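(* Let $p\geq 2$ and let $X_N=I_p(f_N)$, $N\geq 1$, with $f_N\in H^{\odot p}$, be such that $X_N\xrightarrow[N\to\infty]{(d)}N(0,\sigma^2)$ with $\sigma^2>0$. Let $\mathbb Y_N=(Y_{1,N},\ldots,Y_{d,N})$, $N\geq 1$, be a sequence of $d$-dimensional random vectors with components in the $p$-th Wiener chaos, which converges in distribution to $\mathbb Y=(Y_1,\ldots,Y_d)$. Assume that for every $j=1,\ldots,d$, $$\mathbf E[X_NY_{j,N}]\to_{N\to\infty}\rho_j ,$$ and let $\rho=(\rho_1,\ldots,\rho_d)\in\mathbb R^d$. Then $$(X_N,\mathbb Y_N)\xrightarrow[N\to\infty]{(d)}(Z,\mathbb Y),$$ where $Z\sim N(0,\sigma^2)$ and the characteristic function of $(Z,\mathbb Y)$ is given, for every $u\in\mathbb R$, $v\in\mathbb R^d$, by $$\varphi_{(Z,\mathbb Y)}(u,v)=\mathbf E\left[e^{i\langle v,\mathbb Y\rangle}\right]e^{-\frac{\sigma^2u^2}{2}-u\langle\rho,v\rangle}.$$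
   Context: $H$ is a real separable Hilbert space, $H^{\odot n}$ is the symmetric $n$-th tensor power of $H$ (symmetric elements of $H^{\otimes n}$), $(W(h),h\in H)$ is an isonormal Gaussian process on a probability space $(\Omega,\mathcal A,P)$, and $I_n$ is the multiple Wiener–Itô integral of order $n$ with respect to $W$, normalized so that $\mathbf E[I_n(f)I_m(g)]=n!\langle f,g\rangle_{H^{\otimes n}}$ if $n=m$ and $0$ otherwise, for symmetric $f,g$. The $n$-th Wiener chaos is $\{I_n(f): f\in H^{\odot n}\}$. $\langle\cdot,\cdot\rangle$ without subscript is the Euclidean scalar product on $\mathbb R^d$. $\xrightarrow{(d)}$ denotes convergence in distribution. *)

(* Defs.v *)
From HB Require Import structures.
From mathcomp Require Import all_boot all_order all_algebra all_fingroup.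
From mathcomp Require Import complex.
From mathcomp Require Import all_classical all_reals all_analysis.

Set Implicit Arguments.
Unset Strict Implicit.
Unset Printing Implicit Defensive.

Import Order.TTheory GRing.Theory Num.Theory.
Import numFieldNormedType.Exports.

Local Open Scope classical_set_scope.
Local Open Scope ereal_scope.
Local Open Scope ring_scope.

HB.mixin Record CompleteNormedModule_isHilbert (R : realType) (H : Type)
    of CompleteNormedModule R H := {
  ip : H -> H -> R ;
  ipC : forall x y, ip x y = ip y x ;
  ip_linear : forall a x y z, ip (a *: x + y) z = a * ip x z + ip y z ;
  ip_norm : forall x, ip x x = `|x| ^+ 2 }.

#[short(type="hilbertType")]
HB.structure Definition Hilbert (R : realType) :=
  { H of CompleteNormedModule_isHilbert R H & CompleteNormedModule R H }.

Definition separable (T : topologicalType) : Prop :=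
  exists A : set T, countable A /\ dense A.

(* A realization of the Hilbert tensor power H^{(x) n}; it is unique up to a
   canonical isometric isomorphism. [tens h] is h_0 (x) ... (x) h_{n-1}. *)
Record tensor_power (R : realType) (H : hilbertType R) (n : nat) := TensorPower {
  tens_space :> hilbertType R ;
  tens : ('I_n -> H) -> tens_space ;
  tens_multilinear : forall (h : 'I_n -> H) (i : 'I_n) (a : R) (x y : H),
    tens (dfwith h i (a *: x + y)) =
      a *: tens (dfwith h i x) + tens (dfwith h i y) ;
  tens_ip : forall g h : 'I_n -> H,
    ip (tens g) (tens h) = \prod_(i < n) ip (g i) (h i) ;
  tens_dense : dense [set x | exists (m : nat) (c : 'I_m -> R)
    (h : 'I_m -> 'I_n -> H), x = \sum_(k < m) c k *: tens (h k)] }.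

(* The operator U_s permuting the tensor factors, which sends
   [tens h] to [tens (h \o s)], is unitary; so U_s f = g amounts to
   <g, U_s (tens h)> = <f, tens h> for all h. *)
Definition permuted_tensor (R : realType) (H : hilbertType R) (n : nat)
    (K : tensor_power H n) (s : 'S_n) (f g : K) : Prop :=
  forall h : 'I_n -> H, ip g (tens K (fun i => h (s i))) = ip f (tens K h).

Definition symmetric_tensor (R : realType) (H : hilbertType R) (n : nat)
    (K : tensor_power H n) (f : K) : Prop :=
  forall s : 'S_n, permuted_tensor s f f.

(* [normal_prob m s] has standard deviation s and is a junk law for s = 0. *)
Definition normal_law (R : realType) d (T : measurableType d)
    (P : probability T R) (X : T -> R) (s : R) : Prop :=
  forall A : set R, measurable A -> P (X @^-1` A) = normal_prob 0 s A.

Definition centered_gaussian (R : realType) d (T : measurableType d)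
    (P : probability T R) (X : T -> R) : Prop :=
  {ae P, forall w, X w = 0} \/ exists2 s : R, 0 < s & normal_law P X s.

Record isonormal (R : realType) d (T : measurableType d) (P : probability T R)
    (H : hilbertType R) (W : H -> {RV P >-> R}) : Prop := Isonormal {
  isonormal_gaussian : forall (m : nat) (c : 'I_m -> R) (h : 'I_m -> H),
    centered_gaussian P (fun w => \sum_(k < m) c k * W (h k) w) ;
  isonormal_cov : forall g h : H, 'E_P[fun w => W g w * W h w] = (ip g h)%:E }.

(* The monic (probabilists') Hermite polynomials, orthogonal for N(0,1) with
   squared norms n!. *)
Fixpoint hermite (R : realType) (n : nat) : {poly R} :=
  if n is m.+1 then 'X * hermite R m - (hermite R m)^`() else 1.

(* [I] picks a version of the multiple Wiener-Ito integral of each tensor; only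
   its values on symmetric tensors are meaningful, where the three properties
   determine it almost surely since the powers h (x) ... (x) h with |h| = 1
   span a dense subspace of the symmetric tensors. *)
Record multiple_integral (R : realType) d (T : measurableType d)
    (P : probability T R) (H : hilbertType R) (W : H -> {RV P >-> R}) (n : nat)
    (K : tensor_power H n) (I : K -> {RV P >-> R}) : Prop := MultipleIntegral {
  mi_linear : forall (a : R) (f g : K),
    symmetric_tensor f -> symmetric_tensor g ->
    {ae P, forall w, I (a *: f + g) w = a * I f w + I g w} ;
  mi_isometry : forall f g : K, symmetric_tensor f -> symmetric_tensor g ->
    'E_P[fun w => I f w * I g w] = (n`!%:R * ip f g)%:E ;
  mi_hermite : forall h : H, `|h| = 1 ->
    {ae P, forall w, I (tens K (fun=> h)) w = (hermite R n).[W h w]} }.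

Definition wiener_chaos (R : realType) d (T : measurableType d)
    (P : probability T R) (H : hilbertType R) (n : nat) (K : tensor_power H n)
    (I : K -> {RV P >-> R}) : set {RV P >-> R} :=
  [set F | exists2 f : K, symmetric_tensor f & {ae P, forall w, F w = I f w}].

Definition random_vector (R : realType) d (T : measurableType d)
    (P : probability T R) (n : nat) (Y : 'I_n -> {RV P >-> R}) (w : T) :
    'rV[R]_n := \row_j Y j w.

Definition euclidean_dot (R : realType) (n : nat) (u v : 'rV[R]_n) : R :=
  \sum_(j < n) u 0 j * v 0 j.

Definition cvg_in_distribution (R : realType) d (T : measurableType d)
    (P : probability T R) d' (T' : measurableType d') (Q : probability T' R)
    (S : topologicalType) (X : nat -> T -> S) (Y : T' -> S) : Prop :=
  forall phi : S -> R, continuous phi ->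
    (exists M : R, forall x, `|phi x| <= M) ->
    'E_P[fun w => phi (X N w)] @[N --> \oo] --> 'E_Q[fun w => phi (Y w)].

Definition same_law (R : realType) d (T : measurableType d)
    (P : probability T R) d' (T' : measurableType d') (Q : probability T' R)
    (S : topologicalType) (X : T -> S) (Y : T' -> S) : Prop :=
  forall A : set S, <<s [set U : set S | open U] >> A ->
    P (X @^-1` A) = Q (Y @^-1` A).

Definition expi (R : realType) (t : R) : R[i] := Complex (cos t) (sin t).

Definition complex_expectation (R : realType) d (T : measurableType d)
    (P : probability T R) (f : T -> R[i]) : R[i] :=
  Complex (fine 'E_P[fun w => complex.Re (f w)])
          (fine 'E_P[fun w => complex.Im (f w)]).

(* Main.v *)
(** In [L^2], [F = X_N] and [G = <v, Y_N>] are approximated by finite sums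
    [sum_k a_k H_p (W h_k)] of Hermite polynomials with [|h_k| = 1], since the powers
    [h (x) ... (x) h] are total among the symmetric tensors.  Hypercontractivity
    bounds [E F^6] by a multiple of [(E F^2)^3], so that convergence in law bounds all
    the second moments and gives [E F^2 -> sigma^2] and [E F^4 -> 3 sigma^4].  The
    diagram formula writes the fourth cumulant of a chaos as a positive combination of
    squared norms of contractions, and the Cauchy-Schwarz inequality then bounds
    the variance of [<DF, DG>] by a multiple of the square root of the product of the
    fourth cumulants of [F] and [G].  As the cumulant of [F] tends to [0] and that of [G]
    is bounded, [<DF, DF>] and [<DF, DG>], divided by [p], become the constants [sigma^2]
    and [<rho, v>].  Integration by parts therefore gives, for
    [A u = E cos (u F + G + t)], the approximate equation
    [A' u = - (u sigma^2 + <rho, v>) A u], whence the Gaussian factor.  The limit law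
    itself is an ultrafilter limit of the laws of [(X_N, Y_N)], each law being encoded by the
    joint law of countably many bits; it is realized on [[0, 1]]. *)
Require Import Defs.
From HB Require Import structures.
From mathcomp Require Import all_boot all_order all_algebra all_fingroup.
From mathcomp Require Import complex.
From mathcomp Require Import all_classical all_reals all_analysis.
From mathcomp Require Import measurable_realfun.
From mathcomp Require Import ring lra.

Set Implicit Arguments.
Unset Strict Implicit.
Unset Printing Implicit Defensive.

Import Order.TTheory GRing.Theory Num.Theory.
Import numFieldNormedType.Exports.

Local Open Scope classical_set_scope.
Local Open Scope ereal_scope.
Local Open Scope ring_scope.

(** * Expectations and moments *)

(** Working with finite Hermite sums keeps the Malliavin calculus finite-dimensional: derivatives
    are taken only in the directions [h_k], and integration by parts follows from the Gaussian
    characteristic function alone. The sixth moment appears because [E F^4 -> 3 sigma^4] requires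
    control of one power beyond the fourth. The variance bound contains the product of two fourth
    cumulants, so it is enough that one of them vanishes; this is why only [X_N] has to be
    asymptotically Gaussian. Characteristic functions are handled as [E cos (... + t)] with a free
    phase [t], so that one real identity carries the real part ([t = 0]) and the imaginary part
    ([t = - pi / 2]). The last obstacle is existence: the limit of the characteristic functions is
    explicit, but that it belongs to a law must come from compactness, and convergence must then be
    extended from cosines to bounded continuous functions. Both steps rest on the uniform bound on
    second moments. *)

Lemma quad_form_cauchy (R : realType) (a b c : R) :
  (forall s t, 0 <= s ^+ 2 * a + 2 * s * t * b + t ^+ 2 * c) -> b ^+ 2 <= a * c.
Proof.
move=> H.
have a0 : 0 <= a by have := H 1 0; rewrite expr1n expr0n !(mulr0, mul0r, mul1r, addr0).
have [a_eq0|a_neq0] := eqVneq a 0.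
  rewrite a_eq0 mul0r; have [->|b0] := eqVneq b 0; first by rewrite expr0n.
  (* With [a = 0] the form is affine in [s]; this [s] gives it the value [-1]. *)
  have := H (- (c + 1) / (2 * b)) 1; rewrite a_eq0 mulr0 add0r mulr1 expr1n mul1r.
  rewrite (_ : 2 * _ * b + c = -1); last by field.
  by rewrite oppr_ge0 ler10.
(* At [(- b, a)] the form equals [a (a c - b^2)], and [a > 0]. *)
have := H (- b) a; rewrite (_ : _ + _ = a * (a * c - b ^+ 2)); last by ring.
by rewrite pmulr_rge0 ?subr_ge0// lt_def a_neq0.
Qed.

Section expectation.
Context (R : realType) d (T : measurableType d) (P : probability T R).
Implicit Types f g h : T -> R.

(** An infinite integral is sent to [0] by the conversion to [R], so the linearity lemmas carry
    integrability hypotheses. *)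
Definition Ex f : R := \int[P]_w f w.

Definition intg f := P.-integrable setT (EFin \o f).

Lemma ExE f : Ex f = fine 'E_P[f]. Proof. by rewrite unlock. Qed.

Lemma eq_Ex f g : f =1 g -> Ex f = Ex g.
Proof. by move=> fg; rewrite (funext fg). Qed.

Lemma intg_measurable f : intg f -> measurable_fun setT f.
Proof. by move=> /integrableP[/measurable_EFinP]. Qed.

Lemma expectation_Ex f : intg f -> 'E_P[f] = (Ex f)%:E.
Proof.
by move=> fi; rewrite ExE fineK// unlock integrable_fin_num.
Qed.

Lemma intg_le f g : measurable_fun setT f -> (forall w, `|f w| <= g w) ->
  intg g -> intg f.
Proof.
move=> mf fg gi; apply: (le_integrable measurableT _ _ gi).
  exact/measurable_EFinP.
by move=> w _ /=; rewrite lee_fin (le_trans (fg w))// ler_norm.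
Qed.

Lemma intg_cst c : intg (fun=> c).
Proof. exact: finite_measure_integrable_cst. Qed.

Lemma intgD f g : intg f -> intg g -> intg (fun w => f w + g w).
Proof. exact: integrableD. Qed.

Lemma intgZ c f : intg f -> intg (fun w => c * f w).
Proof. exact: integrableZl. Qed.

Lemma intgN f : intg f -> intg (fun w => - f w).
Proof. exact: integrableN. Qed.

Lemma intgB f g : intg f -> intg g -> intg (fun w => f w - g w).
Proof. by move=> fi gi; apply: intgD => //; exact: intgN. Qed.

Lemma intg_norm f : intg f -> intg (fun w => `|f w|).
Proof. exact: integrable_norm. Qed.

Lemma intg_bounded f M : measurable_fun setT f -> (forall w, `|f w| <= M) ->
  intg f.
Proof. by move=> mf fM; apply: (intg_le mf fM); exact: intg_cst. Qed.

Lemma intg_sum (J : Type) (s : seq J) (F : J -> T -> R) :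
  (forall j, intg (F j)) -> intg (fun w => \sum_(j <- s) F j w).
Proof.
move=> Fi; elim: s => [|j s IHs].
  by rewrite (_ : (fun _ => _) = fun=> 0);
    [exact: intg_cst|apply/funext => w; rewrite big_nil].
rewrite (_ : (fun _ => _) = fun w => F j w + \sum_(i <- s) F i w).
  exact: intgD.
by apply/funext => w; rewrite big_cons.
Qed.

Lemma ExD f g : intg f -> intg g -> Ex (fun w => f w + g w) = Ex f + Ex g.
Proof. by move=> fi gi; rewrite /Ex RintegralD. Qed.

Lemma ExB f g : intg f -> intg g -> Ex (fun w => f w - g w) = Ex f - Ex g.
Proof. by move=> fi gi; rewrite /Ex RintegralB. Qed.

Lemma ExZ c f : intg f -> Ex (fun w => c * f w) = c * Ex f.
Proof. by move=> fi; rewrite /Ex RintegralZl. Qed.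

Lemma Ex_cst c : Ex (fun=> c) = c.
Proof. by rewrite ExE expectation_cst. Qed.

Lemma ExN f : intg f -> Ex (fun w => - f w) = - Ex f.
Proof.
move=> fi; rewrite -[RHS]mulN1r -ExZ//; apply: eq_Ex => w; by rewrite mulN1r.
Qed.

Lemma Ex_sum (J : Type) (s : seq J) (F : J -> T -> R) :
  (forall j, intg (F j)) ->
  Ex (fun w => \sum_(j <- s) F j w) = \sum_(j <- s) Ex (F j).
Proof.
move=> Fi; elim: s => [|j s IHs].
  rewrite big_nil -[RHS](Ex_cst 0); apply: eq_Ex => w; by rewrite big_nil.
rewrite big_cons -IHs -ExD//; last exact: intg_sum.
by apply: eq_Ex => w; rewrite big_cons.
Qed.

Lemma Ex_ge0 f : (forall w, 0 <= f w) -> 0 <= Ex f.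
Proof. by move=> f0; apply: Rintegral_ge0. Qed.

Lemma Ex_le f g : intg f -> intg g -> (forall w, f w <= g w) -> Ex f <= Ex g.
Proof. by move=> fi gi fg; apply: le_Rintegral. Qed.

Lemma Ex_norm f : intg f -> `|Ex f| <= Ex (fun w => `|f w|).
Proof. by move=> fi; apply: le_normr_Rintegral. Qed.

Lemma Ex_norm_le f g : intg f -> intg g -> (forall w, `|f w| <= g w) ->
  `|Ex f| <= Ex g.
Proof.
move=> fi gi fg; rewrite (le_trans (Ex_norm fi))// Ex_le//.
exact: intg_norm.
Qed.

Lemma ae_eq_Ex f g : measurable_fun setT f -> measurable_fun setT g ->
  {ae P, forall w, f w = g w} -> Ex f = Ex g.
Proof.
move=> mf mg fg; rewrite /Ex /Rintegral; congr fine; apply: ae_eq_integral => //.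
- exact/measurable_EFinP.
- exact/measurable_EFinP.
- by apply: filterS fg => w /= ->.
Qed.

Lemma ae_eq_intg f g : measurable_fun setT f ->
  {ae P, forall w, f w = g w} -> intg g -> intg f.
Proof.
move=> mf fg gi; apply/integrableP; split; first exact/measurable_EFinP.
have /integrableP[mg] := gi; apply: le_lt_trans; rewrite le_eqVlt; apply/orP; left.
apply/eqP; apply: ae_eq_integral => //.
- by apply: measurableT_comp => //; exact/measurable_EFinP.
- exact: measurableT_comp.
- by apply: filterS fg => w /= ->.
Qed.

Lemma Ex_sqr_cauchy f g : intg (fun w => f w ^+ 2) -> intg (fun w => g w ^+ 2) ->
  intg (fun w => f w * g w) ->
  Ex (fun w => f w * g w) ^+ 2 <= Ex (fun w => f w ^+ 2) * Ex (fun w => g w ^+ 2).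
Proof.
move=> f2 g2 fg; set a := Ex (fun w => f w ^+ 2); set b := Ex (fun w => f w * g w).
set c := Ex (fun w => g w ^+ 2).
have H (s t : R) : 0 <= s ^+ 2 * a + 2 * s * t * b + t ^+ 2 * c.
  have <- : Ex (fun w => s ^+ 2 * f w ^+ 2 + 2 * s * t * (f w * g w) +
      t ^+ 2 * g w ^+ 2) = s ^+ 2 * a + 2 * s * t * b + t ^+ 2 * c.
    by rewrite ExD ?ExD ?ExZ//; do ?[apply: intgD]; exact: intgZ.
  apply: Ex_ge0 => w.
  rewrite [leRHS](_ : _ = (s * f w + t * g w) ^+ 2); last by ring.
  exact: sqr_ge0.
exact: quad_form_cauchy H.
Qed.

(** Finiteness of all absolute moments, unlike integrability, is stable under products; polynomial
    and trigonometric expressions in Gaussian variables are then integrable by [mom_tac]. *)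
Definition mom f := measurable_fun setT f /\ forall n, intg (fun w => `|f w| ^+ n).

Lemma mom_measurable f : mom f -> measurable_fun setT f. Proof. by case. Qed.

Lemma mom_intg f : mom f -> intg f.
Proof.
case=> mf fi; apply: (intg_le (g := fun w => `|f w| ^+ 1)) => // w.
Qed.

Lemma mom_le f g : measurable_fun setT f -> (forall w, `|f w| <= g w) ->
  mom g -> mom f.
Proof.
move=> mf fg [mg gi]; split=> // n.
apply: (intg_le (g := fun w => `|g w| ^+ n)) => //.
  by apply: measurable_funX; exact: measurableT_comp.
move=> w; rewrite normrX normr_id lerXn2r ?nnegrE//.
by rewrite (le_trans (fg w))// ler_norm.
Qed.

Lemma mom_cst c : mom (fun=> c).
Proof. by split=> // n; exact: intg_cst. Qed.

Lemma mom_bounded f M : measurable_fun setT f -> (forall w, `|f w| <= M) -> mom f.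
Proof. by move=> mf fM; apply: (mom_le mf fM); exact: mom_cst. Qed.

Lemma mom_norm f : mom f -> mom (fun w => `|f w|).
Proof.
case=> mf fi; split=> [|n]; first exact: measurableT_comp.
by under eq_fun do rewrite normr_id.
Qed.

Lemma momD f g : mom f -> mom g -> mom (fun w => f w + g w).
Proof.
move=> [mf fi] [mg gi]; split; first exact: measurable_funD.
move=> n; apply: (intg_le (g := fun w => 2 ^+ n * (`|f w| ^+ n + `|g w| ^+ n))).
- apply: measurable_funX; apply: measurableT_comp => //.
  exact: measurable_funD.
- move=> w; rewrite normrX normr_id.
  wlog fg : f g mf fi mg gi / `|f w| <= `|g w|.
    move=> H; have [/H->//|/ltW/H] := leP `|f w| `|g w|.
    by rewrite addrC (addrC (`|g w| ^+ n)); exact.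
  rewrite (@le_trans _ _ ((2 * `|g w|) ^+ n))//.
    rewrite lerXn2r ?nnegrE ?mulr_ge0// (le_trans (ler_normD _ _))//.
    by rewrite mulr_natl mulr2n lerD2r.
  by rewrite exprMn ler_pM2l ?exprn_gt0// lerDr exprn_ge0.
- by apply: intgZ; exact: intgD.
Qed.

Lemma momM f g : mom f -> mom g -> mom (fun w => f w * g w).
Proof.
move=> [mf fi] [mg gi]; split; first exact: measurable_funM.
move=> n; apply: (intg_le (g := fun w => `|f w| ^+ (2 * n) + `|g w| ^+ (2 * n))).
- apply: measurable_funX; apply: measurableT_comp => //.
  exact: measurable_funM.
- move=> w; rewrite normrX normr_id normrM exprMn mulnC !exprM.
  set a := `|f w| ^+ n; set b := `|g w| ^+ n.
  have a0 : 0 <= a by exact: exprn_ge0.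
  have b0 : 0 <= b by exact: exprn_ge0.
  nra.
- exact: intgD.
Qed.

Lemma momZ c f : mom f -> mom (fun w => c * f w).
Proof. by move=> ?; apply: momM => //; exact: mom_cst. Qed.

Lemma momN f : mom f -> mom (fun w => - f w).
Proof. by move=> /(momZ (-1)); under eq_fun do rewrite mulN1r. Qed.

Lemma momX f n : mom f -> mom (fun w => f w ^+ n).
Proof.
move=> fi; elim: n => [|n IHn]; first exact: mom_cst.
under eq_fun do rewrite exprS.
exact: momM.
Qed.

Lemma mom_sum (J : Type) (s : seq J) (F : J -> T -> R) :
  (forall j, mom (F j)) -> mom (fun w => \sum_(j <- s) F j w).
Proof.
move=> Fi; elim: s => [|j s IHs].
  by under eq_fun do rewrite big_nil; exact: mom_cst.
by under eq_fun do rewrite big_cons; exact: momD.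
Qed.

Lemma mom_cos f : measurable_fun setT f -> mom (fun w => cos (f w)).
Proof.
move=> mf; apply: (@mom_bounded _ 1).
  by apply: measurableT_comp => //; apply: continuous_measurable_fun; exact: continuous_cos.
by move=> w; rewrite ler_norml cos_geN1 cos_le1.
Qed.

Lemma mom_sin f : measurable_fun setT f -> mom (fun w => sin (f w)).
Proof.
move=> mf; apply: (@mom_bounded _ 1).
  by apply: measurableT_comp => //; apply: continuous_measurable_fun; exact: continuous_sin.
by move=> w; rewrite ler_norml sin_geN1 sin_le1.
Qed.

End expectation.

Ltac mom_tac := repeat first [ assumption | exact: mom_cst | apply: momN
  | apply: momD | apply: momX | apply: momM | apply: mom_norm
  | apply: mom_sum => ? | exact: mom_cos | exact: mom_sin ].

Ltac intg_tac := first [ assumption | by apply: mom_intg; mom_tac ].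

(** * One-variable calculus *)

Section real_calculus.
Context (R : realType).
Implicit Types (f df : R -> R) (a b c h t u x y : R).

Lemma MVT_norm f df a b : (forall x, is_derive x 1 f (df x)) ->
  exists2 c, `|c - a| <= `|b - a| & f b - f a = df c * (b - a).
Proof.
move=> fd.
have fc x y : {within `[x, y], continuous f}.
  by apply: derivable_within_continuous => z _; have [] := fd z.
have [ab|/ltW ba] := leP a b.
  have [c] := MVT_segment ab (fun x _ => fd x) (fc a b).
  rewrite in_itv/= => /andP[ac cb] ->; exists c => //.
  by rewrite !ger0_norm ?subr_ge0// lerD2r.
have [c] := MVT_segment ba (fun x _ => fd x) (fc b a).
rewrite in_itv/= => /andP[bc ca] E; exists c.
  by rewrite !ler0_norm ?subr_le0// lerN2 lerD2r.
by rewrite -opprB E -mulrN opprB.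
Qed.

Lemma le_norm_sub_cos a b : `|cos b - cos a| <= `|b - a|.
Proof.
have [c _ ->] := @MVT_norm (@cos R) (fun x => - sin x) a b.
by rewrite normrM normrN ler_piMl// ler_norml sin_geN1 sin_le1.
Qed.

Lemma le_norm_sub_sin a b : `|sin b - sin a| <= `|b - a|.
Proof.
have [c _ ->] := @MVT_norm (@sin R) cos a b.
by rewrite normrM ler_piMl// ler_norml cos_geN1 cos_le1.
Qed.

Lemma cos_quadratic a h : `|cos (a + h) - cos a + h * sin a| <= h ^+ 2.
Proof.
have [c ca] := @MVT_norm (@cos R) (fun x => - sin x) a (a + h).
rewrite [a + h - a]addrC addKr => ->; rewrite -[h ^+ 2]ger0_norm ?sqr_ge0//.
rewrite (_ : _ + _ = h * (sin a - sin c)); last by ring.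
rewrite normrM expr2 normrM ler_wpM2l// (le_trans (le_norm_sub_sin _ _))//.
by rewrite distrC; move: ca; rewrite [a + h - a]addrC addKr.
Qed.

Lemma sin_quadratic a h : `|sin (a + h) - sin a - h * cos a| <= h ^+ 2.
Proof.
have [c ca] := @MVT_norm (@sin R) cos a (a + h).
rewrite [a + h - a]addrC addKr => ->; rewrite -[h ^+ 2]ger0_norm ?sqr_ge0//.
rewrite (_ : _ - _ = h * (cos c - cos a)); last by ring.
rewrite normrM expr2 normrM ler_wpM2l// (le_trans (le_norm_sub_cos _ _))//.
by move: ca; rewrite [a + h - a]addrC addKr.
Qed.

(** This replaces differentiation under the integral sign: a pointwise Taylor bound of second order
    integrates to a bound of the same kind for the expectation. *)
Lemma is_derive_quadratic f u l C :
  (forall h, `|f (u + h) - f u - h * l| <= C * h ^+ 2) -> is_derive u 1 f l.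
Proof.
move=> H.
have fl : h^-1 *: ((f \o shift u) (h *: (1 : R)) - f u) @[h --> 0^'] --> l.
  apply/cvgrPdist_le => e e0.
  near=> h.
  have h0 : h != 0 by near: h; exact: nbhs_dnbhs_neq.
  have hn : 0 < `|h| by rewrite normr_gt0.
  rewrite /= /GRing.scale/= mulr1 -(ler_pM2l hn) -normrM mulrBr mulrA divff// mul1r.
  rewrite distrC (addrC h u) (le_trans (H h))//.
  rewrite (@le_trans _ _ (`|C| * `|h| ^+ 2))//.
    by rewrite -normrX -normrM ler_norm.
  rewrite expr2 mulrCA ler_pM2l//.
  rewrite (@le_trans _ _ ((`|C| + 1) * `|h|))//.
    by rewrite ler_pM2r// lerDl.
  rewrite -ler_pdivlMl ?ltr_wpDl// mulrC.
  near: h; apply: dnbhs0_le; rewrite divr_gt0// ltr_wpDl//.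
apply: DeriveDef; last exact/cvg_lim.
by apply/cvg_ex; exists l.
Unshelve. all: by end_near. Qed.

(** Divide by [h] and let it tend to [0]. The lemma identifies two first-order coefficients found
    for one function. *)
Lemma quadratic_bound_eq a b C :
  (forall h, 0 < h -> h <= 1 -> `|h * a - h * b| <= C * h ^+ 2) -> a = b.
Proof.
move=> H; apply/eqP; rewrite -subr_eq0; apply/negPn/negP => ab.
have C0 : 0 <= C by have := H 1 ltr01 (lexx 1); rewrite expr1n mulr1; apply: le_trans.
(* Small enough that [C h] is below [|a - b| / 2]. *)
pose h := Num.min 1 (`|a - b| / (2 * (C + 1))).
have d0 : 0 < `|a - b| by rewrite normr_gt0.
have h0 : 0 < h.
  by rewrite lt_min ltr01 divr_gt0// mulr_gt0// ltr_pwDr.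
have h1 : h <= 1 by rewrite ge_min lexx.
have hd : h * (2 * (C + 1)) <= `|a - b|.
  by rewrite -ler_pdivlMr ?ge_min ?lexx ?orbT// mulr_gt0// ltr_pwDr.
have := H h h0 h1; rewrite -mulrBr normrM gtr0_norm// expr2 mulrCA ler_pM2l//.
nra.
Qed.

Lemma eq_of_derive0 f : (forall x, is_derive x 1 f 0) -> forall a b, f a = f b.
Proof.
move=> fd a b; have [c _] := @MVT_norm f (fun=> 0) b a fd.
by rewrite mul0r => /eqP; rewrite subr_eq0 => /eqP.
Qed.

End real_calculus.

(** * The normal distribution *)

Section expectation_derivative.
Context (R : realType) d (T : measurableType d) (P : probability T R).
Implicit Types Z X G : T -> R.

Let quad Z X G (h : R) (f g : R -> R) u :
  mom P Z -> mom P X -> (forall x, mom P (fun w => f (x * X w + G w))) ->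
  (forall x, mom P (fun w => g (x * X w + G w))) ->
  (forall a k, `|f (a + k) - f a - k * g a| <= k ^+ 2) ->
  `|Ex P (fun w => Z w * f ((u + h) * X w + G w)) - Ex P (fun w => Z w * f (u * X w + G w))
     - h * Ex P (fun w => Z w * X w * g (u * X w + G w))|
   <= Ex P (fun w => `|Z w| * X w ^+ 2) * h ^+ 2.
Proof.
move=> Zm Xm fm gm fg.
have fi x : mom P (fun w => Z w * f (x * X w + G w)) by exact: momM.
have gi : mom P (fun w => Z w * X w * g (u * X w + G w)).
  by apply: momM => //; exact: momM.
rewrite -ExZ; last by intg_tac.
rewrite -ExB; [|by intg_tac|by intg_tac].
rewrite -ExB; [|by intg_tac|by intg_tac].
rewrite mulrC -ExZ; last by intg_tac.
apply: Ex_norm_le; [by intg_tac|by intg_tac|].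
move=> w; rewrite [X in `|X|](_ : _ = Z w * (f (u * X w + G w + h * X w)
      - f (u * X w + G w) - (h * X w) * g (u * X w + G w))); last first.
    by rewrite (_ : (u + h) * X w + G w = u * X w + G w + h * X w); ring.
  rewrite normrM mulrCA ler_wpM2l// (le_trans (fg _ _))//.
  by rewrite exprMn.
Qed.

Lemma is_derive_Ex_cos Z X G (u : R) : mom P Z -> mom P X -> measurable_fun setT G ->
  is_derive u 1 (fun u => Ex P (fun w => Z w * cos (u * X w + G w)))
    (- Ex P (fun w => Z w * X w * sin (u * X w + G w))).
Proof.
move=> Zm Xm mG.
have mX x : measurable_fun setT (fun w => x * X w + G w).
  apply: measurable_funD => //; apply: measurable_funM => //.
  exact: mom_measurable Xm.
rewrite -ExN; last first.
  by apply: mom_intg; do ?[apply: momM => //]; exact: mom_sin.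
under [X in is_derive _ _ _ X]eq_Ex do rewrite -mulrN.
apply: is_derive_quadratic => h; apply: (@quad Z X G h cos (fun x => - sin x) u) => //.
- by move=> x; exact: mom_cos.
- by move=> x; apply: momN; exact: mom_sin.
- by move=> a k; rewrite mulrN opprK; exact: cos_quadratic.
Qed.

End expectation_derivative.

Section normal.
Context (R : realType) (s : R).
Hypothesis s0 : s != 0.
Local Notation N := (normal_prob (0 : R) s).
Local Notation mu := (@lebesgue_measure R).
Local Notation pdf := (normal_pdf 0 s).

Let mpdf : measurable_fun setT pdf. Proof. exact: measurable_normal_pdf. Qed.

(** The Radon-Nikodym derivative is determined only up to null sets; it agrees with [pdf] almost
    everywhere because both integrate to [N E] over every measurable [E]. *)
Lemma ge0_integral_normal_prob (f : R -> \bar R) : measurable_fun setT f ->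
  (forall x, 0 <= f x)%E ->
  (\int[N]_x f x = \int[mu]_x (f x * (pdf x)%:E))%E.
Proof.
move=> mf f0.
have Nmu : N `<< mu by exact: normal_prob_dominates.
rewrite -(@Radon_Nikodym_SigmaFinite.change_of_variables _ _ _ N mu)//.
apply: ae_eq_integral => //.
- apply: emeasurable_funM => //.
  exact: measurable_int (Radon_Nikodym_SigmaFinite.f_integrable Nmu).
- by apply: emeasurable_funM => //; exact/measurable_EFinP.
- have : ae_eq mu setT (Radon_Nikodym_SigmaFinite.f N mu) (EFin \o pdf).
    apply: integral_ae_eq => //.
    + exact: Radon_Nikodym_SigmaFinite.f_integrable.
    + exact/measurable_EFinP.
    + by move=> E _ mE; rewrite -Radon_Nikodym_SigmaFinite.f_integral.
  by apply: filterS => x /= H _; rewrite H.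
Qed.

Lemma intg_normal (f : R -> R) : measurable_fun setT f ->
  intg N f <-> mu.-integrable setT (EFin \o (fun x => f x * pdf x)).
Proof.
move=> mf.
have E : (\int[N]_x `|(f x)%:E| = \int[mu]_x `|(f x * pdf x)%:E|)%E.
  rewrite ge0_integral_normal_prob//; last first.
    by apply/measurable_EFinP; exact: measurableT_comp.
  by apply: eq_integral => x _; rewrite /= normrM EFinM (ger0_norm (normal_pdf_ge0 _ _ _)).
split=> /integrableP[_ fi]; apply/integrableP; split.
- by apply/measurable_EFinP; exact: measurable_funM.
- by rewrite /comp/= -E.
- exact/measurable_EFinP.
- by rewrite /comp/= E.
Qed.

Lemma Ex_normal (f : R -> R) : intg N f -> Ex N f = \int[mu]_x (f x * pdf x).
Proof.
move=> fi; have mf := intg_measurable fi.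
have pos (g : R -> R) : (forall x, 0 <= g x) -> intg N g -> Ex N g = \int[mu]_x (g x * pdf x).
  move=> g0 gi; rewrite /Ex /Rintegral ge0_integral_normal_prob//.
  by apply/measurable_EFinP; exact: (intg_measurable gi).
have ni : intg N (fun x => `|f x|) by exact: intg_norm.
have di : intg N (fun x => f x + `|f x|) by exact: intgD.
(* The signed [f] is the difference of the nonnegative functions [f + |f|] and [|f|]. *)
transitivity (Ex N (fun x => f x + `|f x|) - Ex N (fun x => `|f x|)).
  by rewrite ExD// addrK.
have d0 x : 0 <= f x + `|f x| by rewrite -lerBlDl sub0r ler_normr lexx orbT.
rewrite !pos//.
rewrite -RintegralB//; last 2 first.
- by apply/(intg_normal (intg_measurable di)).
- by apply/(intg_normal (intg_measurable ni)).
by apply: eq_Rintegral => x _; rewrite mulrDl addrK.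
Qed.

(** The exponents of the densities with deviations [s] and [2 s] differ by
    [y = (1/2 - 1/8) x^2 / s^2], and [y^(k+1) <= (k+1)! e^y] absorbs the power. The wider density is
    both integrable and bounded, which serves moments and boundary terms. *)
Lemma normal_pdf_decay k : exists C, forall x : R,
  x ^+ k.+1.*2 * pdf x <= C * normal_pdf 0 (2 * s) x.
Proof.
have s20 : 0 < s ^+ 2 by rewrite exprn_even_gt0.
have s21 : 2 * s != 0 by rewrite mulf_neq0// pnatr_eq0.
pose p := normal_peak s; pose p2 := normal_peak (2 * s).
have pp : 0 < p by exact: normal_peak_gt0.
have pp2 : 0 < p2 by exact: normal_peak_gt0.
exists ((8 / 3 * s ^+ 2) ^+ k.+1 * k.+1`!%:R * p / p2) => x.
rewrite !normal_pdfE// /normal_fun !subr0 -/p -/p2.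
set y := 3 / 8 * x ^+ 2 / s ^+ 2.
have y0 : 0 <= y by rewrite /y divr_ge0 ?sqr_ge0// mulr_ge0 ?sqr_ge0.
have yk : y ^+ k.+1 <= k.+1`!%:R * expR y.
  rewrite -ler_pdivrMl ?ltr0n ?fact_gt0// mulrC.
  by rewrite (le_trans _ (expR_ge1Dxn k y0))// lerDr.
have -> : x ^+ k.+1.*2 = (8 / 3 * s ^+ 2) ^+ k.+1 * y ^+ k.+1.
  by rewrite -mul2n exprM -exprMn /y; congr (_ ^+ _); field.
have -> : expR (- x ^+ 2 / ((2 * s) ^+ 2 *+ 2)) = expR y * expR (- x ^+ 2 / (s ^+ 2 *+ 2)).
  rewrite -expRD; congr expR; rewrite /y; by field.
rewrite [leRHS](_ : _ = (8 / 3 * s ^+ 2) ^+ k.+1 * (k.+1`!%:R * expR y) * (p *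
   expR (- x ^+ 2 / (s ^+ 2 *+ 2)))); last by field; rewrite ?gt_eqF.
rewrite ler_wpM2r ?mulr_ge0 ?expR_ge0 ?(ltW pp)// ler_wpM2l// exprn_ge0//.
by rewrite mulr_ge0// ltW.
Qed.

Lemma mom_normal : mom N (fun x => x).
Proof.
split=> // n.
apply: (@intg_le _ _ _ N (fun x : R => `|x| ^+ n) (fun x : R => 1 + x ^+ n.+1.*2)).
- apply: (@measurable_funX _ _ _ setT (fun x : R => `|x|)); exact: measurableT_comp.
- move=> x; rewrite normrX normr_id -mul2n exprM -[x ^+ 2]ger0_norm ?sqr_ge0// normrX -exprM.
  have [x1|/ltW x1] := leP `|x| 1.
    by rewrite (le_trans (exprn_ile1 _ (normr_ge0 x) x1))// lerDl.
  rewrite (@le_trans _ _ (`|x| ^+ (2 * n.+1)))//; last by rewrite lerDr.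
  by apply: ler_weXn2l => //; rewrite mul2n -addnn addSn ltnW// ltnS leq_addr.
- apply: intgD; first exact: intg_cst.
  have [C CH] := normal_pdf_decay n.
  apply/intg_normal; first exact: exprn_measurable.
  apply: (@le_integrable _ _ _ mu _ measurableT (EFin \o (fun x : R => x ^+ n.+1.*2 * pdf x)) (EFin \o (fun x => C * normal_pdf 0 (2 * s) x))).
  + by apply/measurable_EFinP; apply: measurable_funM => //; exact: exprn_measurable.
  + move=> x _ /=; rewrite lee_fin ger0_norm; last first.
      by rewrite mulr_ge0 ?normal_pdf_ge0// exprn_even_ge0// odd_double.
    by rewrite (le_trans (CH x))// ler_norm.
  + exact: (@integrableZl _ _ _ mu setT measurableT C _ (integrable_normal_pdf 0 (2 * s))).
Qed.

Lemma is_derive_normal_pdf (x : R) : is_derive x 1 pdf (- (x / s ^+ 2) * pdf x).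
Proof.
rewrite normal_pdfE//.
have s20 : s ^+ 2 != 0 by rewrite sqrf_eq0.
have -> : (fun y => normal_peak s * normal_fun 0 s y) =
    (fun y => normal_peak s * expR (y ^+ 2 * (- (s ^+ 2 *+ 2)^-1))).
  by apply/funext => y; rewrite /normal_fun subr0 mulNr mulrN.
rewrite /normal_fun subr0 [- x ^+ 2 / _](_ : _ = x ^+ 2 * (- (s ^+ 2 *+ 2)^-1)); last first.
  by rewrite mulNr mulrN.
apply: is_derive_eq.
rewrite /GRing.scale/=.
by field.
Qed.

(** The derivative of [F = f pdf] is [h pdf]. Its integral over [[-(n+1), n+1]] is a difference of
    boundary values, which tends to [0], while dominated convergence gives [E h]. *)
Lemma normal_ibp (f df : R -> R) k C :
  (forall x : R, is_derive x 1 f (df x)) -> continuous df ->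
  (forall x, `|f x| <= C * (1 + x ^+ k.*2)) -> intg N df ->
  s ^+ 2 * Ex N df = Ex N (fun x => x * f x).
Proof.
move=> fd cdf fC idf.
have s20 : s ^+ 2 != 0 by rewrite sqrf_eq0.
have cf : continuous f.
  by move=> x; apply/differentiable_continuous/derivable1_diffP; have [] := fd x.
have mf : measurable_fun setT f by exact: continuous_measurable_fun.
have fm : mom N f.
  apply: (@mom_le _ _ _ N f (fun x : R => C * (1 + x ^+ k.*2)) mf fC).
  by have ? := mom_normal; mom_tac.
have C0 : 0 <= C.
  have := le_trans (normr_ge0 _) (fC 1); rewrite expr1n; lra.
pose F x := f x * pdf x; pose h x := df x - x / s ^+ 2 * f x.
have hi : intg N h.
  apply: intgB => //; apply: mom_intg; do ?[apply: momM => //]; last exact: mom_cst.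
  exact: mom_normal.
have mh : measurable_fun setT h by exact: intg_measurable hi.
have Fd (x : R) : is_derive x 1 F (h x * pdf x).
  have := fd x; have := is_derive_normal_pdf x => ? ?.
  by apply: is_derive_eq; rewrite /h /GRing.scale/=; ring.
have [C1 H1] := normal_pdf_decay 0.
have [C2 H2] := normal_pdf_decay k.
have s21 : 2 * s != 0 by rewrite mulf_neq0// pnatr_eq0.
(* Decay of [F] like [1 / x^2] bounds the boundary terms by [2 B / (n + 1)]. *)
have [B HB] : exists B, forall x, x ^+ 2 * `|F x| <= B.
  exists (C * (`|C1| + `|C2|) * normal_peak (2 * s)) => x.
  rewrite /F normrM (ger0_norm (normal_pdf_ge0 _ _ _)).
  rewrite (@le_trans _ _ (C * (x ^+ 2 * pdf x + x ^+ k.+1.*2 * pdf x)))//.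
    rewrite -mulrDl mulrA mulrA ler_wpM2r ?normal_pdf_ge0//.
    rewrite mulrC (le_trans (ler_wpM2r (sqr_ge0 x) (fC x)))//.
    by rewrite -mulrA ler_wpM2l// mulrDl mul1r lerD2l -exprD addnC doubleS.
  rewrite -mulrA ler_wpM2l//.
  rewrite (le_trans (lerD (H1 x) (H2 x)))// -mulrDl.
  rewrite (@le_trans _ _ ((`|C1| + `|C2|) * normal_pdf 0 (2 * s) x))//.
    by rewrite ler_wpM2r ?normal_pdf_ge0// lerD ?ler_norm.
  by rewrite ler_wpM2l ?addr_ge0// normal_pdf_ub.
have B0 : 0 <= B by have := HB 0; rewrite expr0n mul0r.
pose g_ (n : nat) := (fun x => h x * pdf x) \_ `[- n.+1%:R, n.+1%:R].
have cg : continuous (fun x => h x * pdf x).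
  move=> x; apply: cvgM; last exact: continuous_normal_pdf.
  apply: cvgB; first exact: cdf.
  by apply: cvgM; [apply: cvgM; [exact: cvg_id|exact: cvg_cst]|exact: cf].
have gE n : (\int[mu]_x (g_ n x)%:E = (F n.+1%:R - F (- n.+1%:R))%:E)%E.
  have nn : - n.+1%:R < n.+1%:R :> R by rewrite gtrN// ltr0n.
  rewrite EFinB -(@continuous_FTC2 _ (fun x => h x * pdf x) F _ _ nn).
  - by rewrite [RHS]integral_mkcond; apply: eq_integral => x _; rewrite restrict_EFin.
  - exact: continuous_subspaceT.
  - have cF (x : R) : {for x, continuous F}.
      by apply/differentiable_continuous/derivable1_diffP; have [] := Fd x.
    split.
    + by move=> x _; have [] := Fd x.
    + exact: cvg_at_right_filter (cF _).
    + exact: cvg_at_left_filter (cF _).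
  - by move=> x _; rewrite derive1E; have [_ ->] := Fd x.
have hmu : mu.-integrable setT (EFin \o (fun x => h x * pdf x)).
  by apply/intg_normal.
have [] := @dominated_convergence _ _ _ mu setT measurableT (fun n => EFin \o g_ n)
  (EFin \o (fun x => h x * pdf x)) (EFin \o (fun x => `|h x * pdf x|)).
- move=> n; rewrite /g_ -restrict_EFin; apply/(measurable_restrict _ _ _) => //.
  by apply: measurable_funS (measurable_int _ hmu).
- exact: measurable_int hmu.
- apply: aeW => x _; apply: cvg_near_cst.
  near=> n; rewrite /g_ /= patchE ifT// inE/= in_itv/= -ler_norml.
  near: n; exists (Num.bound `|x|) => // n /= xn.
  by rewrite (le_trans (ltW (archi_boundP (normr_ge0 x))))// ler_nat leqW.
- exact: integrable_norm.
- apply: aeW => x n _; rewrite /= lee_fin /g_ patchE; case: ifP => // _.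
  by rewrite normr0.
move=> _ _ L.
have {}L : (F n.+1%:R - F (- n.+1%:R)) @[n --> \oo] --> Ex N h.
  have E : (\int[mu]_x (h x * pdf x)%:E = (Ex N h)%:E)%E.
    by rewrite Ex_normal// /Rintegral fineK//; exact: integrable_fin_num.
  move: L; rewrite /comp/= E => /fine_cvg; apply: cvg_trans.
  rewrite (_ : (fun n => F n.+1%:R - F (- n.+1%:R)) =
    fine \o (fun n => \int[mu]_x (g_ n x)%:E)%E)//.
  by apply/funext => n /=; rewrite gE.
have L0 : (F n.+1%:R - F (- n.+1%:R)) @[n --> \oo] --> 0.
  apply: norm_cvg0; apply: (@squeeze_cvgr _ _ _ _ (cst 0) (fun n => 2 * B * harmonic n)).
  - apply: nearW => n; rewrite normr_ge0/= (le_trans (ler_normB _ _))//.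
    rewrite /harmonic/= ler_pdivlMr ?ltr0n// mulrDl.
    have n1 : 1 <= n.+1%:R :> R by rewrite ler1n.
    have n2 : n.+1%:R <= n.+1%:R ^+ 2 :> R by rewrite expr2 ler_peMl// (le_trans ler01).
    rewrite mulr_natl mulr2n lerD//.
      by rewrite (le_trans _ (HB n.+1%:R))// mulrC ler_wpM2r.
    by rewrite (le_trans _ (HB (- n.+1%:R)))// mulrC sqrrN ler_wpM2r.
  - exact: cvg_cst.
  - rewrite -[X in _ --> X](mulr0 (2 * B)); apply: cvgM; first exact: cvg_cst.
    exact: cvg_harmonic.
have h0 : Ex N h = 0 by exact: (cvg_unique _ L L0).
have xfi : intg N (fun x => x * f x).
  by apply: mom_intg; apply: momM => //; exact: mom_normal.
have : Ex N h = Ex N df - (s ^+ 2)^-1 * Ex N (fun x => x * f x).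
  rewrite -ExZ// -ExB//; last exact: intgZ.
  by apply: eq_Ex => x; rewrite /h; ring.
rewrite h0 => /esym/eqP; rewrite subr_eq0 => /eqP ->.
by rewrite mulrA divff// mul1r.
Unshelve. all: by end_near. Qed.

(** Integration by parts turns the derivative in [t] into the equation [g' = - s^2 t g], so [g]
    times [e^(s^2 t^2 / 2)] is constant. *)
Lemma normal_charfun (t a : R) :
  Ex N (fun x => cos (t * x + a)) = expR (- (s ^+ 2 * t ^+ 2) / 2) * cos a.
Proof.
have mX := mom_normal.
pose g t := Ex N (fun x => 1 * cos (t * x + a)).
have gd (u : R) : is_derive u 1 g (- (s ^+ 2 * u) * g u).
  have -> : - (s ^+ 2 * u) * g u = - Ex N (fun x => 1 * x * sin (u * x + a)).
    rewrite (@eq_Ex _ _ _ N _ (fun x : R => x * sin (u * x + a))); last by move=> x; rewrite mul1r.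
    have fd (x : R) : is_derive x 1 (fun x => sin (u * x + a)) (u * cos (u * x + a)).
      by apply: is_derive_eq; rewrite /GRing.scale/=; ring.
    rewrite -(@normal_ibp _ _ 0 1 fd).
    - rewrite ExZ.
        rewrite /g mulNr mulrA; congr (- (_ * _)); by apply: eq_Ex => x; rewrite mul1r.
      by apply: mom_intg; apply: mom_cos; apply: measurable_funD => //; apply: measurable_funM.
    - move=> x; apply: cvgM; first exact: cvg_cst.
      apply: continuous_comp; last exact: continuous_cos.
      apply: cvgD; last exact: cvg_cst.
      by apply: cvgM; [exact: cvg_cst|exact: cvg_id].
    - move=> x; rewrite expr0 mul1r ler_norml.
      have := sin_geN1 (u * x + a); have := sin_le1 (u * x + a); lra.
    - apply: mom_intg; apply: momM; first exact: mom_cst.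
      by apply: mom_cos; apply: measurable_funD => //; apply: measurable_funM.
  apply: (is_derive_Ex_cos (G := fun=> a)) => //.
  exact: mom_cst.
pose k t := g t * expR (s ^+ 2 * t ^+ 2 / 2).
have kd (u : R) : is_derive u 1 k 0.
  have ? := gd u.
  by apply: is_derive_eq; rewrite /GRing.scale/=; field.
have := eq_of_derive0 kd t 0; rewrite /k expr0n mulr0 mul0r expR0 mulr1.
rewrite /g; under [X in _ = X -> _]eq_Ex do rewrite mul0r add0r.
rewrite Ex_cst mul1r => <-; rewrite mulrCA -expRD mulNr addNr expR0 mulr1.
by apply: eq_Ex => x; rewrite mul1r.
Qed.

Lemma normal_moment2 : Ex N (fun x => x ^+ 2) = s ^+ 2.
Proof.
have mX := mom_normal.
rewrite (@eq_Ex _ _ _ N _ (fun x : R => x * x)); last by move=> x; rewrite expr2.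
rewrite -(@normal_ibp _ (fun=> 1) 1 1).
- by rewrite Ex_cst mulr1.
- by move=> x; exact: cvg_cst.
- by move=> x; rewrite mul1r ler_norml; nra.
- exact: intg_cst.
Qed.

Lemma normal_moment4 : Ex N (fun x => x ^+ 4) = 3 * s ^+ 4.
Proof.
have mX := mom_normal.
rewrite (@eq_Ex _ _ _ N _ (fun x : R => x * x ^+ 3)); last by move=> x; rewrite -exprS.
have fd (x : R) : is_derive x 1 (fun x => x ^+ 3) (3 * x ^+ 2).
  by apply: is_derive_eq; rewrite /GRing.scale/=; ring.
rewrite -(@normal_ibp _ _ 2 1 fd).
- rewrite ExZ; last by apply: mom_intg; exact: momX.
  by rewrite normal_moment2; ring.
- move=> x; apply: cvgM; first exact: cvg_cst.
  exact: exprn_continuous.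
- move=> x; rewrite mul1r ler_norml.
  have := sqr_ge0 (x ^+ 2 - 1); have := sqr_ge0 (x ^+ 2 - x); have := sqr_ge0 (x ^+ 2 + x); have := sqr_ge0 x.
  rewrite (_ : x ^+ 2.*2 = x ^+ 4)//; nra.
- by apply: mom_intg; apply: momM; [exact: mom_cst|exact: momX].
Qed.

End normal.

(** * Gaussian families *)

Section gaussian_law.
Context (R : realType) d (T : measurableType d) (P : probability T R).

Lemma normal_law_Ex (X : {RV P >-> R}) (s : R) (f : R -> R) :
  normal_law P X s -> intg (normal_prob 0 s) f ->
  intg P (f \o X) /\ Ex P (f \o X) = Ex (normal_prob 0 s) f.
Proof.
move=> Xs fi; have mf : measurable_fun setT f by exact: intg_measurable fi.
(* [X] is retyped with values in the measurable space that carries [normal_prob]. *)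
have mX : @measurable_fun _ _ T (measurableTypeR R) setT X.
  have mX : measurable_fun setT X by exact: measurable_funPT.
  by move=> mT A mA; exact: mX.
pose X' : {mfun T >-> measurableTypeR R} := @mfun_Sub _ _ T (measurableTypeR R) X (mem_set mX).
have eqN (g : R -> \bar R) : (\int[distribution P X']_x g x = \int[normal_prob 0 s]_x g x)%E.
  apply: (@eq_measure_integral _ (measurableTypeR R) R setT (normal_prob 0 s)
    (distribution P X')) => A mA _.
  by symmetry; apply: esym; exact: Xs.
have mef : @measurable_fun _ _ (measurableTypeR R) _ setT (EFin \o f).
  exact/measurable_EFinP.
have fX : intg P (f \o X).
  have /integrableP[_ nf] := fi.
  apply/integrableP; split; first by apply/measurable_EFinP; exact: measurableT_comp.
  rewrite -eqN in nf.
  by move: nf; rewrite ge0_integral_distribution//; exact: measurableT_comp.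
split=> //; rewrite /Ex /Rintegral; congr fine; rewrite -eqN integral_distribution//.
Qed.

Lemma centered_gaussian_mom (X : {RV P >-> R}) : centered_gaussian P X -> mom P X.
Proof.
have mX : measurable_fun setT X by exact: measurable_funPT.
case=> [X0|[s s0 Xs]]; split=> // n.
  apply: (ae_eq_intg (g := fun=> `|0 : R| ^+ n)).
  - by apply: measurable_funX; exact: measurableT_comp.
  - by apply: filterS X0 => w /= ->.
  - exact: intg_cst.
have [_ /(_ n) Ni] := mom_normal (lt0r_neq0 s0).
by have [] := normal_law_Ex Xs Ni.
Qed.

Lemma centered_gaussian_charfun (X : {RV P >-> R}) a : centered_gaussian P X ->
  Ex P (fun w => cos (X w + a)) = expR (- Ex P (fun w => X w ^+ 2) / 2) * cos a.
Proof.
have mX : measurable_fun setT X by exact: measurable_funPT.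
case=> [X0|[s s0 Xs]].
  have -> : Ex P (fun w => X w ^+ 2) = 0.
    rewrite -[RHS](Ex_cst P 0); apply: ae_eq_Ex => //; first exact: measurable_funX.
    by apply: filterS X0 => w /= ->; rewrite expr0n.
  rewrite oppr0 mul0r expR0 mul1r -[RHS](Ex_cst P); apply: ae_eq_Ex => //.
    by apply: mom_measurable (mom_cos P _); exact: measurable_funD.
  by apply: filterS X0 => w /= ->; rewrite add0r.
have s0' := lt0r_neq0 s0; have mN := mom_normal s0'.
have [_ H2] := normal_law_Ex Xs (mom_intg (momX 2 mN)).
have /mom_intg ci : mom (normal_prob 0 s) (fun x : R => cos (1 * x + a)).
  by apply: mom_cos; apply: measurable_funD => //; exact: measurable_funM.
have [_ H1] := normal_law_Ex Xs ci.
rewrite [X in expR (- X / 2)]H2 normal_moment2//.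
have := normal_charfun s0' 1 a; rewrite expr1n mulr1 -H1 => <-.
by apply: eq_Ex => w /=; rewrite mul1r.
Qed.

End gaussian_law.

Section gaussian_family.
Context (R : realType) d (T : measurableType d) (P : probability T R) (m : nat).

(** Stated through the characteristic function and not through a density, since the vectors behind
    [V] may be dependent and [c] singular. *)
Record gaussian_family (V : 'I_m -> T -> R) (c : 'I_m -> 'I_m -> R) : Prop :=
  GaussianFamily {
  gf_mom : forall k, mom P (V k) ;
  gf_sym : forall k l, c k l = c l k ;
  gf_charfun : forall (x : 'I_m -> R) a,
    Ex P (fun w => cos (\sum_k x k * V k w + a)) =
    expR (- (\sum_k \sum_l x k * x l * c k l) / 2) * cos a }.

End gaussian_family.

Lemma isonormal_family (R : realType) d (T : measurableType d)
    (P : probability T R) (H : hilbertType R) (W : H -> {RV P >-> R}) m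
    (h : 'I_m -> H) : isonormal W ->
  gaussian_family P (fun k => W (h k) : T -> R) (fun k l => ip (h k) (h l)).
Proof.
move=> HW.
have Wm (g : H) : mom P (W g).
  apply: centered_gaussian_mom.
  have := isonormal_gaussian HW (fun _ : 'I_1 => 1) (fun=> g).
  by under eq_fun do rewrite big_ord1 mul1r.
split=> [k|k l|x a]; [exact: Wm|exact: ipC|].
have mS : measurable_fun setT (fun w => \sum_k x k * W (h k) w).
  apply: (@mom_measurable _ _ _ P); apply: mom_sum => k.
  by apply: momM; [exact: mom_cst|exact: Wm].
pose S : {RV P >-> R} := mfun_Sub (mem_set mS).
have SE w : S w = \sum_k x k * W (h k) w by [].
have := @centered_gaussian_charfun _ _ _ P S a (isonormal_gaussian HW x h).
move=> ->; congr (expR (- _ / 2) * _).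
rewrite (eq_Ex P (g := fun w => \sum_k \sum_l x k * x l * (W (h k) w * W (h l) w))).
  rewrite Ex_sum; last first.
    by move=> k; apply: mom_intg; apply: mom_sum => l; have := Wm (h k); have := Wm (h l) => ? ?; mom_tac.
  apply: eq_bigr => k _; rewrite Ex_sum; last first.
    by move=> l; apply: mom_intg; have := Wm (h k); have := Wm (h l) => ? ?; mom_tac.
  apply: eq_bigr => l _; rewrite ExZ; last first.
    by apply: mom_intg; have := Wm (h k); have := Wm (h l) => ? ?; mom_tac.
  by rewrite ExE (isonormal_cov HW).
move=> w; rewrite /= expr2 mulr_suml; apply: eq_bigr => k _.
rewrite mulr_sumr; apply: eq_bigr => l _; ring.
Qed.

(** * Trigonometric approximation *)

Lemma continuous_sum (R : realType) (S : topologicalType) (J : Type) (s : seq J)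
    (F : J -> S -> R) :
  (forall j, continuous (F j)) -> continuous (fun x => \sum_(j <- s) F j x).
Proof.
move=> Fc; elim: s => [|j s IH] x.
  by under eq_fun do rewrite big_nil; exact: cvg_cst.
under eq_fun do rewrite big_cons.
by apply: cvgD; [exact: Fc|exact: IH].
Qed.

Section trigonometric_polynomials.
Context (R : realType) (n : nat).
Implicit Types (f g : 'rV[R]_n -> R).

(** Real trigonometric polynomials; the phase [a] provides constants and sines, and makes the class
    closed under products. *)
Inductive trig : ('rV[R]_n -> R) -> Prop :=
| trig_cos l a : trig (fun x => cos (euclidean_dot l x + a))
| trigD f g : trig f -> trig g -> trig (fun x => f x + g x)
| trigZ c f : trig f -> trig (fun x => c * f x).

Lemma euclidean_dotDl (l l' x : 'rV[R]_n) :
  euclidean_dot (l + l') x = euclidean_dot l x + euclidean_dot l' x.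
Proof. by rewrite -big_split; apply: eq_bigr => i _; rewrite mxE mulrDl. Qed.

Lemma euclidean_dotBl (l l' x : 'rV[R]_n) :
  euclidean_dot (l - l') x = euclidean_dot l x - euclidean_dot l' x.
Proof. by rewrite -sumrB; apply: eq_bigr => i _; rewrite !mxE mulrBl. Qed.

Lemma euclidean_dot0l (x : 'rV[R]_n) : euclidean_dot 0 x = 0.
Proof. by rewrite /euclidean_dot big1// => i _; rewrite mxE mul0r. Qed.

Lemma trig_cst c : trig (fun=> c).
Proof.
have := trigZ c (trig_cos 0 0).
by under eq_fun do rewrite euclidean_dot0l addr0 cos0 mulr1.
Qed.

Lemma trigM f g : trig f -> trig g -> trig (fun x => f x * g x).
Proof.
elim=> [l a|f1 f2 _ IH1 _ IH2 tg|c f1 _ IH1 tg].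
- elim=> [l' a'|g1 g2 _ IH1 _ IH2|c g1 _ IH1].
  + have := trigZ (2^-1) (trigD (trig_cos (l + l') (a + a')) (trig_cos (l - l') (a - a'))).
    congr trig; apply/funext => x; rewrite euclidean_dotDl euclidean_dotBl.
    set u := euclidean_dot l x; set v := euclidean_dot l' x.
    rewrite (_ : u + v + (a + a') = (u + a) + (v + a')); last by ring.
    rewrite (_ : u - v + (a - a') = (u + a) - (v + a')); last by ring.
    by rewrite cosB cosD; field.
  + by under eq_fun do rewrite mulrDr; exact: trigD.
  + by under eq_fun do rewrite mulrCA; exact: trigZ.
- by under eq_fun do rewrite mulrDl; apply: trigD; [exact: IH1|exact: IH2].
- by under eq_fun do rewrite -mulrA; apply: trigZ; exact: IH1.
Qed.

Lemma trig_sin_coord (i : 'I_n) (c : R) : trig (fun x => sin (c * x 0 i)).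
Proof.
have := trig_cos (c *: delta_mx 0 i) (- (pi / 2)); congr trig; apply/funext => x.
rewrite (_ : euclidean_dot _ _ = c * x 0 i).
  by rewrite cosB cos_pihalf sin_pihalf mulr0 add0r mulr1.
rewrite /euclidean_dot (bigD1 i)//= !mxE !eqxx mulr1 big1 ?addr0// => j ji.
by rewrite !mxE (negbTE ji) andbF mulr0 mul0r.
Qed.

Lemma continuous_coord (i : 'I_n) : continuous (fun x : 'rV[R]_n => x 0 i).
Proof. by move=> x; exact: coord_continuous. Qed.

Lemma continuous_euclidean_dot (l : 'rV[R]_n) : continuous (euclidean_dot l).
Proof.
apply: continuous_sum => i x.
exact: (cvgM (cvg_cst (l 0 i)) (@continuous_coord i x)).
Qed.

Lemma trig_bounded f : trig f -> exists M, forall x, `|f x| <= M.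
Proof.
elim=> [l a|f1 f2 _ [M1 H1] _ [M2 H2]|c f1 _ [M1 H1]].
- by exists 1 => x; rewrite ler_norml cos_geN1 cos_le1.
- by exists (M1 + M2) => x; rewrite (le_trans (ler_normD _ _))// lerD.
- by exists (`|c| * M1) => x; rewrite normrM ler_wpM2l.
Qed.

End trigonometric_polynomials.

Section bernstein.
Context (R : realType).

(* The expectation of [g] under the binomial law of parameters [N] and [t]. *)
Fixpoint bernstein (N : nat) (t : R) (g : nat -> R) : R :=
  if N is N'.+1 then
    (1 - t) * bernstein N' t g + t * bernstein N' t (fun j => g j.+1)
  else g 0%N.

Lemma bernsteinD N t g h :
  bernstein N t (fun j => g j + h j) = bernstein N t g + bernstein N t h.
Proof. by elim: N g h => [|N IH] g h //=; rewrite !IH; ring. Qed.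

Lemma bernsteinZ N t c g : bernstein N t (fun j => c * g j) = c * bernstein N t g.
Proof. by elim: N g => [|N IH] g //=; rewrite !IH; ring. Qed.

Lemma bernstein_cst N t c : bernstein N t (fun=> c) = c.
Proof. by elim: N => [|N IH] //=; rewrite IH; ring. Qed.

Lemma bernstein_le N t g h : 0 <= t <= 1 -> (forall j, g j <= h j) ->
  bernstein N t g <= bernstein N t h.
Proof.
move=> /andP[t0 t1]; elim: N g h => [|N IH] g h gh //=.
by rewrite lerD// ler_wpM2l ?subr_ge0// IH.
Qed.

(** At [a = - N t] this is the binomial variance. The free shift [a] lets the induction go through,
    since a successful trial moves it to [a + 1]. *)
Lemma bernstein_sqr N t a :
  bernstein N t (fun j => (j%:R + a) ^+ 2) = (N%:R * t + a) ^+ 2 + N%:R * t * (1 - t).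
Proof.
elim: N a => [|N IH] a /=; first by rewrite !mul0r addr0.
rewrite IH; under [X in bernstein N t X]eq_fun do rewrite -addn1 natrD -addrA.
by rewrite IH -natr1; ring.
Qed.

Context (n : nat).

Definition upd (k : 'I_n -> nat) (i : 'I_n) (j : nat) : 'I_n -> nat :=
  fun l => if l == i then j else k l.

(** Expectation under independent binomial counts, one for each coordinate in [s], drawn in turn and
    recorded in [k]. *)
Fixpoint mbernstein N (t : 'I_n -> R) (s : seq 'I_n) (g : ('I_n -> nat) -> R)
    (k : 'I_n -> nat) : R :=
  if s is i :: s' then
    bernstein N (t i) (fun j => mbernstein N t s' g (upd k i j))
  else g k.

Lemma mbernsteinD N t s g h k :
  mbernstein N t s (fun j => g j + h j) k = mbernstein N t s g k + mbernstein N t s h k.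
Proof.
elim: s k => [|i s IH] k //=; rewrite -bernsteinD; congr bernstein.
by apply/funext => j; rewrite IH.
Qed.

Lemma mbernsteinZ N t s c g k :
  mbernstein N t s (fun j => c * g j) k = c * mbernstein N t s g k.
Proof.
elim: s k => [|i s IH] k //=; rewrite -bernsteinZ; congr bernstein.
by apply/funext => j; rewrite IH.
Qed.

Lemma mbernstein_cst N t s c k : mbernstein N t s (fun=> c) k = c.
Proof.
elim: s k => [|i s IH] k //=; rewrite -[RHS](bernstein_cst N (t i)); congr bernstein.
by apply/funext => j; rewrite IH.
Qed.

Lemma mbernstein_le N t s g h k : (forall i, 0 <= t i <= 1) -> (forall j, g j <= h j) ->
  mbernstein N t s g k <= mbernstein N t s h k.
Proof.
move=> t01 gh; elim: s k => [|i s IH] k //=; apply: bernstein_le => // j.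
Qed.

Lemma mbernstein_sum N t s (J : Type) (r : seq J) (g : J -> ('I_n -> nat) -> R) k :
  mbernstein N t s (fun j => \sum_(i <- r) g i j) k = \sum_(i <- r) mbernstein N t s (g i) k.
Proof.
elim: r => [|i r IH].
  rewrite big_nil -[RHS](mbernstein_cst N t s 0 k); congr mbernstein.
  by apply/funext => j; rewrite big_nil.
rewrite big_cons -IH -mbernsteinD; congr mbernstein.
by apply/funext => j; rewrite big_cons.
Qed.

Lemma mbernstein_coord N t s (q : nat -> R) i k : i \notin s ->
  mbernstein N t s (fun j => q (j i)) k = q (k i).
Proof.
elim: s k => [|l s IH] k //=; rewrite in_cons negb_or => /andP[il ls].
rewrite -[RHS](bernstein_cst N (t l)); congr bernstein; apply/funext => j.
by rewrite IH// /upd (negbTE il).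
Qed.

Lemma mbernstein_coord_in N t s (q : nat -> R) i k : uniq s -> i \in s ->
  mbernstein N t s (fun j => q (j i)) k = bernstein N (t i) q.
Proof.
elim: s k => [|l s IH] k //= /andP[ls us]; rewrite in_cons.
have [il _|il /= is_] := eqVneq i l.
  rewrite il; congr bernstein; apply/funext => j.
  by rewrite mbernstein_coord ?il// /upd eqxx.
rewrite -[RHS](bernstein_cst N (t l)); congr bernstein; apply/funext => j.
by rewrite IH.
Qed.

End bernstein.

Section trig_approximation.
Context (R : realType).

(** Only [x] is confined to the box, and [y] may leave it; compactness of the box serves to find one
    radius [r] that works for all [x]. *)
Lemma uniform_continuity (n : nat) (phi : 'rV[R]_n -> R) (B e : R) :
  continuous phi -> 0 < e ->
  exists2 r : R, 0 < r & forall x y : 'rV[R]_n, (forall i, `|x 0 i| <= B) ->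
    (forall i, `|x 0 i - y 0 i| < r) -> `|phi x - phi y| <= e.
Proof.
move=> phic e0.
pose K := [set x : 'rV[R]_n | forall i, `[- B, B]%classic (x 0 i)].
have cK : compact K.
  have := @rV_compact R n (fun=> `[- B, B]%classic) (fun _ => @segment_compact R (- B) B).
  congr compact; apply/seteqP; split => x /= H i; by have := H i.
pose Q (r : R) (x : 'rV[R]_n) := forall y : 'rV[R]_n, ball x r y -> `|phi x - phi y| <= e.
have [r [r0 Hr]] : exists r, 0 < r /\ K `<=` Q r.
  have /compact_near_coveringP/(_ _ (0 : R)^'+ Q _) H := cK.
  have : \forall r \near (0 : R)^'+, K `<=` Q r.
    apply: H => x Kx.
    have /cvgrPdist_lt/(_ (e / 2)) := phic x; rewrite divr_gt0// => /(_ isT).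
    move=> /nbhs_ballP[r /= r0 Hr].
    exists (ball x (r / 2), [set s : R | 0 < s < r / 2]).
      split; first by apply: nbhsx_ballx; rewrite divr_gt0.
      near=> s; apply/andP; split; near: s; [exact: nbhs_right_gt|].
      by apply: nbhs_right_lt; rewrite divr_gt0.
    move=> [x' s] /= [xx' /andP[s0 sr]] y x'y.
    rewrite (splitr e) -[X in `|X|](subrKA (phi x)) (le_trans (ler_normD _ _))// lerD//.
      rewrite distrC ltW// Hr//; apply: le_ball xx'; lra.
    rewrite ltW// Hr//.
    rewrite (splitr r); apply: ball_triangle xx' _.
    by apply: le_ball x'y; exact: ltW.
  move=> H'; have : \forall r \near (0 : R)^'+, 0 < r /\ K `<=` Q r.
    near=> r; split; near: r => //; exact: nbhs_right_gt.
  by move=> /filter_ex[r ?]; exists r.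
exists r => // x y xB xy; apply: Hr.
  by move=> i /=; rewrite in_itv/= -ler_norml.
by split=> // i j; rewrite (ord1 i); exact: xy.
Unshelve. all: by end_near. Qed.

Lemma asin_lipschitz (a b : R) : `|a| <= 2^-1 -> `|b| <= 2^-1 ->
  `|asin a - asin b| <= 2 * `|a - b|.
Proof.
wlog ab : a b / b <= a.
  move=> H ha hb; have [/H->//|/ltW/H] := leP b a.
  by rewrite distrC (distrC a b); exact.
move=> ha hb; pose df (x : R) := (Num.sqrt (1 - x ^+ 2))^-1.
have itvP' c : c \in `[b, a] -> `|c| <= 2^-1.
  move: ha hb; rewrite in_itv/= !ler_norml => /andP[? ?] /andP[? ?] /andP[? ?].
  by apply/andP; split; lra.
have c1 (c : R) : `|c| <= 2^-1 -> -1 < c < 1.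
  by rewrite ler_norml => /andP[? ?]; apply/andP; split; lra.
have [||c /itvP' cab ->] := @MVT_segment _ (@asin R) df b a ab.
- by move=> c /subset_itv_oo_cc/itvP'/c1 ?; exact: is_derive1_asin.
- apply: derivable_within_continuous => c /itvP'/c1 c1'.
  by have [] := is_derive1_asin c1'.
rewrite normrM ler_wpM2r// ger0_norm ?invr_ge0 ?sqrtr_ge0//.
have h : 2^-1 <= Num.sqrt (1 - c ^+ 2).
  rewrite (_ : 2^-1 = Num.sqrt (2^-1 ^+ 2)); last by rewrite sqrtr_sqr ger0_norm.
  rewrite ler_sqrt.
    have : `|c| ^+ 2 <= 2^-1 ^+ 2 by rewrite lerXn2r// nnegrE.
    rewrite real_normK ?num_real//; lra.
  have : `|c| ^+ 2 <= 2^-1 ^+ 2 by rewrite lerXn2r// nnegrE.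
  rewrite real_normK ?num_real//; lra.
by rewrite invf_ple ?posrE// (lt_le_trans _ h).
Qed.

(** The projection onto [[-1/2, 1/2]], where [asin] is Lipschitz. *)
Let exists_clamp : exists clamp : R -> R, [/\ forall y, `|clamp y| <= 2^-1,
  forall y, `|y| <= 2^-1 -> clamp y = y &
  forall y z, `|clamp y - clamp z| <= `|y - z|].
Proof.
pose clamp (y : R) : R := Num.max (- 2^-1) (Num.min 2^-1 y).
have clamp_half y : `|clamp y| <= 2^-1.
  rewrite ler_norml /clamp le_max lexx/= ge_max ge_min lexx/= andbT.
  by rewrite (le_trans (_ : _ <= 0)) ?oppr_le0 ?invr_ge0.
have clamp_id y : `|y| <= 2^-1 -> clamp y = y.
  by rewrite ler_norml => /andP[h1 h2]; rewrite /clamp min_r// max_r.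
have clamp_lip y z : `|clamp y - clamp z| <= `|y - z|.
  have clampE (v : R) : [\/ v <= - 2^-1 /\ clamp v = - 2^-1, 2^-1 <= v /\ clamp v = 2^-1 |
      [/\ - 2^-1 <= v, v <= 2^-1 & clamp v = v]].
    rewrite /clamp; have [v1|v1] := lerP 2^-1 v.
      by apply: Or32; split=> //; rewrite max_r//; lra.
    have [v2|v2] := lerP v (- 2^-1).
      by apply: Or31; split.
    by apply: Or33; split=> //; exact: ltW.
  case: (ger0P (y - z)) => ?; rewrite ler_norml;
    by case: (clampE y) => [[? ->]|[? ->]|[? ? ->]];
       case: (clampE z) => [[? ->]|[? ->]|[? ? ->]]; apply/andP; split; lra.
by exists clamp.
Qed.

Lemma trig_bernstein n (i : 'I_n) N (t : 'rV[R]_n -> R) (h : nat -> 'rV[R]_n -> R) :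
  trig t -> (forall j, trig (h j)) ->
  trig (fun x => bernstein N (t x) (fun j => h j x)).
Proof.
move=> tt; elim: N h => [|N IH] h th /=; first exact: th.
apply: trigD; apply: trigM => //; [|exact: IH|by apply: IH => j].
under eq_fun do rewrite -mulN1r.
by apply: trigD; [exact: trig_cst|exact: trigZ].
Qed.

(** Bernstein approximation in the variables [t = (1 + sin (x_i / L)) / 2], which are trigonometric
    and lie in [[0, 1]]. A bounded continuous function need not be a uniform limit of trigonometric
    polynomials, so the error is allowed to grow quadratically; bounded second moments absorb it
    later. In the box [|x_i| <= L / 2] the binomial counts concentrate; outside it the trivial bound
    [2 M] is below the allowed error. *)
Lemma trig_approx n (phi : 'rV[R]_n -> R) (M e : R) : continuous phi ->
  (forall x, `|phi x| <= M) -> 0 < e ->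
  exists2 tau : 'rV[R]_n -> R, trig tau &
    forall x, `|phi x - tau x| <= e * (1 + \sum_i x 0 i ^+ 2).
Proof.
move=> phic phiM e0.
have M0 : 0 <= M := le_trans (normr_ge0 _) (phiM 0).
(* Chosen so that [2 M <= e x_i^2] as soon as [|x_i| > L / 2]. *)
pose L := 1 + 8 * M / e.
have L1 : 1 <= L by rewrite lerDl divr_ge0 ?mulr_ge0// ltW.
have L0 : 0 < L by rewrite (lt_le_trans ltr01).
have LM : 8 * M <= e * L ^+ 2.
  rewrite (@le_trans _ _ (e * L))//; last first.
    by rewrite ler_wpM2l ?(ltW e0)// expr2 ler_peMl// ltW.
  by rewrite mulrDr mulr1 mulrCA divff ?gt_eqF// mulr1 lerDr ltW.
have [clamp [clamp_half clamp_id clamp_lip]] := exists_clamp.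
(* A left inverse of the function [t] on [[- L / 2, L / 2]]; the clamp extends it to a Lipschitz
   function on the line. *)
pose node (y : R) : R := L * asin (clamp (2 * y - 1)).
have node_lip y z : `|node y - node z| <= 4 * L * `|y - z|.
  rewrite -mulrBr normrM gtr0_norm// (mulrC 4) -mulrA ler_wpM2l ?(ltW L0)//.
  rewrite (le_trans (asin_lipschitz _ _))// (_ : 4 = 2 * 2); last by ring.
  rewrite -mulrA ler_wpM2l// (le_trans (clamp_lip _ _))//.
  rewrite (_ : 2 * y - 1 - _ = 2 * (y - z)); last by ring.
  by rewrite normrM ger0_norm.
pose t (y : R) := 2^-1 * (1 + sin (L^-1 * y)).
have t01 y : 0 <= t y <= 1.
  rewrite /t; have := sin_geN1 (L^-1 * y); have := sin_le1 (L^-1 * y) => ? ?.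
  by apply/andP; split; lra.
have node_t y : `|y| <= L / 2 -> node (t y) = y.
  move=> yL; have y2 : `|L^-1 * y| <= 2^-1.
    by rewrite normrM gtr0_norm ?invr_gt0// ler_pdivrMl.
  have E : 2 * t y - 1 = sin (L^-1 * y) by rewrite /t; field.
  rewrite /node E clamp_id; last first.
    rewrite (le_trans _ y2)// -[X in `|X|]subr0 -[X in _ - X]sin0.
    by rewrite (le_trans (le_norm_sub_sin _ _))// subr0.
  rewrite sinK ?mulrA ?divff ?mul1r ?gt_eqF//.
  rewrite in_itv/= -ler_norml (le_trans y2)//.
  by rewrite -[leLHS]mul1r ler_wpM2r// (le_trans _ (pi_ge2 R))// ler1n.
have [r r0 Hr] := @uniform_continuity n phi (L / 2) (e / 2) phic (divr_gt0 e0 (ltr0Sn R 1)).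
(* A node at distance at least [r] from [x_i] has its fraction [j / N] at distance at least
   [r / (4 L)] from [t x_i]; the square of this distance times [c] is at least [1]. *)
pose c := 16 * L ^+ 2 / r ^+ 2.
have c0 : 0 < c by rewrite divr_gt0 ?mulr_gt0 ?exprn_gt0.
have Mc0 : 0 <= 2 * M * c by rewrite mulr_ge0 ?(ltW c0)// mulr_ge0.
(* A binomial fraction has variance at most [1 / (4 N)]; [N] makes the contribution of all [n]
   coordinates at most [e / 2]. *)
have [N N0 NM] : exists2 N : nat, 0 < N%:R :> R &
    2 * M * c * (n%:R / (4 * N%:R)) <= e / 2.
  exists (Num.bound (M * n%:R * c / e)).+1; first by rewrite ltr0n.
  set N := (Num.bound _).+1; have N0 : 0 < N%:R :> R by rewrite ltr0n.
  have : M * n%:R * c / e <= N%:R.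
    rewrite (le_trans (ltW (archi_boundP _)))//.
      by rewrite divr_ge0 ?(ltW e0)// mulr_ge0 ?(ltW c0)// mulr_ge0.
    by rewrite ler_nat.
  rewrite ler_pdivrMr// => H.
  rewrite (_ : 2 * M * c * _ = (M * n%:R * c) / N%:R / 2); last by field; rewrite gt_eqF.
  by rewrite ler_pM2r// ler_pdivrMr// [e * _]mulrC.
pose xi (k : 'I_n -> nat) : 'rV[R]_n := \row_i node ((k i)%:R / N%:R).
pose tau (x : 'rV[R]_n) := mbernstein N (fun i => t (x 0 i)) (enum 'I_n)
  (fun k => phi (xi k)) (fun=> 0%N).
exists tau.
  rewrite /tau; move: (fun=> 0%N) (fun k => phi (xi k)).
  elim: (enum _) => [|i s IH] k g /=; first exact: trig_cst.
  apply: (@trig_bernstein _ _ _ (fun x : 'rV[R]_n => t (x 0 i))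
    (fun j x => mbernstein N (fun l => t (x 0 l)) s g (upd k i j))) => //.
  rewrite /t; apply: trigZ; apply: trigD; [exact: trig_cst|exact: trig_sin_coord].
move=> x; set tx := fun i => t (x 0 i).
have tx01 i : 0 <= tx i <= 1 by exact: t01.
have tauE : phi x - tau x =
    mbernstein N tx (enum 'I_n) (fun k => phi x + (-1) * phi (xi k)) (fun=> 0%N).
  by rewrite mbernsteinD mbernsteinZ mbernstein_cst mulN1r.
have normB (g h : ('I_n -> nat) -> R) k : (forall j, `|g j| <= h j) ->
    `|mbernstein N tx (enum 'I_n) g k| <= mbernstein N tx (enum 'I_n) h k.
  move=> gh; rewrite ler_norml; apply/andP; split; last first.
    by apply: mbernstein_le => // j; rewrite (le_trans (ler_norm _)).
  rewrite lerNl -mulN1r -mbernsteinZ; apply: mbernstein_le => // j.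
  by rewrite mulN1r (le_trans (ler_norm _))// normrN.
have S0 : 0 <= \sum_i x 0 i ^+ 2 by apply: sumr_ge0 => i _; exact: sqr_ge0.
have [xL|/existsNP[i /negP]] := pselect (forall i, `|x 0 i| <= L / 2); last first.
  rewrite -ltNge => xi2.
  rewrite tauE (le_trans (normB _ (fun=> 2 * M) _ _))//.
    move=> k; rewrite mulN1r (le_trans (ler_normB _ _))//.
    by rewrite mulr_natl mulr2n lerD.
  rewrite mbernstein_cst.
  have xi4 : L ^+ 2 / 4 <= x 0 i ^+ 2.
    rewrite -[x 0 i ^+ 2]ger0_norm ?sqr_ge0// normrX.
    rewrite (_ : L ^+ 2 / 4 = (L / 2) ^+ 2); last by field.
    by rewrite lerXn2r ?nnegrE// ?(ltW xi2)// divr_ge0// ltW.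
  have : x 0 i ^+ 2 <= \sum_i x 0 i ^+ 2.
    by rewrite (bigD1 i)//= lerDl sumr_ge0// => j _; exact: sqr_ge0.
  move: (\sum_i _) => S xS; rewrite (@le_trans _ _ (e * (L ^+ 2 / 4)))//; first lra.
  by rewrite ler_wpM2l ?(ltW e0)//; lra.
(* As in Chebyshev's inequality: either all nodes are close to [x] and uniform continuity gives
   [e / 2], or the second term is at least [2 M]. *)
rewrite tauE (le_trans (normB _ (fun k => e / 2 + 2 * M * c *
    \sum_i (N%:R ^- 2) * ((k i)%:R + (- (N%:R * tx i))) ^+ 2) _ _))//.
  move=> k; rewrite mulN1r.
  have sum0 : 0 <= \sum_i N%:R ^- 2 * ((k i)%:R + (- (N%:R * tx i))) ^+ 2.
    by apply: sumr_ge0 => i _; rewrite mulr_ge0 ?sqr_ge0// invr_ge0 exprn_ge0// ltW.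
  have [close|/existsNP[i /negP]] := pselect (forall i, `|x 0 i - xi k 0 i| < r).
    rewrite (@le_trans _ _ (e / 2))//; first exact: Hr.
    by rewrite lerDl mulr_ge0.
  rewrite -leNgt => ri.
  rewrite (@le_trans _ _ (2 * M))//.
    by rewrite (le_trans (ler_normB _ _))// mulr_natl mulr2n lerD.
  suff h1 : 1 <= c * \sum_i N%:R ^- 2 * ((k i)%:R + (- (N%:R * tx i))) ^+ 2.
    rewrite -[leLHS]add0r lerD ?divr_ge0 ?(ltW e0)//.
    by rewrite -[leRHS]mulrA -[leLHS]mulr1 ler_wpM2l// mulr_ge0.
  rewrite (bigD1 i)//= (@le_trans _ _ (c * (N%:R ^- 2 * ((k i)%:R + (- (N%:R * tx i))) ^+ 2)))//; last first.
    rewrite ler_pM2l// lerDl; apply: sumr_ge0 => j _.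
    by rewrite mulr_ge0 ?sqr_ge0// invr_ge0 exprn_ge0// ltW.
  move: ri; rewrite mxE -{1}(node_t _ (xL i)) => /le_trans/(_ (node_lip _ _)) h.
  have -> : c * (N%:R ^- 2 * ((k i)%:R + (- (N%:R * tx i))) ^+ 2) =
      ((4 * L * `|t (x 0 i) - (k i)%:R / N%:R|) / r) ^+ 2.
    rewrite expr_div_n exprMn real_normK ?num_real// /c /tx.
    by field; rewrite !gt_eqF.
  by rewrite -[leLHS](expr1n _ 2) lerXn2r ?nnegrE ?divr_ge0 ?mulr_ge0 ?(ltW L0) ?(ltW r0)// ler_pdivlMr// mul1r.
rewrite mbernsteinD mbernstein_cst mbernsteinZ mbernstein_sum.
have bi i : mbernstein N tx (enum 'I_n)
    (fun k => N%:R ^- 2 * ((k i)%:R + - (N%:R * tx i)) ^+ 2) (fun=> 0%N) <= (4 * N%:R)^-1.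
  rewrite (mbernstein_coord_in N tx (fun j => N%:R ^- 2 * (j%:R + - (N%:R * tx i)) ^+ 2))
    ?enum_uniq ?mem_enum// bernsteinZ bernstein_sqr subrr expr0n add0r.
  rewrite (_ : _ * _ = (tx i * (1 - tx i)) / N%:R); last by field; rewrite gt_eqF.
  rewrite invfM ler_wpM2r ?invr_ge0 ?(ltW N0)//.
  have := sqr_ge0 (tx i - 2^-1); nra.
rewrite (@le_trans _ _ (e / 2 + 2 * M * c * (\sum_(i < n) (4 * N%:R)^-1)))//.
  by rewrite lerD2l ler_wpM2l//; apply: ler_sum => i _; exact: bi.
rewrite sumr_const card_ord -[_ *+ n]mulr_natl.
move: NM; set X := 2 * M * c * _ => NM.
have eS : 0 <= e * \sum_i x 0 i ^+ 2 by rewrite mulr_ge0 ?(ltW e0).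
by rewrite mulrDr mulr1; lra.
Qed.

End trig_approximation.

Lemma measurable_cos_comp (R : realType) d (T : measurableType d) (f : T -> R) :
  measurable_fun setT f -> measurable_fun setT (fun w => cos (f w)).
Proof.
by move=> mf; apply: measurableT_comp => //; apply: continuous_measurable_fun; exact: continuous_cos.
Qed.

Section continuous_random_vector.
Context (R : realType) d (T : measurableType d) (n : nat) (V : 'I_n -> T -> R).
Hypothesis mV : forall i, measurable_fun setT (V i).
Local Notation Vv := (fun w => \row_i V i w).

Lemma measurable_trig (tau : 'rV[R]_n -> R) : trig tau ->
  measurable_fun setT (fun w => tau (Vv w)).
Proof.
elim=> [l a|f g _ IHf _ IHg|c f _ IHf].
- apply: measurable_cos_comp; apply: measurable_funD => //.
  apply: measurable_sum => i; apply: measurable_funM => //.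
  by under eq_fun do rewrite mxE; exact: mV.
- exact: measurable_funD.
- exact: measurable_funM.
Qed.

(** Measurability comes from the coordinates, because [phi] is a pointwise limit of trigonometric
    polynomials. *)
Lemma measurable_bounded_continuous_rV (phi : 'rV[R]_n -> R) (M : R) : continuous phi ->
  (forall x, `|phi x| <= M) -> measurable_fun setT (fun w => phi (Vv w)).
Proof.
move=> phic phiM.
have e0 k : 0 < k.+1%:R^-1 :> R by rewrite invr_gt0 ltr0n.
have /choice[tau taup] k : exists tau, trig tau /\
    forall x, `|phi x - tau x| <= k.+1%:R^-1 * (1 + \sum_i x 0 i ^+ 2).
  by have [tau] := trig_approx phic phiM (e0 k); exists tau.
apply: (measurable_fun_cvg (h := fun k w => tau k (Vv w))).
  by move=> k; apply: measurable_trig; have [] := taup k.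
move=> w _; apply/subr_cvg0; apply: norm_cvg0.
set S := 1 + \sum_i (Vv w) 0 i ^+ 2.
apply: (@squeeze_cvgr _ _ _ _ (cst 0) (fun k => harmonic k * S)).
- apply: nearW => k; rewrite normr_ge0/= distrC.
  by have [_ ->] := taup k.
- exact: cvg_cst.
- rewrite -[X in _ --> X](mul0r S); apply: cvgM; last exact: cvg_cst.
  exact: cvg_harmonic.
Qed.

Lemma measurable_continuous_rV (phi : 'rV[R]_n -> R) : continuous phi ->
  measurable_fun setT (fun w => phi (Vv w)).
Proof.
(* Bounded continuous functions of [y] that tend to [y]. *)
move=> phic; pose h k (y : R) := y / (1 + k.+1%:R^-1 * y ^+ 2).
have h0 k (y : R) : 0 < 1 + k.+1%:R^-1 * y ^+ 2 by rewrite ltr_wpDr// mulr_ge0 ?sqr_ge0.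
apply: (measurable_fun_cvg (h := fun k w => h k (phi (Vv w)))).
  move=> k; apply: (@measurable_bounded_continuous_rV (fun x => h k (phi x)) k.+1%:R).
    move=> x; apply: (cvgM (phic x)); apply: cvgV; first by rewrite gt_eqF.
    apply: (cvgD (cvg_cst (1 : R))); apply: (cvgM (cvg_cst (k.+1%:R^-1 : R))).
    by rewrite expr2; exact: (cvgM (phic x) (phic x)).
  move=> x; rewrite /h normrM normfV (gtr0_norm (h0 _ _)) ler_pdivrMr//.
  set y := phi x; rewrite mulrDr mulr1 mulrA divff ?pnatr_eq0// mul1r.
  have k1 : 1 <= k.+1%:R :> R by rewrite ler1n.
  rewrite -real_normK ?num_real//; have := sqr_ge0 (`|y| - 2^-1); nra.
move=> w _; apply/subr_cvg0; apply: norm_cvg0; set y := phi (Vv w).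
apply: (@squeeze_cvgr _ _ _ _ (cst 0) (fun k => harmonic k * `|y| ^+ 3)).
- apply: nearW => k; rewrite normr_ge0/=.
  rewrite (_ : h k y - y = - (k.+1%:R^-1 * y ^+ 3 / (1 + k.+1%:R^-1 * y ^+ 2))); last first.
    rewrite /h; have /lt0r_neq0 := h0 k y; move: (k.+1%:R^-1) => r r0; field.
    by rewrite r0.
  rewrite normrN normrM normfV (gtr0_norm (h0 _ _)) ler_pdivrMr// normrM normrX /harmonic/=.
  rewrite ger0_norm// ler_peMr ?mulr_ge0 ?exprn_ge0// lerDl mulr_ge0 ?sqr_ge0//.
- exact: cvg_cst.
- rewrite -[X in _ --> X](mul0r (`|y| ^+ 3)); apply: cvgM; last exact: cvg_cst.
  exact: cvg_harmonic.
Qed.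

End continuous_random_vector.

(** * Functions of polynomial growth *)

Section weight.
Context (R : realType) (n : nat).
Implicit Types x y : 'rV[R]_n.

Definition weight x : R := 1 + \sum_i x 0 i ^+ 2.

Lemma weight_ge1 x : 1 <= weight x.
Proof. by rewrite lerDl sumr_ge0// => i _; exact: sqr_ge0. Qed.

Lemma weight_gt0 x : 0 < weight x.
Proof. exact: lt_le_trans (weight_ge1 x). Qed.

Lemma weight_ge0 x : 0 <= weight x. Proof. exact/ltW/weight_gt0. Qed.

Lemma weight_sqr x i : x 0 i ^+ 2 <= weight x.
Proof.
rewrite /weight (bigD1 i)//= addrCA lerDl addr_ge0// sumr_ge0// => j _.
exact: sqr_ge0.
Qed.

Lemma weightX_le x i j : (i <= j)%N -> weight x ^+ i <= weight x ^+ j.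
Proof. by move=> ij; apply: ler_weXn2l => //; exact: weight_ge1. Qed.

Lemma weight_continuous k : continuous (fun x => weight x ^+ k).
Proof.
have wc : continuous weight.
  have sc : continuous (fun x => \sum_i x 0 i ^+ 2).
    apply: continuous_sum => i x.
    exact: (cvgM (@continuous_coord R n i x) (@continuous_coord R n i x)).
  by move=> x; exact: (cvgD (cvg_cst (1 : R)) (sc x)).
by move=> x; exact: (continuous_comp (wc x) (@exprn_continuous R k (weight x))).
Qed.

Lemma weight_shift x y : weight (x + y) <= 2 * weight x * weight y.
Proof.
rewrite (@le_trans _ _ (1 + 2 * \sum_i x 0 i ^+ 2 + 2 * \sum_i y 0 i ^+ 2))//.
  rewrite -addrA lerD2l !mulr_sumr -big_split/=; apply: ler_sum => i _.
  rewrite mxE; have := sqr_ge0 (x 0 i - y 0 i); nra.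
rewrite /weight; set a := \sum_i x 0 i ^+ 2; set b := \sum_i y 0 i ^+ 2.
have a0 : 0 <= a by rewrite sumr_ge0// => i _; exact: sqr_ge0.
have b0 : 0 <= b by rewrite sumr_ge0// => i _; exact: sqr_ge0.
nra.
Qed.

Lemma weight_scale x (t : R) : `|t| <= 1 -> weight (t *: x) <= weight x.
Proof.
move=> t1; rewrite lerD2l; apply: ler_sum => i _; rewrite mxE exprMn.
rewrite ler_piMl ?sqr_ge0// -real_normK ?num_real// exprn_ile1//.
Qed.

(** Dividing [phi] by [1 + r weight^k] makes it bounded. This costs at most [B r weight^(2k)], and
    [r] is such that [B r <= e / 2]. *)
Lemma trig_approx_weight (phi : 'rV[R]_n -> R) (B : R) k (e : R) : continuous phi ->
  (forall x, `|phi x| <= B * weight x ^+ k) -> 0 < e ->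
  exists2 tau : 'rV[R]_n -> R, trig tau &
    forall x, `|phi x - tau x| <= e * weight x ^+ (2 * k).+1.
Proof.
move=> phic phiB e0.
have B0 : 0 <= B.
  have := le_trans (normr_ge0 _) (phiB 0).
  by rewrite pmulr_lge0// exprn_gt0// weight_gt0.
pose r := e / 2 / (B + 1).
have r0 : 0 < r by rewrite divr_gt0 ?divr_gt0// ltr_wpDl.
have wk x : 0 <= weight x ^+ k by rewrite exprn_ge0// weight_ge0.
have d0 x : 0 < 1 + r * weight x ^+ k by rewrite ltr_wpDr// mulr_ge0// ltW.
pose g x := phi x / (1 + r * weight x ^+ k).
have gc : continuous g.
  move=> x; apply: (cvgM (phic x)); apply: cvgV; first by rewrite gt_eqF.
  apply: (cvgD (cvg_cst (1 : R))); apply: (cvgM (cvg_cst r)).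
  exact: weight_continuous.
have gB x : `|g x| <= B / r.
  rewrite /g normrM normfV (gtr0_norm (d0 _)) ler_pdivrMr// (le_trans (phiB x))//.
  by rewrite mulrDr mulr1 mulrA divfK ?gt_eqF// lerDr divr_ge0// ltW.
have [tau tt taug] := trig_approx gc gB (divr_gt0 e0 (ltr0Sn R 1)).
exists tau => // x.
have -> : phi x - tau x = (phi x - g x) + (g x - tau x) by ring.
rewrite (le_trans (ler_normD _ _))// (splitr e) mulrDl lerD//; last first.
  rewrite (le_trans (taug x))// -/(weight x) ler_pM2l ?divr_gt0//.
  by rewrite -[leLHS]expr1; exact: weightX_le.
have -> : phi x - g x = phi x * (r * weight x ^+ k) / (1 + r * weight x ^+ k).
  by rewrite /g; have /lt0r_neq0 := d0 x => ?; field.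
rewrite normrM normfV (gtr0_norm (d0 _)) ler_pdivrMr// normrM.
rewrite (ger0_norm (mulr_ge0 (ltW r0) (wk x))).
rewrite (@le_trans _ _ (B * weight x ^+ k * (r * weight x ^+ k)))//.
  by rewrite ler_wpM2r// mulr_ge0// ltW.
rewrite (_ : B * _ * _ = B * r * weight x ^+ (2 * k)); last first.
  by rewrite mul2n -addnn exprD; ring.
have h1 : B * r <= e / 2.
  rewrite /r mulrA ler_pdivrMr ?ltr_wpDl// mulrC ler_wpM2l ?divr_ge0 ?(ltW e0)//.
  by rewrite lerDl.
have w0 : 0 <= weight x ^+ (2 * k).+1 by rewrite exprn_ge0// weight_ge0.
have h2 : B * r * weight x ^+ (2 * k) <= e / 2 * weight x ^+ (2 * k).+1.
  apply: ler_pM => //; last exact: weightX_le.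
    by rewrite mulr_ge0 ?(ltW r0).
  by rewrite exprn_ge0// weight_ge0.
rewrite (le_trans h2)// ler_peMr ?mulr_ge0 ?divr_ge0 ?(ltW e0)//.
by rewrite lerDl mulr_ge0 ?(ltW r0).
Qed.

End weight.

(** * Gaussian integration by parts *)

Section gaussian_ibp.
Context (R : realType) d (T : measurableType d) (P : probability T R) (m : nat).
Context (V : 'I_m -> T -> R) (c : 'I_m -> 'I_m -> R).
Hypothesis GF : gaussian_family P V c.
Local Notation Vv := (fun w => \row_i V i w).
Implicit Types phi tau : 'rV[R]_m -> R.

Let Vm k : mom P (V k). Proof. exact: gf_mom GF k. Qed.
Let mV k : measurable_fun setT (V k). Proof. exact: mom_measurable (Vm k). Qed.

Lemma mom_weight j : mom P (fun w => weight (Vv w) ^+ j).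
Proof.
apply: momX; apply: momD; first exact: mom_cst.
by apply: mom_sum => i; apply: momX; under eq_fun do rewrite mxE; exact: Vm.
Qed.

Lemma mom_weight_le phi B j : continuous phi -> (forall x, `|phi x| <= B * weight x ^+ j) ->
  mom P (fun w => phi (Vv w)).
Proof.
move=> phic phiB; apply: (mom_le (g := fun w => B * weight (Vv w) ^+ j)) => //.
  exact: measurable_continuous_rV.
by apply: momM; [exact: mom_cst|exact: mom_weight].
Qed.

Lemma mom_trig tau : trig tau -> mom P (fun w => tau (Vv w)).
Proof.
move=> tt; have [M tM] := trig_bounded tt.
by apply: (@mom_bounded _ _ _ _ _ M) => //; exact: measurable_trig.
Qed.

Lemma trig_shift tau y : trig tau -> trig (fun x => tau (x + y)).
Proof.
elim=> [l a|f g _ IHf _ IHg|b f _ IHf]; [|exact: trigD|exact: trigZ].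
have := trig_cos l (euclidean_dot l y + a); congr trig; apply/funext => x.
congr cos; rewrite addrA; congr (_ + _); rewrite -big_split/=; apply: eq_bigr => i _.
by rewrite mxE mulrDr.
Qed.

Variable k : 'I_m.
(** The covariance vector of [V k]. Under the expectation, shifting the argument by [t v] amounts,
    to first order in [t], to inserting the factor [1 + t V_k] (Cameron-Martin). *)
Let v : 'rV[R]_m := \row_i c k i.

Section characteristic_function.
Variable l : 'rV[R]_m.
Let Q : R := \sum_i \sum_j l 0 i * l 0 j * c i j.
Let n := euclidean_dot l v.
Local Notation L := (fun w => euclidean_dot l (Vv w)).

Let mL : measurable_fun setT L.
Proof.
apply: measurable_sum => i; apply: measurable_funM => //.
by under eq_fun do rewrite mxE; exact: mV.
Qed.

(** The characteristic function of [u V_k + L], whose variance is [Q + 2 u n + u^2 c_kk]. *)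
Let E (u : R) := expR (- (Q + u * n *+ 2 + u ^+ 2 * c k k) / 2).

Let charfun u a : Ex P (fun w => cos (u * V k w + (L w + a))) = E u * cos a.
Proof.
pose x i := l 0 i + (i == k)%:R * u.
have xE (F : 'I_m -> R) : \sum_i x i * F i = \sum_i l 0 i * F i + u * F k.
  rewrite /x; under eq_bigr do rewrite mulrDl; rewrite big_split/=; congr (_ + _).
  rewrite (bigD1 k)//= eqxx mul1r big1 ?addr0// => i /negbTE ->; by rewrite !mul0r.
rewrite -[RHS](_ : expR (- (\sum_i \sum_j x i * x j * c i j) / 2) * cos a = _).
  rewrite -(gf_charfun GF); apply: eq_Ex => w; rewrite xE addrA; congr (cos (_ + _)).
  rewrite addrC; congr (_ + _); apply: eq_bigr => i _; by rewrite mxE.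
rewrite /E; congr (expR (- _ / 2) * _).
have -> : \sum_i \sum_j x i * x j * c i j = \sum_i x i * (\sum_j x j * c i j).
  by apply: eq_bigr => i _; rewrite mulr_sumr; apply: eq_bigr => j _; rewrite mulrA.
rewrite (xE (fun i => \sum_j x j * c i j)) (xE (c k)).
have -> : \sum_i l 0 i * (\sum_j x j * c i j) = Q + u * n.
  rewrite /Q /n /euclidean_dot mulr_sumr -big_split/=; apply: eq_bigr => i _.
  rewrite (xE (c i)) mulrDr mulr_sumr; congr (_ + _).
    by apply: eq_bigr => j _; rewrite mulrA.
  by rewrite mxE (gf_sym GF); ring.
have -> : \sum_i l 0 i * c k i = n by apply: eq_bigr => i _; rewrite mxE.
ring.
Qed.

Let Ed (u : R) : is_derive u 1 E (- (n + u * c k k) * E u).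
Proof. by apply: is_derive_eq; rewrite /GRing.scale/= /E; field. Qed.

Let is_derive_unique (f g : R -> R) (u a b : R) : f =1 g ->
  is_derive u 1 f a -> is_derive u 1 g b -> a = b.
Proof. by move=> /funext-> [_ <-] [_ <-]. Qed.

Let charfun_sin u a :
  Ex P (fun w => V k w * sin (u * V k w + (L w + a))) = (n + u * c k k) * E u * cos a.
Proof.
have mLa : measurable_fun setT (fun w => L w + a) by exact: measurable_funD.
have H2 := @is_derive_Ex_cos _ _ _ P (fun=> 1) (V k) _ u (mom_cst P 1) (Vm k) mLa.
have H3 : is_derive u 1 (fun u => E u * cos a) (- (n + u * c k k) * E u * cos a).
  by have ? := Ed u; apply: is_derive_eq; rewrite /GRing.scale/=; ring.
have H1 : (fun t => Ex P (fun w => 1 * cos (t * V k w + (L w + a)))) =1 (fun u => E u * cos a).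
  by move=> t; rewrite -charfun; apply: eq_Ex => w; rewrite mul1r.
have := is_derive_unique H1 H2 H3.
rewrite !mulNr => /oppr_inj <-.
by apply: eq_Ex => w; rewrite mul1r.
Qed.

Let charfun_cos u a :
  Ex P (fun w => V k w * cos (u * V k w + (L w + a))) = - (n + u * c k k) * E u * sin a.
Proof.
have := charfun_sin u (a + pi / 2).
rewrite cosD cos_pihalf sin_pihalf mulr0 mulr1 sub0r mulrN !mulNr => <-.
apply: eq_Ex => w; congr (_ * _).
by rewrite !addrA [in RHS]sinD cos_pihalf sin_pihalf mulr0 mulr1 add0r.
Qed.

Let charfun_sin2 u a :
  Ex P (fun w => V k w * V k w * sin (u * V k w + (L w + a))) =
  (c k k - (n + u * c k k) ^+ 2) * E u * sin a.
Proof.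
have mLa : measurable_fun setT (fun w => L w + a) by exact: measurable_funD.
have H2 := @is_derive_Ex_cos _ _ _ P (V k) (V k) _ u (Vm k) (Vm k) mLa.
have H3 : is_derive u 1 (fun u => - (n + u * c k k) * E u * sin a)
    (- ((c k k - (n + u * c k k) ^+ 2) * E u * sin a)).
  by have ? := Ed u; apply: is_derive_eq; rewrite /GRing.scale/=; ring.
have H1 : (fun t => Ex P (fun w => V k w * cos (t * V k w + (L w + a)))) =1
    (fun u => - (n + u * c k k) * E u * sin a).
  by move=> t; rewrite -charfun_cos.
have := is_derive_unique H1 H2 H3.
by move=> /oppr_inj <-.
Qed.

Let charfun_cos2 u a :
  Ex P (fun w => V k w * V k w * cos (u * V k w + (L w + a))) =
  (c k k - (n + u * c k k) ^+ 2) * E u * cos a.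
Proof.
have := charfun_sin2 u (a + pi / 2).
rewrite sinD cos_pihalf sin_pihalf mulr0 mulr1 add0r => <-.
apply: eq_Ex => w; congr (_ * _).
by rewrite !addrA [in RHS]sinD cos_pihalf sin_pihalf mulr0 mulr1 add0r.
Qed.

(** Shifting by [s v] only adds [s n] to the phase, where [n] is the covariance of [L] and [V k];
    all the expectations are thus explicit trigonometric functions of [s]. *)
Lemma is_derive_gauss_cos (t a : R) :
  is_derive t 1 (fun t => Ex P (fun w => cos (euclidean_dot l (Vv w + t *: v) + a)))
    (Ex P (fun w => V k w * cos (euclidean_dot l (Vv w + t *: v) + a))) /\
  is_derive t 1 (fun t => Ex P (fun w => V k w * cos (euclidean_dot l (Vv w + t *: v) + a)))
    (Ex P (fun w => (V k w ^+ 2 - c k k) * cos (euclidean_dot l (Vv w + t *: v) + a))).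
Proof.
have LE (s : R) w : euclidean_dot l (Vv w + s *: v) + a = 0 * V k w + (L w + (a + s * n)).
  rewrite mul0r add0r (addrC a) addrA; congr (_ + _).
  rewrite /euclidean_dot /n /euclidean_dot mulr_sumr -big_split/=; apply: eq_bigr => i _.
  by rewrite !mxE mulrDr; ring.
have E0 (s : R) : Ex P (fun w => cos (euclidean_dot l (Vv w + s *: v) + a)) = E 0 * cos (a + s * n).
  by rewrite -charfun; apply: eq_Ex => w; rewrite LE.
have E1 (s : R) : Ex P (fun w => V k w * cos (euclidean_dot l (Vv w + s *: v) + a)) =
    - n * E 0 * sin (a + s * n).
  have := charfun_cos 0 (a + s * n); rewrite mul0r addr0 => <-.
  by apply: eq_Ex => w; rewrite LE.
split.
  rewrite E1 (funext E0); apply: is_derive_eq; rewrite /GRing.scale/=; ring.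
have mC (s : R) : mom P (fun w => cos (euclidean_dot l (Vv w + s *: v) + a)).
  apply: mom_cos; under eq_fun do rewrite LE.
  by do ?[apply: measurable_funD => //]; exact: measurable_funM.
have -> : Ex P (fun w => (V k w ^+ 2 - c k k) * cos (euclidean_dot l (Vv w + t *: v) + a)) =
   - n ^+ 2 * E 0 * cos (a + t * n).
  rewrite (eq_Ex _ (g := fun w => V k w * V k w * cos (euclidean_dot l (Vv w + t *: v) + a)
     - c k k * cos (euclidean_dot l (Vv w + t *: v) + a))); last by move=> w; ring.
  have ? := mC t; have ? := Vm k; rewrite ExB; [|intg_tac|intg_tac].
  rewrite ExZ; last by intg_tac.
  rewrite E0; have := charfun_cos2 0 (a + t * n); rewrite mul0r addr0 => H.
  under eq_Ex do rewrite LE.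
  by rewrite H; ring.
rewrite (funext E1); apply: is_derive_eq; rewrite /GRing.scale/=; ring.
Qed.

End characteristic_function.

Lemma is_derive_gauss_trig tau (t : R) : trig tau ->
  is_derive t 1 (fun t => Ex P (fun w => tau (Vv w + t *: v)))
    (Ex P (fun w => V k w * tau (Vv w + t *: v))) /\
  is_derive t 1 (fun t => Ex P (fun w => V k w * tau (Vv w + t *: v)))
    (Ex P (fun w => (V k w ^+ 2 - c k k) * tau (Vv w + t *: v))).
Proof.
move=> tt; elim: tt t => [l a|f g tf IHf tg IHg|b f tf IHf] t; first exact: is_derive_gauss_cos.
- have fm s : mom P (fun w => f (Vv w + s *: v)) by exact: mom_trig (trig_shift _ tf).
  have gm s : mom P (fun w => g (Vv w + s *: v)) by exact: mom_trig (trig_shift _ tg).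
  have [f1 f2] := IHf t; have [g1 g2] := IHg t; have ? := Vm k.
  have S (F : T -> R) s : mom P F -> Ex P (fun w => F w * (f (Vv w + s *: v) + g (Vv w + s *: v))) =
      Ex P (fun w => F w * f (Vv w + s *: v)) + Ex P (fun w => F w * g (Vv w + s *: v)).
    move=> Fm; have ? := fm s; have ? := gm s; rewrite -ExD; [|intg_tac|intg_tac].
    by apply: eq_Ex => w; rewrite mulrDr.
  split.
    rewrite S//; have -> : (fun t => Ex P (fun w => f (Vv w + t *: v) + g (Vv w + t *: v))) =
      (fun t => Ex P (fun w => f (Vv w + t *: v))) + (fun t => Ex P (fun w => g (Vv w + t *: v))).
      by apply/funext => s; rewrite ExD//; exact: mom_intg.
    exact: is_deriveD.
  rewrite S; last by mom_tac.
  have -> : (fun t => Ex P (fun w => V k w * (f (Vv w + t *: v) + g (Vv w + t *: v)))) =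
      (fun t => Ex P (fun w => V k w * f (Vv w + t *: v))) + (fun t => Ex P (fun w => V k w * g (Vv w + t *: v))).
    by apply/funext => s; rewrite S.
  exact: is_deriveD.
- have fm s : mom P (fun w => f (Vv w + s *: v)) by exact: mom_trig (trig_shift _ tf).
  have [f1 f2] := IHf t; have ? := Vm k.
  have S (F : T -> R) s : mom P F -> Ex P (fun w => F w * (b * f (Vv w + s *: v))) =
      b *: Ex P (fun w => F w * f (Vv w + s *: v)).
    move=> Fm; have ? := fm s; rewrite /GRing.scale/= -ExZ; last by intg_tac.
    by apply: eq_Ex => w; rewrite mulrCA.
  split.
    rewrite S//; have -> : (fun t => Ex P (fun w => b * f (Vv w + t *: v))) =
      b \*: (fun t => Ex P (fun w => f (Vv w + t *: v))).
      by apply/funext => s; rewrite ExZ//; exact: mom_intg.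
    exact: is_deriveZ.
  rewrite S; last by mom_tac.
  have -> : (fun t => Ex P (fun w => V k w * (b * f (Vv w + t *: v)))) =
      b \*: (fun t => Ex P (fun w => V k w * f (Vv w + t *: v))).
    by apply/funext => s; rewrite S.
  exact: is_deriveZ.
Qed.

End gaussian_ibp.

(** * Functions with a directional derivative of polynomial growth *)

Section tame.
Context (R : realType) (m : nat) (v : 'rV[R]_m).
Implicit Types (f g : 'rV[R]_m -> R) (x : 'rV[R]_m) (s B : R).

(* [g] is the derivative of [f] along [v], with a Taylor remainder of second
   order that grows polynomially. *)
Definition tame f g := continuous f /\ continuous g /\
  exists (B : R) j, [/\ 0 <= B, forall x, `|f x| <= B * weight x ^+ j,
    forall x, `|g x| <= B * weight x ^+ j &
    forall (x : 'rV[R]_m) (s : R), 0 < s -> s <= 1 ->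
      `|f (x + s *: v) - f x - s * g x| <= B * s ^+ 2 * weight x ^+ j].

Let weightX_ge0 x j : 0 <= weight x ^+ j :> R.
Proof. by rewrite exprn_ge0// weight_ge0. Qed.

Lemma tame_common f1 g1 f2 g2 : tame f1 g1 -> tame f2 g2 ->
  exists (B : R) j, 1 <= B /\
   ([/\ forall x, `|f1 x| <= B * weight x ^+ j, forall x, `|g1 x| <= B * weight x ^+ j &
    forall (x : 'rV[R]_m) (s : R), 0 < s -> s <= 1 ->
      `|f1 (x + s *: v) - f1 x - s * g1 x| <= B * s ^+ 2 * weight x ^+ j] /\
   [/\ forall x, `|f2 x| <= B * weight x ^+ j, forall x, `|g2 x| <= B * weight x ^+ j &
    forall (x : 'rV[R]_m) (s : R), 0 < s -> s <= 1 ->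
      `|f2 (x + s *: v) - f2 x - s * g2 x| <= B * s ^+ 2 * weight x ^+ j]).
Proof.
move=> [_ [_ [B1 [j1 [B10 a1 b1 r1]]]]] [_ [_ [B2 [j2 [B20 a2 b2 r2]]]]].
exists (1 + B1 + B2), (j1 + j2)%N.
have h1 (a : R) (x : 'rV[R]_m) : 0 <= a -> B1 * a * weight x ^+ j1 <= (1 + B1 + B2) * a * weight x ^+ (j1 + j2).
  move=> a0; apply: ler_pM; rewrite ?mulr_ge0//; first by rewrite ler_wpM2r//; lra.
  by apply: weightX_le; exact: leq_addr.
have h2 (a : R) (x : 'rV[R]_m) : 0 <= a -> B2 * a * weight x ^+ j2 <= (1 + B1 + B2) * a * weight x ^+ (j1 + j2).
  move=> a0; apply: ler_pM; rewrite ?mulr_ge0//; first by rewrite ler_wpM2r//; lra.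
  by apply: weightX_le; exact: leq_addl.
split; first lra.
split; split=> [x|x|x s s0 s1].
- by rewrite (le_trans (a1 x))//; have := h1 1 x ler01; rewrite !mulr1.
- by rewrite (le_trans (b1 x))//; have := h1 1 x ler01; rewrite !mulr1.
- by rewrite (le_trans (r1 x s s0 s1))// h1// sqr_ge0.
- by rewrite (le_trans (a2 x))//; have := h2 1 x ler01; rewrite !mulr1.
- by rewrite (le_trans (b2 x))//; have := h2 1 x ler01; rewrite !mulr1.
- by rewrite (le_trans (r2 x s s0 s1))// h2// sqr_ge0.
Qed.

Lemma tame_cst a : tame (fun=> a) (fun=> 0).
Proof.
split; first exact: cst_continuous.
split; first exact: cst_continuous.
exists `|a|, 0%N; split=> // x; rewrite ?expr0 ?mulr1// ?normr0//.
by move=> s _ _; rewrite subrr mulr0 subr0 normr0 mulr1 mulr_ge0// sqr_ge0.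
Qed.

Lemma tame_coord i : tame (fun x => x 0 i) (fun=> v 0 i).
Proof.
split; first exact: continuous_coord.
split; first exact: cst_continuous.
exists (1 + `|v 0 i|), 1%N; have v0 : 0 <= `|v 0 i| by [].
split=> [|x|x|x s s0 s1]; first lra.
- rewrite expr1; have := weight_sqr x i; have := weight_ge1 x.
  rewrite -real_normK ?num_real//; have := normr_ge0 (x 0 i); move: (weight x) => q.
  have := sqr_ge0 (`|x 0 i| - 1); nra.
- by rewrite expr1; have := weight_ge1 x; nra.
- rewrite !mxE (_ : _ - _ = 0) ?normr0; last by ring.
  by rewrite mulr_ge0// mulr_ge0 ?sqr_ge0//; lra.
Qed.

Lemma tameD f1 g1 f2 g2 : tame f1 g1 -> tame f2 g2 ->
  tame (fun x => f1 x + f2 x) (fun x => g1 x + g2 x).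
Proof.
move=> t1 t2; have [B [j [B1 [[a1 b1 r1] [a2 b2 r2]]]]] := tame_common t1 t2.
have [cf1 [cg1 _]] := t1; have [cf2 [cg2 _]] := t2.
split; first by move=> x; exact: (cvgD (cf1 x) (cf2 x)).
split; first by move=> x; exact: (cvgD (cg1 x) (cg2 x)).
exists (2 * B), j; split=> [|x|x|x s s0 s1]; first lra.
- by rewrite (le_trans (ler_normD _ _))// -mulrA mulr_natl mulr2n lerD.
- by rewrite (le_trans (ler_normD _ _))// -mulrA mulr_natl mulr2n lerD.
- rewrite (_ : _ - _ = (f1 (x + s *: v) - f1 x - s * g1 x) + (f2 (x + s *: v) - f2 x - s * g2 x)); last by ring.
  by rewrite (le_trans (ler_normD _ _))// -2!mulrA mulr_natl mulr2n [B * _]mulrA lerD// ?r1 ?r2.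
Qed.

Let increment f g B j : 1 <= B -> (forall x, `|g x| <= B * weight x ^+ j) ->
  (forall (x : 'rV[R]_m) (s : R), 0 < s -> s <= 1 ->
      `|f (x + s *: v) - f x - s * g x| <= B * s ^+ 2 * weight x ^+ j) ->
  forall (x : 'rV[R]_m) (s : R), 0 < s -> s <= 1 -> `|f (x + s *: v) - f x| <= 2 * s * B * weight x ^+ j.
Proof.
move=> B1 b r x s s0 s1.
rewrite -[X in `|X|](subrK (s * g x)) (le_trans (ler_normD _ _))//.
rewrite (_ : 2 * s * B * _ = B * s * weight x ^+ j + s * (B * weight x ^+ j)); last by ring.
rewrite lerD//; last by rewrite normrM gtr0_norm// ler_pM2l.
rewrite (le_trans (r x s s0 s1))// ler_wpM2r// ler_wpM2l//; first lra.
by rewrite expr2 ler_piMr// ltW.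
Qed.

Lemma tameM f1 g1 f2 g2 : tame f1 g1 -> tame f2 g2 ->
  tame (fun x => f1 x * f2 x) (fun x => g1 x * f2 x + f1 x * g2 x).
Proof.
move=> t1 t2; have [B [j [B1 [[a1 b1 r1] [a2 b2 r2]]]]] := tame_common t1 t2.
have [cf1 [cg1 _]] := t1; have [cf2 [cg2 _]] := t2.
split; first by move=> x; exact: (cvgM (cf1 x) (cf2 x)).
split.
  by move=> x; exact: (cvgD (cvgM (cg1 x) (cf2 x)) (cvgM (cf1 x) (cg2 x))).
have dbl (x : 'rV[R]_m) : weight x ^+ (2 * j) = weight x ^+ j * weight x ^+ j.
  by rewrite mul2n -addnn exprD.
have B0 : 0 <= B by lra.
have h (u1 u2 : R) (x : 'rV[R]_m) : `|u1| <= B * weight x ^+ j -> `|u2| <= B * weight x ^+ j ->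
    `|u1 * u2| <= B ^+ 2 * weight x ^+ (2 * j).
  move=> h1 h2; rewrite normrM dbl (_ : B ^+ 2 * _ = (B * weight x ^+ j) * (B * weight x ^+ j)); last by ring.
  exact: ler_pM.
(* In the remainder of the product, the remainders of the two factors contribute [1] each and the
   product of the two increments contributes [4]. *)
exists (6 * B ^+ 2), (2 * j)%N; split=> [|x|x|x s s0 s1].
- by rewrite mulr_ge0// sqr_ge0.
- rewrite (le_trans (h _ _ _ (a1 x) (a2 x)))// ler_wpM2r//.
  by have := sqr_ge0 B; lra.
- rewrite (le_trans (ler_normD _ _))//.
  have h1 := h _ _ _ (b1 x) (a2 x); have h2 := h _ _ _ (a1 x) (b2 x).
  have : 0 <= B ^+ 2 * weight x ^+ (2 * j) by rewrite mulr_ge0// sqr_ge0.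
  lra.
- have i1 := increment B1 b1 r1 x s0 s1; have i2 := increment B1 b2 r2 x s0 s1.
  have q1 := r1 x s s0 s1; have q2 := r2 x s s0 s1.
  move: (f1 (x + s *: v)) (f2 (x + s *: v)) i1 i2 q1 q2 => y1 y2 i1 i2 q1 q2.
  rewrite (_ : _ - _ = (y1 - f1 x - s * g1 x) * f2 x + f1 x * (y2 - f2 x - s * g2 x)
      + (y1 - f1 x) * (y2 - f2 x)); last by ring.
  rewrite (le_trans (ler_normD _ _))//.
  rewrite (_ : 6 * B ^+ 2 * s ^+ 2 * _ = (B * s ^+ 2 * weight x ^+ j) * (B * weight x ^+ j)
    + (B * weight x ^+ j) * (B * s ^+ 2 * weight x ^+ j)
    + (2 * s * B * weight x ^+ j) * (2 * s * B * weight x ^+ j)); last by rewrite dbl; ring.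
  rewrite lerD//; last by rewrite normrM ler_pM.
  by rewrite (le_trans (ler_normD _ _))// lerD// normrM ler_pM.
Qed.

(** Applied with [(C, S) = (cos, - sin)] and [(sin, cos)]. *)
Let tame_trig f g (C S : R -> R) : continuous C -> continuous S ->
  (forall y, `|C y| <= 1) -> (forall y, `|S y| <= 1) ->
  (forall a h, `|C (a + h) - C a - h * S a| <= h ^+ 2) ->
  tame f g -> tame (fun x => C (f x)) (fun x => g x * S (f x)).
Proof.
move=> Cc Sc C1 S1 CS t1.
have [B [j [B1 [[a b r] _]]]] := tame_common t1 t1.
have [cf [cg _]] := t1.
split; first by move=> x; exact: (continuous_comp (cf x) (Cc (f x))).
split; first by move=> x; exact: (cvgM (cg x) (continuous_comp (cf x) (Sc (f x)))).
have dbl (x : 'rV[R]_m) : weight x ^+ (2 * j) = weight x ^+ j * weight x ^+ j.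
  by rewrite mul2n -addnn exprD.
have B0 : 0 <= B by lra.
have w1 (x : 'rV[R]_m) k : 1 <= weight x ^+ k by rewrite exprn_ege1// weight_ge1.
have BB : B <= B ^+ 2 by rewrite expr2 ler_peMr.
have Bw (x : 'rV[R]_m) : B * weight x ^+ j <= B ^+ 2 * weight x ^+ (2 * j).
  by rewrite ler_pM// dbl ler_peMr.
(* The quadratic error of [C] over the increment of [f] contributes [4], the remainder of [f]
   contributes [1]. *)
exists (5 * B ^+ 2), (2 * j)%N; split=> [|x|x|x s s0 s1].
- by rewrite mulr_ge0// sqr_ge0.
- rewrite (le_trans (C1 _))//; have := w1 x (2 * j)%N; have := sqr_ge0 B; nra.
- rewrite normrM (@le_trans _ _ (B * weight x ^+ j))//.
    by rewrite -[leRHS]mulr1 ler_pM.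
  rewrite (le_trans (Bw x))// ler_wpM2r//; have := sqr_ge0 B; lra.
- have i1 := increment B1 b r x s0 s1; have q1 := r x s s0 s1.
  move: (f (x + s *: v)) i1 q1 => y i1 q1.
  have := CS (f x) (y - f x); rewrite subrKC => cs.
  rewrite (_ : _ - _ = (C y - C (f x) - (y - f x) * S (f x)) + (y - f x - s * g x) * S (f x)); last by ring.
  rewrite (le_trans (ler_normD _ _))//.
  rewrite (_ : 5 * B ^+ 2 * s ^+ 2 * _ = (2 * s * B * weight x ^+ j) ^+ 2
      + s ^+ 2 * (B ^+ 2 * weight x ^+ (2 * j))); last by rewrite dbl; ring.
  rewrite lerD//.
    rewrite (le_trans cs)// -real_normK ?num_real// lerXn2r ?nnegrE//.
    by rewrite !mulr_ge0// ltW.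
  rewrite normrM (@le_trans _ _ (B * s ^+ 2 * weight x ^+ j))//.
    by rewrite -[leRHS]mulr1 ler_pM.
  by rewrite mulrAC mulrC ler_wpM2l ?sqr_ge0.
Qed.

Lemma tame_cos f g : tame f g -> tame (fun x => cos (f x)) (fun x => g x * - sin (f x)).
Proof.
apply: (@tame_trig f g cos (fun y => - sin y)).
- exact: continuous_cos.
- by move=> x; apply: cvgN; exact: continuous_sin.
- by move=> y; rewrite ler_norml cos_geN1 cos_le1.
- by move=> y; rewrite normrN ler_norml sin_geN1 sin_le1.
- by move=> a h; rewrite mulrN opprK; exact: cos_quadratic.
Qed.

Lemma tame_sin f g : tame f g -> tame (fun x => sin (f x)) (fun x => g x * cos (f x)).
Proof.
apply: tame_trig.
- exact: continuous_sin.
- exact: continuous_cos.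
- by move=> y; rewrite ler_norml sin_geN1 sin_le1.
- by move=> y; rewrite ler_norml cos_geN1 cos_le1.
- exact: sin_quadratic.
Qed.

End tame.

Lemma continuous_rV_shift (R : realType) m (y : 'rV[R]_m) :
  continuous (fun x : 'rV[R]_m => x + y).
Proof.
move=> x A [B xB BA].
exists (fun i j => [set r | B i j (r + y i j)]).
  move=> i j /=.
  have : nbhs (x i j + y i j) (B i j) by have := xB i j; rewrite mxE.
  by move/(@cvgD _ _ _ _ _ id (fun=> y i j) _ _ cvg_id (cvg_cst (y i j))).
by move=> z zB; apply: BA => i j; rewrite mxE; exact: zB.
Qed.

Section tame_ibp.
Context (R : realType) d (T : measurableType d) (P : probability T R) (m : nat).
Context (V : 'I_m -> T -> R) (c : 'I_m -> 'I_m -> R).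
Hypothesis GF : gaussian_family P V c.
Local Notation Vv := (fun w => \row_i V i w).
Variable k : 'I_m.
Let v : 'rV[R]_m := \row_i c k i.
Let A : R := 2 * weight v.

Let A1 : 1 <= A. Proof. by rewrite /A; have := weight_ge1 v; lra. Qed.

Let weight_shiftX (x : 'rV[R]_m) (s : R) j : `|s| <= 1 ->
  weight (x + s *: v) ^+ j <= A ^+ j * weight x ^+ j.
Proof.
move=> s1; rewrite -exprMn lerXn2r ?nnegrE ?weight_ge0//.
  by rewrite mulr_ge0 ?weight_ge0// (le_trans ler01).
rewrite (le_trans (weight_shift _ _))// /A mulrAC ler_wpM2r ?weight_ge0//.
by rewrite ler_wpM2l// weight_scale.
Qed.

Let mom_shift (f : 'rV[R]_m -> R) (B : R) j (s : R) : continuous f ->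
  (forall x, `|f x| <= B * weight x ^+ j) -> `|s| <= 1 ->
  mom P (fun w => f (Vv w + s *: v)).
Proof.
move=> fc fB s1.
apply: (@mom_weight_le _ _ _ _ _ _ _ GF (fun x => f (x + s *: v)) (`|B| * A ^+ j) j).
  move=> x; apply: continuous_comp; last exact: fc.
  exact: continuous_rV_shift.
move=> x; rewrite (le_trans (fB _))// -mulrA.
rewrite (@le_trans _ _ (`|B| * weight (x + s *: v) ^+ j))//.
  by rewrite ler_wpM2r ?ler_norm// exprn_ge0// weight_ge0.
by rewrite ler_wpM2l// weight_shiftX.
Qed.

Let D (f : 'rV[R]_m -> R) s := Ex P (fun w => f (Vv w + s *: v)) - Ex P (fun w => f (Vv w))
  - s * Ex P (fun w => V k w * f (Vv w)).

(** The remainder is quadratic although [f] is only continuous. For a trigonometric polynomial the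
    second derivative in [s] is the expectation of [(V_k^2 - c_kk) tau], which contains no
    derivative of [tau]; hence [K] depends on the growth of [f] alone, and the bound passes to [f]
    by approximation. *)
Lemma gauss_taylor (f : 'rV[R]_m -> R) (B : R) j : continuous f ->
  (forall x, `|f x| <= B * weight x ^+ j) ->
  exists K, forall s, 0 < s -> s <= 1 -> `|D f s| <= K * s ^+ 2.
Proof.
move=> fc fB; pose J := (2 * j).+1.
have Vm := gf_mom GF k; have Wm i := mom_weight GF i.
have WJ := Wm J.
pose N w := `|V k w ^+ 2 - c k k|.
have Nm : mom P N by rewrite /N; mom_tac.
pose K := Ex P (fun w => N w * ((`|B| + 1) * (A ^+ J * weight (Vv w) ^+ J))).
pose K2 := Ex P (fun w => A ^+ J * weight (Vv w) ^+ J) + Ex P (fun w => weight (Vv w) ^+ J)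
  + Ex P (fun w => `|V k w| * weight (Vv w) ^+ J).
exists K => s s0 s1.
have s1' : `|s| <= 1 by rewrite gtr0_norm.
have AJ0 i (x : 'rV[R]_m) : 0 <= A ^+ i * weight x ^+ i.
  by rewrite -exprMn exprn_ge0// mulr_ge0 ?weight_ge0// (le_trans ler01).
have K20 : 0 <= K2.
  rewrite !addr_ge0//; apply: Ex_ge0 => w //; first by rewrite exprn_ge0// weight_ge0.
  by rewrite mulr_ge0// exprn_ge0// weight_ge0.
have fm0 : mom P (fun w => f (Vv w)) by exact: (mom_weight_le GF fc fB).
have fms := mom_shift fc fB s1'.
apply/ler_addgt0Pr => e e0.
(* [dl <= 1] keeps the growth constant of [tau] below [|B| + 1], so that [K] does not depend on [e];
   replacing [f] by [tau] changes the remainder by at most [dl K2 <= e]. *)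
pose dl := Num.min 1 (e / (K2 + 1)).
have dl0 : 0 < dl by rewrite lt_min ltr01 divr_gt0// ltr_wpDl.
have dl1 : dl <= 1 by rewrite ge_min lexx.
have dlK : dl * K2 <= e.
  have : dl <= e / (K2 + 1) by rewrite ge_min lexx orbT.
  rewrite ler_pdivlMr ?ltr_wpDl// => H; rewrite (le_trans _ H)// ler_wpM2l ?(ltW dl0)//.
  by rewrite lerDl.
have [tau tt taug] := trig_approx_weight fc fB dl0.
have tauB x : `|tau x| <= (`|B| + 1) * weight x ^+ J.
  rewrite -[tau x](subKr (f x)) (le_trans (ler_normB _ _))// mulrDl lerD//.
    rewrite (@le_trans _ _ (`|B| * weight x ^+ j))//.
      by rewrite (le_trans (fB x))// ler_wpM2r ?ler_norm// exprn_ge0// weight_ge0.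
    by rewrite ler_wpM2l//; apply: weightX_le; rewrite /J mul2n -addnn -addSn leq_addl.
  by rewrite (le_trans (taug x))// ler_wpM2r// exprn_ge0// weight_ge0.
have taum s' : mom P (fun w => tau (Vv w + s' *: v)).
  exact: (mom_trig GF (trig_shift (s' *: v) tt)).
have taum0 : mom P (fun w => tau (Vv w)) by exact: (mom_trig GF tt).
have Dtau : `|D tau s| <= K * s ^+ 2.
  (* The derivative at [0] is the linear term of [D], so the mean value theorem is applied twice. *)
  have g1 t := (is_derive_gauss_trig GF k t tt).1.
  have g2 t := (is_derive_gauss_trig GF k t tt).2.
  have [xi xi1] := MVT_norm 0 s g1.
  rewrite !subr0 in xi1 *; rewrite scale0r; under [X in _ - X]eq_Ex do rewrite addr0.
  rewrite /D => ->.
  have [eta eta1] := MVT_norm 0 xi g2.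
  rewrite !subr0 in eta1 *; rewrite scale0r; under [X in _ - X]eq_Ex do rewrite addr0.
  move=> E; rewrite mulrC -mulrBr E normrM normrM.
  rewrite mulrC expr2 mulrA ler_pM// ?mulr_ge0//; last by rewrite gtr0_norm.
  rewrite ler_pM//; last by rewrite (le_trans xi1)// gtr0_norm.
  apply: Ex_norm_le; [|by rewrite /K; intg_tac|].
    by have ? := taum eta; intg_tac.
  move=> w; rewrite normrM ler_wpM2l// (le_trans (tauB _))// ler_wpM2l ?addr_ge0//.
  by rewrite weight_shiftX// (le_trans eta1)// (le_trans xi1).
have Dd : `|D f s - D tau s| <= dl * K2.
  have ? := taum s.
  have -> : D f s - D tau s = Ex P (fun w => f (Vv w + s *: v) - tau (Vv w + s *: v))
     - Ex P (fun w => f (Vv w) - tau (Vv w)) - s * Ex P (fun w => V k w * (f (Vv w) - tau (Vv w))).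
    rewrite !ExB; try by intg_tac.
    have -> : Ex P (fun w => V k w * (f (Vv w) - tau (Vv w))) =
        Ex P (fun w => V k w * f (Vv w) - V k w * tau (Vv w)).
      by apply: eq_Ex => w; ring.
    rewrite ExB; try by intg_tac.
    by rewrite /D; ring.
  rewrite (le_trans (ler_normB _ _))// (le_trans (lerD (ler_normB _ _) (lexx _)))//.
  rewrite /K2 !mulrDr -!ExZ; try by intg_tac.
  rewrite lerD//; first rewrite lerD//.
  - apply: Ex_norm_le; [by intg_tac|by intg_tac|] => w.
    by rewrite (le_trans (taug _))// ler_wpM2l ?(ltW dl0)// weight_shiftX.
  - by apply: Ex_norm_le; [by intg_tac|by intg_tac|] => w.
  - apply: Ex_norm_le; [by intg_tac|by intg_tac|] => w.
    rewrite normrM -[leRHS]mul1r ler_pM//.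
    by rewrite normrM mulrCA ler_wpM2l.
rewrite -[D f s](subrK (D tau s)) (le_trans (ler_normD _ _))// addrC lerD//.
exact: le_trans Dd dlK.
Qed.

(** Both sides are the first-order coefficient of [E f(V + s v)] at [s = 0]: the left one by
    [gauss_taylor], the right one by the pointwise expansion in [tame]. *)
Lemma tame_ibp f g : tame v f g ->
  Ex P (fun w => V k w * f (Vv w)) = Ex P (fun w => g (Vv w)).
Proof.
move=> [fc [gc [B [j [B0 fB gB r]]]]].
have [K HK] := gauss_taylor fc fB.
have fm0 : mom P (fun w => f (Vv w)) by exact: (mom_weight_le GF fc fB).
have gm0 : mom P (fun w => g (Vv w)) by exact: (mom_weight_le GF gc gB).
have Wm := mom_weight GF j.
apply: (@quadratic_bound_eq _ _ _ (K + Ex P (fun w => B * weight (Vv w) ^+ j))) => s s0 s1.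
have fms : mom P (fun w => f (Vv w + s *: v)).
  by apply: (mom_shift fc fB); rewrite gtr0_norm.
have H : `|Ex P (fun w => f (Vv w + s *: v)) - Ex P (fun w => f (Vv w)) - s * Ex P (fun w => g (Vv w))|
    <= Ex P (fun w => B * weight (Vv w) ^+ j) * s ^+ 2.
  rewrite -ExZ; last by intg_tac.
  rewrite -ExB; try by intg_tac.
  rewrite -ExB; try by intg_tac.
  rewrite mulrC -ExZ; last by intg_tac.
  apply: Ex_norm_le; [by intg_tac|by intg_tac|] => w.
  by rewrite (le_trans (r _ _ s0 s1))// [leRHS]mulrA (mulrC B).
have := HK s s0 s1; rewrite /D; move: H.
set a := Ex P (fun w => f (Vv w + s *: v)) - Ex P (fun w => f (Vv w)).
move=> H1 H2; rewrite mulrDl [leRHS]addrC.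
rewrite (_ : s * _ - s * _ = (a - s * Ex P (fun w => g (Vv w))) - (a - s * Ex P (fun w => V k w * f (Vv w)))); last by ring.
by rewrite (le_trans (ler_normB _ _))// lerD.
Qed.

End tame_ibp.

(** * Malliavin derivatives of functions of finitely many Gaussian variables *)

Section wiener_derivative.
Context (R : realType) d (T : measurableType d) (P : probability T R) (m : nat).
Context (V : 'I_m -> T -> R) (c : 'I_m -> 'I_m -> R).
Implicit Types f g : T -> R.

(* [wder k f g] says that [g = <Df, h_k>] for the Malliavin derivative [D], where
   [V k = W(h_k)]. *)
Inductive wder (k : 'I_m) : (T -> R) -> (T -> R) -> Prop :=
| wder_cst a : wder k (fun=> a) (fun=> 0)
| wder_var l : wder k (V l) (fun=> c k l)
| wderD f1 g1 f2 g2 : wder k f1 g1 -> wder k f2 g2 ->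
    wder k (fun w => f1 w + f2 w) (fun w => g1 w + g2 w)
| wderM f1 g1 f2 g2 : wder k f1 g1 -> wder k f2 g2 ->
    wder k (fun w => f1 w * f2 w) (fun w => g1 w * f2 w + f1 w * g2 w)
| wder_cos f g : wder k f g -> wder k (fun w => cos (f w)) (fun w => g w * - sin (f w))
| wder_sin f g : wder k f g -> wder k (fun w => sin (f w)) (fun w => g w * cos (f w)).

Lemma wder_ext k f1 f2 g1 g2 : wder k f1 g1 -> f1 =1 f2 -> g1 =1 g2 -> wder k f2 g2.
Proof. by move=> ? /funext <- /funext <-. Qed.

Lemma wder_tame k f g : wder k f g ->
  exists phi psi, [/\ tame (\row_i c k i) phi psi, f = (fun w => phi (\row_i V i w)) &
    g = (fun w => psi (\row_i V i w))].
Proof.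
elim=> {f g} [a|l|f1 g1 f2 g2 _ [p1 [q1 [t1 -> ->]]] _ [p2 [q2 [t2 -> ->]]]
  |f1 g1 f2 g2 _ [p1 [q1 [t1 -> ->]]] _ [p2 [q2 [t2 -> ->]]]
  |f g _ [p [q [t -> ->]]]|f g _ [p [q [t -> ->]]]].
- by exists (fun=> a), (fun=> 0); split=> //; exact: tame_cst.
- exists (fun x => x 0 l), (fun=> (\row_i c k i) 0 l); split=> //.
  + exact: tame_coord.
  + by apply/funext => w; rewrite mxE.
  + by apply/funext => w; rewrite mxE.
- by exists (fun x => p1 x + p2 x), (fun x => q1 x + q2 x); split=> //; exact: tameD.
- exists (fun x => p1 x * p2 x), (fun x => q1 x * p2 x + p1 x * q2 x).
  by split=> //; exact: tameM.
- by exists (fun x => cos (p x)), (fun x => q x * - sin (p x)); split=> //; exact: tame_cos.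
- by exists (fun x => sin (p x)), (fun x => q x * cos (p x)); split=> //; exact: tame_sin.
Qed.

Hypothesis GF : gaussian_family P V c.

Lemma wder_mom k f g : wder k f g -> mom P f /\ mom P g.
Proof.
move=> /wder_tame[p [q [[pc [qc [B [j [_ pB qB _]]]]] -> ->]]].
by split; [exact: (mom_weight_le GF pc pB)|exact: (mom_weight_le GF qc qB)].
Qed.

Lemma wder_ibp k f g : wder k f g -> Ex P (fun w => V k w * f w) = Ex P g.
Proof. by move=> /wder_tame[p [q [t -> ->]]]; exact: (tame_ibp GF t). Qed.

Lemma wderZ k a f g : wder k f g -> wder k (fun w => a * f w) (fun w => a * g w).
Proof.
move=> fg; apply: wder_ext (wderM (wder_cst k a) fg) _ _ => w //.
by rewrite mul0r add0r.
Qed.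

Lemma wder_sum k (J : Type) (s : seq J) (F G : J -> T -> R) :
  (forall j, wder k (F j) (G j)) ->
  wder k (fun w => \sum_(j <- s) F j w) (fun w => \sum_(j <- s) G j w).
Proof.
move=> FG; elim: s => [|j s IH].
  by apply: wder_ext (wder_cst k 0) _ _ => w; rewrite big_nil.
by apply: wder_ext (wderD (FG j) IH) _ _ => w; rewrite big_cons.
Qed.

Lemma wderX k f g n : wder k f g ->
  wder k (fun w => f w ^+ n) (fun w => n%:R * f w ^+ n.-1 * g w).
Proof.
move=> fg; elim: n => [|n IH].
  by apply: wder_ext (wder_cst k 1) _ _ => w; rewrite ?expr0// !mul0r.
apply: wder_ext (wderM fg IH) _ _ => w; first by rewrite exprS.
case: n {IH} => [|n] /=; first by rewrite !expr0; ring.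
by rewrite -[in RHS]natr1 [in LHS]mulrCA exprS; ring.
Qed.

End wiener_derivative.

(** * Hermite polynomials and Wick products *)

Section hermite_values.
Context (R : realType).

Definition herm n (x : R) : R := (hermite R n).[x].

Lemma deriv_hermite n : (hermite R n)^`() = n%:R *: hermite R n.-1.
Proof.
elim: n => [|n IH] /=; first by rewrite derivC scale0r.
rewrite derivB derivM derivX mul1r IH derivZ; case: n IH => [|n] IH /=.
  by rewrite !scale0r mulr0 addr0 subr0 scale1r.
by rewrite -!mul_polyC -[n.+2%:R]natr1 polyCD; ring.
Qed.

Lemma herm0 x : herm 0 x = 1.
Proof. by rewrite /herm /= hornerC. Qed.

Lemma hermS n x : herm n.+1 x = x * herm n x - n%:R * herm n.-1 x.
Proof. by rewrite /herm /= deriv_hermite !hornerE. Qed.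

(* The Wick product of [herm a x] and [herm b y] for standard Gaussian variables
   [x], [y] of covariance [r]. *)
Fixpoint wick (r : R) a b (x y : R) : R :=
  if a is a'.+1 then
    x * wick r a' b x y - a'%:R * (if a' is a''.+1 then wick r a'' b x y else 0)
      - b%:R * r * wick r a' b.-1 x y
  else herm b y.

Lemma wick0 r b x y : wick r 0 b x y = herm b y. Proof. by []. Qed.

Lemma wickS r a b x y : wick r a.+1 b x y =
  x * wick r a b x y - a%:R * wick r a.-1 b x y - b%:R * r * wick r a b.-1 x y.
Proof. by case: a => [|a] //=; rewrite !mul0r. Qed.

Arguments wick : simpl never.

(** Product formula: [i] pairs are contracted, in ['C(a, i) b^_i] ways, each with a factor [r]. As a
    function of [a] the sum satisfies the three-term recurrence of [herm]. *)
Lemma herm_mul_wick r a b x y : herm a x * herm b y =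
  \sum_(i < a.+1) 'C(a, i)%:R * (b ^_ i)%:R * r ^+ i * wick r (a - i) (b - i) x y.
Proof.
pose S a b := \sum_(0 <= i < a.+1) 'C(a, i)%:R * (b ^_ i)%:R * r ^+ i * wick r (a - i) (b - i) x y.
rewrite -(big_mkord xpredT (fun i => 'C(a, i)%:R * (b ^_ i)%:R * r ^+ i * wick r (a - i) (b - i) x y)).
rewrite -/(S a b).
have S0 : S 0%N b = herm b y by rewrite /S big_nat1 bin0 ffactn0 expr0 !mul1r !subn0.
have SS n : S n.+1 b = x * S n b - n%:R * S n.-1 b.
  (* Pascal's rule for ['C(n + 1, i)]: the additional left factor is either free or contracted. *)
  have pascal : S n.+1 b =
      \sum_(0 <= i < n.+1) 'C(n, i)%:R * (b ^_ i)%:R * r ^+ i * wick r (n.+1 - i) (b - i) x y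
      + \sum_(0 <= i < n.+1) 'C(n, i)%:R * (b ^_ i.+1)%:R * r ^+ i.+1 * wick r (n - i) (b - i.+1) x y.
    rewrite /S big_nat_recl// [X in _ = X + _]big_nat_recl//.
    rewrite !bin0 -addrA; congr (_ + _).
    under eq_bigr do rewrite binS natrD mulrDl mulrDl mulrDl subSS.
    rewrite big_split/=; congr (_ + _).
    rewrite big_nat_recr//= bin_small// !mul0r addr0.
    by apply: eq_bigr => i _; rewrite subSS.
  (* The recurrence of [wick] produces the factor [n - i], and
     [(n - i) 'C(n, i) = n 'C(n - 1, i)]. *)
  have lower : n%:R * S n.-1 b =
      \sum_(0 <= i < n.+1) (n - i)%:R * ('C(n, i)%:R * (b ^_ i)%:R * r ^+ i * wick r (n - i).-1 (b - i) x y).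
    case: n {pascal} => [|n]; first by rewrite mul0r big_nat1 subn0 mul0r.
    rewrite [RHS]big_nat_recr//= subnn mul0r addr0 /S mulr_sumr.
    apply: eq_big_nat => i /andP[_ im].
    rewrite !mulrA; congr (_ * _ * _ * _).
      by rewrite -!natrM -mul_bin_down.
    by rewrite subSn.
  rewrite pascal lower /S mulr_sumr -sumrB -big_split/=; apply: eq_big_nat => i /andP[_ im].
  rewrite subSn// wickS ffactnSr natrM exprS subnS.
  have -> : (b - i).-1%N = (b - i.+1)%N by rewrite subnS.
  ring.
have [n] : exists n, (a < n)%N by exists a.+1.
elim: n a => // n IH [|a] an; first by rewrite S0 herm0 mul1r.
rewrite SS -IH// hermS mulrBl -mulrA; congr (_ - _).
case: a an => [|a] an; first by rewrite !mul0r.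
by rewrite -mulrA IH// ltnW.
Qed.

End hermite_values.

Section wick_expectation.
Context (R : realType) d (T : measurableType d) (P : probability T R) (m : nat).
Context (V : 'I_m -> T -> R) (c : 'I_m -> 'I_m -> R).
Hypothesis GF : gaussian_family P V c.
Hypothesis c1 : forall k, c k k = 1.

Local Notation U a b k l := (fun w => wick (c k l) a b (V k w) (V l w)).
Local Notation D := (@wder _ _ T m V c).

Lemma wder_herm k n l : D k (fun w => herm n (V l w)) (fun w => n%:R * c k l * herm n.-1 (V l w)).
Proof.
suff [] : D k (fun w => herm n (V l w)) (fun w => n%:R * c k l * herm n.-1 (V l w)) /\
  D k (fun w => herm n.+1 (V l w)) (fun w => n.+1%:R * c k l * herm n (V l w)) by [].
elim: n => [|n [IH1 IH2]]; split=> //.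
- by apply: wder_ext (wder_cst V c k 1) _ _ => w; rewrite ?herm0// !mul0r.
- apply: wder_ext (wder_var V c k l) _ _ => w; first by rewrite hermS herm0; ring.
  by rewrite herm0; ring.
- apply: wder_ext (wderD (wderM (wder_var V c k l) IH2) (wderZ (- n.+1%:R) IH1)) _ _ => w.
    by rewrite [in RHS]hermS/=; ring.
  rewrite !(hermS n) -[n.+2%:R]natr1; ring.
Qed.

(** Two consecutive values of [a] are carried through the induction, since the recurrence of [wick]
    goes two steps back. *)
Lemma wder_wick j a b k l : D j (U a b k l)
  (fun w => a%:R * c j k * U a.-1 b k l w + b%:R * c j l * U a b.-1 k l w).
Proof.
suff [] : (forall b, D j (U a b k l)
  (fun w => a%:R * c j k * U a.-1 b k l w + b%:R * c j l * U a b.-1 k l w)) /\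
  (forall b, D j (U a.+1 b k l)
  (fun w => a.+1%:R * c j k * U a b k l w + b%:R * c j l * U a.+1 b.-1 k l w)) by [].
elim: a {b} => [|a [IH1 IH2]]; split=> // b.
- apply: wder_ext (wder_herm j b l) _ _ => w //=; ring.
- apply: wder_ext (wderD (wderM (wder_var V c j k) (wder_herm j b l))
     (wderZ (- (b%:R * c k l)) (wder_herm j b.-1 l))) _ _ => w.
    by rewrite /=; ring.
  case: b => [|b] /=; ring.
- apply: wder_ext (wderD (wderD (wderM (wder_var V c j k) (IH2 b))
     (wderZ (- a.+1%:R) (IH1 b))) (wderZ (- (b%:R * c k l)) (IH2 b.-1))) _ _ => w.
    by rewrite [in RHS]wickS/=; ring.
  by rewrite -[a.+2%:R]natr1 (wickS _ a.+1 b.-1) (wickS _ a b)/=; ring.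
Qed.

(** Since [c k k = 1], the terms subtracted in [wickS] are exactly the derivative of [U a b] in the
    direction [h_k]; they cancel, and only the derivative of [f] remains. *)
Lemma wick_ibp k l a b f g : D k f g ->
  Ex P (fun w => U a.+1 b k l w * f w) = Ex P (fun w => U a b k l w * g w).
Proof.
move=> fg; have ug := wder_wick k a b k l.
have := wder_ibp GF (wderM ug fg).
have [fm gm] := wder_mom GF fg; have [um um'] := wder_mom GF ug.
have vm := gf_mom GF k.
have [u1 _] := wder_mom GF (wder_wick k a.-1 b k l).
have [u2 _] := wder_mom GF (wder_wick k a b.-1 k l).
rewrite ExD; [|intg_tac|intg_tac].
move=> H; rewrite (eq_Ex _ (g := fun w => V k w * (U a b k l w * f w)
   - (a%:R * c k k * U a.-1 b k l w + b%:R * c k l * U a b.-1 k l w) * f w)).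
  by rewrite ExB; [|intg_tac|intg_tac]; rewrite H addrAC subrr add0r.
by move=> w; rewrite wickS c1; ring.
Qed.

(** The recurrence of [wick] raises only the first exponent. The polynomial with exponents
    [(0, b.+1)] is therefore read as the one with exponents [(b.+1, 0)] for the pair [(l, l)]. *)
Lemma wick_ibp0 k l b f g : D l f g ->
  Ex P (fun w => U 0%N b.+1 k l w * f w) = Ex P (fun w => U 0%N b k l w * g w).
Proof.
move=> fg; have := @wick_ibp l l b 0 f g fg.
have E (n : nat) x : wick (c l l) n 0 x x = herm n x.
  rewrite c1; suff [] : wick 1 n 0 x x = herm n x /\ wick 1 n.+1 0 x x = herm n.+1 x by [].
  elim: n => [|n [IH1 IH2]]; first by rewrite wickS hermS !wick0 herm0; split=> //; ring.
  by split=> //; rewrite wickS hermS IH2 /= IH1; ring.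
by under eq_Ex do rewrite E; under [X in _ = X -> _]eq_Ex do rewrite E.
Qed.

(* [x ^ a'] counts, among the complete pairings of the [a + b] factors on the left
   with the [a' + b'] factors on the right, those using each kind of edge. *)
Definition pairings k l p q a b : {poly R} :=
  ((c k p)%:P * 'X + (c k q)%:P) ^+ a * ((c l p)%:P * 'X + (c l q)%:P) ^+ b.

Lemma size_linear_le (x y : R) : (size (x%:P * 'X + y%:P)%R <= 2)%N.
Proof.
rewrite (leq_trans (size_polyD _ _))// geq_max (leq_trans (size_polyC_leq1 _))// andbT.
by rewrite (leq_trans (size_polyMleq _ _))// size_polyX addn2/= ltnS size_polyC_leq1.
Qed.

Lemma size_pairings k l p q a b : (size (pairings k l p q a b) <= (a + b).+1)%N.
Proof.
have H (x y : R) n : (size ((x%:P * 'X + y%:P) ^+ n)%R <= n.+1)%N.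
  elim: n => [|n IH]; first by rewrite expr0 size_poly1.
  rewrite exprS (leq_trans (size_polyMleq _ _))//.
  by rewrite -subn1 leq_subLR add1n; exact: leq_add (size_linear_le x y) IH.
rewrite (leq_trans (size_polyMleq _ _))// -subn1 leq_subLR add1n.
by rewrite (leq_trans (leq_add (H _ _ a) (H _ _ b)))// addSn addnS.
Qed.

Lemma Ex_wick0 k l a b : Ex P (U a b k l) = ((a + b)%N == 0%N)%:R.
Proof.
have U1 a' b' : Ex P (U a' b' k l) = Ex P (fun w => U a' b' k l w * 1).
  by apply: eq_Ex => w; rewrite mulr1.
have Z (f : T -> R) : Ex P (fun w => f w * 0) = 0.
  by rewrite -[RHS](Ex_cst P 0); apply: eq_Ex => w; rewrite mulr0.
rewrite U1; case: a => [|a]; last by rewrite (wick_ibp l a b (wder_cst V c k 1)) Z.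
case: b => [|b]; last by rewrite (wick_ibp0 k b (wder_cst V c l 1)) Z.
by rewrite -[RHS](Ex_cst P 1); apply: eq_Ex => w; rewrite wick0 herm0 mulr1.
Qed.

(** Each integration by parts removes one left factor and pairs it with a factor [V p] or [V q] on
    the right; unequal numbers of factors leave one unpaired, and the expectation vanishes. *)
Lemma Ex_wick k l p q a b a' b' : Ex P (fun w => U a b k l w * U a' b' p q w) =
  if (a + b == a' + b')%N then (a'`! * b'`!)%:R * (pairings k l p q a b)`_a' else 0.
Proof.
(* The recursion for the coefficients of [pairings]. When [n2 = 0], the size bound kills the
   coefficient that lies beyond the last one. *)
have step (x y A B e : R) (Q : {poly R}) n n1 n2 : (size Q <= n.+1)%N ->
  A = (if (n == n1.-1 + n2)%N then (n1.-1`! * n2`!)%:R * Q`_n1.-1 else 0) ->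
  B = (if (n == n1 + n2.-1)%N then (n1`! * n2.-1`!)%:R * Q`_n1 else 0) ->
  n1%:R * x * A + n2%:R * y * B =
  if (n.+1 == n1 + n2)%N then (n1`! * n2`!)%:R * ((x%:P * 'X + y%:P) * Q)`_n1 else 0.
  move=> sQ -> ->.
  have -> : ((x%:P * 'X + y%:P) * Q)`_n1 = x * ('X * Q)`_n1 + y * Q`_n1.
    by rewrite mulrDl -mulrA coefD !coefCM.
  rewrite coefXM.
  case: n1 => [|n1] /=.
    rewrite !mul0r mulr0 !add0r !add0n; case: n2 => [|n2] /=; first by rewrite !mul0r.
    by rewrite eqSS; case: eqP => _; rewrite ?mulr0// !fact0 !mul1n factS natrM; ring.
  rewrite !addSn eqSS; case: n2 => [|n2] /=.
    rewrite !mul0r addr0 addn0; case: eqP => nn; last by rewrite mulr0.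
    by rewrite -nn [Q`_n.+1]nth_default// mulr0 addr0 factS !natrM; ring.
  rewrite addnS; case: eqP => _; last by rewrite !mulr0 addr0.
  by rewrite !factS !natrM; ring.
elim: a a' b' => [|a IH] a' b'.
  elim: b a' b' => [|b IH] a' b'.
    under eq_Ex do rewrite wick0 herm0 mul1r.
    rewrite Ex_wick0 /pairings !expr0 mulr1 coef1 addn0 eq_sym.
    by case: a' => [|a']; case: b' => [|b'] //=; rewrite ?fact0 ?mul1r ?muln1//.
  rewrite (wick_ibp0 k b (wder_wick l a' b' p q)).
  have um1 := (wder_mom GF (wder_wick k 0 b k l)).1.
  have um2 := (wder_mom GF (wder_wick k a'.-1 b' p q)).1.
  have um3 := (wder_mom GF (wder_wick k a' b'.-1 p q)).1.
  rewrite (eq_Ex _ (g := fun w => a'%:R * c l p * (U 0%N b k l w * U a'.-1 b' p q w) +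
     b'%:R * c l q * (U 0%N b k l w * U a' b'.-1 p q w))); last by move=> w; ring.
  rewrite ExD; [|intg_tac|intg_tac]; rewrite ExZ; last intg_tac; rewrite ExZ; last intg_tac.
  rewrite (step _ _ _ _ 0 _ _ _ _ (size_pairings k l p q 0 b) (IH _ _) (IH _ _)) add0n add0n.
  by rewrite /pairings !expr0 !mul1r exprS.
rewrite (wick_ibp l a b (wder_wick k a' b' p q)).
have um1 := (wder_mom GF (wder_wick k a b k l)).1.
have um2 := (wder_mom GF (wder_wick k a'.-1 b' p q)).1.
have um3 := (wder_mom GF (wder_wick k a' b'.-1 p q)).1.
rewrite (eq_Ex _ (g := fun w => a'%:R * c k p * (U a b k l w * U a'.-1 b' p q w) +
   b'%:R * c k q * (U a b k l w * U a' b'.-1 p q w))); last by move=> w; ring.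
rewrite ExD; [|intg_tac|intg_tac]; rewrite ExZ; last intg_tac; rewrite ExZ; last intg_tac.
rewrite (step _ _ _ _ 0 _ _ _ _ (size_pairings k l p q a b) (IH _ _) (IH _ _)) addSn.
by rewrite /pairings exprS mulrA.
Qed.

(** [j] of the factors [V k] are paired with [V p] and the other [n - j] with [V q]; this fixes how
    many edges join [V l] to each of them. *)
Definition cross (n : nat) k l p q : R :=
  (n`! ^ 2)%:R * \sum_(j < n.+1) ('C(n, j) ^ 2)%:R *
    (c k p * c l q) ^+ j * (c k q * c l p) ^+ (n - j).

Lemma Ex_wick_diag k l p q n n' :
  Ex P (fun w => U n n k l w * U n' n' p q w) = (n == n')%:R * cross n k l p q.
Proof.
rewrite Ex_wick (_ : (n + n == n' + n')%N = (n == n')); last first.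
  by rewrite !addnn (inj_eq double_inj).
case: eqP => [<-|_]; last by rewrite mul0r.
rewrite mul1r /cross mulnn; congr (_ * _).
have lin (x y : R) j : ((x%:P * 'X + y%:P) ^+ n)`_j =
    if (j <= n)%N then 'C(n, j)%:R * x ^+ j * y ^+ (n - j) else 0.
  rewrite addrC exprDn coef_sum.
  under eq_bigr do rewrite exprMn -!polyC_exp -mulrnAl -polyCMn mulrA -polyCM coefCM coefXn.
  case: leqP => jn.
    rewrite (bigD1 (Ordinal (jn : (j < n.+1)%N)))//= eqxx mulr1 big1 ?addr0.
      by rewrite -mulr_natl; ring.
    by move=> i; rewrite -val_eqE/= eq_sym => /negbTE ->; rewrite mulr0.
  apply: big1 => i _; rewrite (_ : (j == i) = false) ?mulr0//.
  by apply/negbTE; rewrite neq_ltn (leq_trans _ jn) ?orbT.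
rewrite /pairings coefM; apply: eq_bigr => j _.
rewrite !lin leq_ord leq_subr subKn ?leq_ord// bin_sub ?leq_ord//.
by rewrite natrX !exprMn; ring.
Qed.

(** The number [i! 'C(n, i)^2] of ways to contract [i] pairs between two groups of [n] factors. *)
Definition diagram (n : nat) i : R := ('C(n, i) * n ^_ i)%:R.

(** Components with different numbers of contractions are orthogonal, so both products contract the
    same number [i] of pairs. *)
Lemma Ex_herm4 n k l p q :
  Ex P (fun w => herm n (V k w) * herm n (V l w) * (herm n (V p w) * herm n (V q w))) =
  \sum_(i < n.+1) diagram n i ^+ 2 * (c k l * c p q) ^+ i * cross (n - i) k l p q.
Proof.
pose F k l i w := diagram n i * c k l ^+ i * U (n - i)%N (n - i)%N k l w.
have FE k' l' w : herm n (V k' w) * herm n (V l' w) = \sum_(i < n.+1) F k' l' i w.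
  by rewrite (herm_mul_wick (c k' l')); apply: eq_bigr => i _; rewrite /F /diagram natrM.
have Fm k' l' i : mom P (F k' l' i).
  by have um := (wder_mom GF (wder_wick k (n - i) (n - i) k' l')).1; rewrite /F; mom_tac.
rewrite (eq_Ex _ (g := fun w => \sum_(i < n.+1) \sum_(j < n.+1) F k l i w * F p q j w)); last first.
  by move=> w; rewrite !FE mulr_suml; apply: eq_bigr => i _; rewrite mulr_sumr.
rewrite Ex_sum; last by move=> i; apply: mom_intg; apply: mom_sum => j; exact: momM.
apply: eq_bigr => i _.
rewrite Ex_sum; last by move=> j; apply: mom_intg; exact: momM.
have FF j : Ex P (fun w => F k l i w * F p q j w) = diagram n i * c k l ^+ i *
    (diagram n j * c p q ^+ j) * ((n - i == n - j)%N%:R * cross (n - i) k l p q).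
  rewrite -Ex_wick_diag -ExZ.
    by apply: eq_Ex => w; rewrite /F; ring.
  have um := (wder_mom GF (wder_wick k (n - i) (n - i) k l)).1.
  by have um' := (wder_mom GF (wder_wick k (n - j) (n - j) p q)).1; intg_tac.
rewrite (bigD1 i)//= FF eqxx big1 ?addr0; first by rewrite mul1r exprMn; ring.
move=> j ji; rewrite FF (_ : (n - i == n - j)%N = false) ?mul0r ?mulr0//.
apply/negbTE; apply: contra ji; rewrite -val_eqE/= => /eqP nij.
by rewrite -(subKn (leq_ord j)) -nij subKn// leq_ord.
Qed.

Lemma Ex_herm2 n k l : Ex P (fun w => herm n (V k w) * herm n (V l w)) = n`!%:R * c k l ^+ n.
Proof.
have um i : mom P (U (n - i)%N (n - i)%N k l).
  by have := (wder_mom GF (wder_wick k (n - i) (n - i) k l)).1.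
rewrite (eq_Ex _ (g := fun w => \sum_(i < n.+1) diagram n i * c k l ^+ i * U (n - i)%N (n - i)%N k l w)).
  rewrite Ex_sum; last by move=> i; apply: mom_intg; have ? := um i; mom_tac.
  rewrite big_ord_recr/= big1 => [|i _].
    rewrite add0r ExZ; last by apply: mom_intg; exact: um.
    by rewrite Ex_wick0 subnn mulr1 /diagram binn ffactnn mul1n.
  rewrite ExZ; last by apply: mom_intg; exact: um.
  rewrite Ex_wick0 addn_eq0 subn_eq0 andbb leqNgt ltn_ord /= mulr0//.
by move=> w; rewrite (herm_mul_wick (c k l)); apply: eq_bigr => i _; rewrite /diagram natrM.
Qed.

End wick_expectation.

(** * Chaoses and their fourth cumulants *)

Section psd_kernels.
Context (R : realType) (J : Type).
Implicit Types (K : J -> J -> R) (s t : seq (R * J)).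

(** Weighted points are kept in lists, which leaves the index type [J] arbitrary and allows
    repetitions. *)
Definition form K s t := \sum_(x <- s) \sum_(y <- t) x.1 * y.1 * K x.2 y.2.

Definition psd K := forall s, 0 <= form K s s.

Lemma form_cat K s1 s2 t1 t2 : form K (s1 ++ s2) (t1 ++ t2) =
  form K s1 t1 + form K s1 t2 + form K s2 t1 + form K s2 t2.
Proof.
rewrite /form big_cat/=; under eq_bigr do rewrite big_cat/=.
rewrite big_split/= -!addrA; congr (_ + (_ + _)).
by under eq_bigr do rewrite big_cat/=; rewrite big_split.
Qed.

Lemma form_scale K a b s t :
  form K [seq (a * x.1, x.2) | x <- s] [seq (b * x.1, x.2) | x <- t] = a * b * form K s t.
Proof.
rewrite /form big_map mulr_sumr; apply: eq_bigr => x _.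
rewrite big_map mulr_sumr; apply: eq_bigr => y _ /=; ring.
Qed.

Lemma form_sym K s t : (forall i j, K i j = K j i) -> form K s t = form K t s.
Proof.
move=> Ks; rewrite /form exchange_big/=; apply: eq_bigr => x _; apply: eq_bigr => y _.
by rewrite Ks (mulrC x.1).
Qed.

Lemma psd_cauchy K s t : (forall i j, K i j = K j i) -> psd K ->
  form K s t ^+ 2 <= form K s s * form K t t.
Proof.
move=> Ks Kp; apply: quad_form_cauchy => u v.
have := Kp ([seq (u * x.1, x.2) | x <- s] ++ [seq (v * x.1, x.2) | x <- t]).
rewrite form_cat !form_scale (form_sym t s Ks).
by congr (0 <= _); ring.
Qed.

Lemma psd1 : psd (fun _ _ => 1).
Proof.
move=> s; rewrite (_ : form _ s s = (\sum_(x <- s) x.1) ^+ 2) ?sqr_ge0//.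
rewrite expr2 mulr_suml; apply: eq_bigr => x _; rewrite mulr_sumr.
by apply: eq_bigr => y _; rewrite mulr1.
Qed.

(** Schur's product theorem for a covariance: at each [w], the form of [K] is taken with the random
    weights [x Z(w)]. *)
Lemma psd_mul_cov d (T : measurableType d) (P : probability T R) K (Z : J -> T -> R) :
  (forall j, mom P (Z j)) -> psd K -> psd (fun i j => K i j * Ex P (fun w => Z i w * Z j w)).
Proof.
move=> Zm Kp s.
have -> : form (fun i j => K i j * Ex P (fun w => Z i w * Z j w)) s s =
    Ex P (fun w => form K [seq (x.1 * Z x.2 w, x.2) | x <- s] [seq (x.1 * Z x.2 w, x.2) | x <- s]).
  rewrite /form; under [X in _ = Ex P X]eq_fun do rewrite big_map.
  rewrite Ex_sum; last first.
    move=> x; apply: mom_intg; under eq_fun do rewrite big_map.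
    by apply: mom_sum => y /=; have ? := Zm x.2; have ? := Zm y.2; mom_tac.
  apply: eq_bigr => x _; under [X in _ = Ex P X]eq_fun do rewrite big_map.
  rewrite Ex_sum; last first.
    by move=> y; apply: mom_intg => /=; have ? := Zm x.2; have ? := Zm y.2; mom_tac.
  apply: eq_bigr => y _; rewrite /= mulrA -ExZ; last first.
    by apply: mom_intg; have ? := Zm x.2; have ? := Zm y.2; mom_tac.
  by apply: eq_Ex => w; ring.
by apply: Ex_ge0 => w; exact: Kp.
Qed.

End psd_kernels.

Section chaos.
Context (R : realType) d (T : measurableType d) (P : probability T R) (m : nat).
Context (V : 'I_m -> T -> R) (c : 'I_m -> 'I_m -> R).
Hypothesis GF : gaussian_family P V c.
Hypothesis c1 : forall k, c k k = 1.
Implicit Types a b : 'I_m -> R.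

Let cs k l : c k l = c l k. Proof. exact: gf_sym GF k l. Qed.
Let Vm k : mom P (V k). Proof. exact: gf_mom GF k. Qed.

Lemma gf_cov k l : Ex P (fun w => V k w * V l w) = c k l.
Proof. by rewrite (wder_ibp GF (wder_var V c k l)) Ex_cst. Qed.

Lemma psd_cov (J : Type) (K : J -> J -> R) (f : J -> 'I_m) n :
  psd K -> psd (fun i j => K i j * c (f i) (f j) ^+ n).
Proof.
move=> Kp; elim: n => [|n IH].
  by under eq_fun do (under eq_fun do rewrite expr0 mulr1).
have := psd_mul_cov (P := P) (Z := fun j => V (f j)) (fun j => Vm (f j)) IH.
congr psd; apply/funext => i; apply/funext => j.
by rewrite gf_cov -mulrA -exprSr.
Qed.

Definition chaos p a w : R := \sum_k a k * herm p (V k w).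

(* The carre du champ [<DF, DG>] of [F = chaos p a] and [G = chaos p b]. *)
Definition carre p a b w : R :=
  p%:R * (\sum_k \sum_l a k * b l * c k l * (herm p.-1 (V k w) * herm p.-1 (V l w))).

(* The four-index sum [sum a_k b_l a_q b_r (c_kl c_qr)^s (c_kq c_lr)^i (c_kr c_lq)^j]. *)
Definition dsum a b s i j : R := \sum_(x : 'I_m * 'I_m) \sum_(y : 'I_m * 'I_m)
  (a x.1 * b x.2 * c x.1 x.2 ^+ s) * (a y.1 * b y.2 * c y.1 y.2 ^+ s) *
  ((c x.1 y.1 * c x.2 y.2) ^+ i * (c x.1 y.2 * c x.2 y.1) ^+ j).

Let enumS (u : 'I_m * 'I_m -> R) (J : Type) (f : 'I_m * 'I_m -> J) :=
  [seq (u x, f x) | x <- enum {: 'I_m * 'I_m}].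

Let form_enum (J : Type) (K : J -> J -> R) u v (f g : 'I_m * 'I_m -> J) :
  form K (enumS u f) (enumS v g) = \sum_x \sum_y u x * v y * K (f x) (g y).
Proof.
rewrite /form /enumS big_map big_enum/=; apply: eq_bigr => x _.
by rewrite big_map big_enum.
Qed.

Lemma dsum_ge0 a b s n : 0 <= dsum a b s n 0.
Proof.
pose K (x y : 'I_m * 'I_m) := 1 * c x.1 y.1 ^+ n * c x.2 y.2 ^+ n.
have Kp : psd K by apply: (psd_cov snd); apply: (psd_cov fst); exact: psd1.
have := Kp (enumS (fun x => a x.1 * b x.2 * c x.1 x.2 ^+ s) id).
rewrite form_enum; congr (_ <= _); apply: eq_bigr => x _; apply: eq_bigr => y _.
by rewrite /K expr0 mulr1 mul1r exprMn.
Qed.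

(** Index pairs are embedded into quadruples in two ways, [(x1, x1, x2, x2)] and [(x1, x2, x2, x1)].
    The mixed sum is the [K]-product of the two images, and each image has squared norm
    [dsum a b s (i + j) 0]. *)
Lemma norm_dsum_le a b s i j : `|dsum a b s i j| <= dsum a b s (i + j) 0.
Proof.
pose K (x y : 'I_m * 'I_m * 'I_m * 'I_m) :=
  1 * c x.1.1.1 y.1.1.1 ^+ i * c x.1.1.2 y.1.1.2 ^+ j * c x.1.2 y.1.2 ^+ i * c x.2 y.2 ^+ j.
have Kp : psd K.
  apply: (psd_cov snd); apply: (psd_cov (fun x => x.1.2)); apply: (psd_cov (fun x => x.1.1.2)).
  by apply: (psd_cov (fun x => x.1.1.1)); exact: psd1.
have Ks x y : K x y = K y x by rewrite /K cs [c x.1.1.2 _]cs [c x.1.2 _]cs [c x.2 _]cs.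
pose X (x : 'I_m * 'I_m) := a x.1 * b x.2 * c x.1 x.2 ^+ s.
have := psd_cauchy (enumS X (fun x => (x.1, x.1, x.2, x.2)))
  (enumS X (fun x => (x.1, x.2, x.2, x.1))) Ks Kp.
rewrite !form_enum.
have -> : \sum_x \sum_y X x * X y * K (x.1, x.1, x.2, x.2) (y.1, y.2, y.2, y.1) = dsum a b s i j.
  apply: eq_bigr => x _; apply: eq_bigr => y _; rewrite /K /X/= !exprMn; ring.
have -> : \sum_x \sum_y X x * X y * K (x.1, x.1, x.2, x.2) (y.1, y.1, y.2, y.2) = dsum a b s (i + j) 0.
  by apply: eq_bigr => x _; apply: eq_bigr => y _; rewrite /K /X/= !exprMn !exprD expr0; ring.
have -> : \sum_x \sum_y X x * X y * K (x.1, x.2, x.2, x.1) (y.1, y.2, y.2, y.1) = dsum a b s (i + j) 0.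
  by apply: eq_bigr => x _; apply: eq_bigr => y _; rewrite /K /X/= !exprMn !exprD expr0; ring.
rewrite -expr2 -[_ ^+ 2 in X in X -> _]real_normK ?num_real//.
by rewrite ler_pXn2r// nnegrE dsum_ge0.
Qed.

Let sum4 (F : 'I_m -> 'I_m -> 'I_m -> 'I_m -> R) :
  \sum_(x : 'I_m * 'I_m) \sum_(y : 'I_m * 'I_m) F x.1 x.2 y.1 y.2 =
  \sum_k \sum_l \sum_q \sum_r F k l q r.
Proof.
rewrite -(pair_bigA _ (fun k l => \sum_(y : 'I_m * 'I_m) F k l y.1 y.2))/=.
apply: eq_bigr => k _; apply: eq_bigr => l _.
by rewrite -(pair_bigA _ (fun q r => F k l q r)).
Qed.

(** Grouping the indices as [(k, q)] and [(l, r)] instead of [(k, l)] and [(q, r)] separates the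
    coefficients [a] from [b]. This is where the cumulants of [F] and [G] come apart. *)
Lemma dsum_cauchy a b s n : dsum a b s n 0 ^+ 2 <= dsum a a n s 0 * dsum b b n s 0.
Proof.
pose K (x y : 'I_m * 'I_m) := 1 * c x.1 y.1 ^+ s * c x.2 y.2 ^+ s.
have Kp : psd K by apply: (psd_cov snd); apply: (psd_cov fst); exact: psd1.
have Ks x y : K x y = K y x by rewrite /K cs [c x.2 _]cs.
pose X a (x : 'I_m * 'I_m) := a x.1 * a x.2 * c x.1 x.2 ^+ n.
have := psd_cauchy (enumS (X a) id) (enumS (X b) id) Ks Kp.
have XX e : \sum_x \sum_y X e x * X e y * K x y = dsum e e n s 0.
  by apply: eq_bigr => x _; apply: eq_bigr => y _; rewrite /K /X expr0 exprMn; ring.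
rewrite !form_enum !XX; congr (_ ^+ 2 <= _).
rewrite (sum4 (fun k q l r => X a (k, q) * X b (l, r) * K (k, q) (l, r))).
rewrite /dsum (sum4 (fun k l q r => a k * b l * c k l ^+ s * (a q * b r * c q r ^+ s) *
   ((c k q * c l r) ^+ n * (c k r * c l q) ^+ 0))).
apply: eq_bigr => k _; rewrite exchange_big/=; apply: eq_bigr => l _; apply: eq_bigr => q _.
by apply: eq_bigr => r _; rewrite /X /K/= expr0 exprMn; ring.
Qed.

(** The indices joined by the [i]-fold edges are taken as the new pairs [x] and [y]. *)
Lemma dsum_rot a i j : dsum a a 0 i j = dsum a a i j 0.
Proof.
rewrite /dsum (sum4 (fun k l q r => a k * a l * c k l ^+ 0 * (a q * a r * c q r ^+ 0) *
   ((c k q * c l r) ^+ i * (c k r * c l q) ^+ j))).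
rewrite (sum4 (fun k l q r => a k * a l * c k l ^+ i * (a q * a r * c q r ^+ i) *
   ((c k q * c l r) ^+ j * (c k r * c l q) ^+ 0))).
apply: eq_bigr => k _; rewrite exchange_big/=; apply: eq_bigr => q _.
rewrite exchange_big/=; apply: eq_bigr => r _; apply: eq_bigr => l _.
by rewrite !expr0 !exprMn [c r l]cs [c q l]cs; ring.
Qed.

Let Hm n k : mom P (fun w => herm n (V k w)).
Proof. by have [] := wder_mom GF (wder_herm V c k n k). Qed.

Lemma mom_chaos p a : mom P (chaos p a).
Proof. by apply: mom_sum => k; have ? := Hm p k; mom_tac. Qed.

Lemma mom_carre p a b : mom P (carre p a b).
Proof.
apply: momM; first exact: mom_cst.
apply: mom_sum => k; apply: mom_sum => l.
by have ? := Hm p.-1 k; have ? := Hm p.-1 l; mom_tac.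
Qed.

Lemma Ex_chaos2 p a b : Ex P (fun w => chaos p a w * chaos p b w) =
  p`!%:R * (\sum_k \sum_l a k * b l * c k l ^+ p).
Proof.
rewrite (eq_Ex _ (g := fun w => \sum_k \sum_l a k * b l * (herm p (V k w) * herm p (V l w)))).
  rewrite Ex_sum => [|k]; last first.
    by apply: mom_intg; apply: mom_sum => l; have ? := Hm p k; have ? := Hm p l; mom_tac.
  rewrite mulr_sumr; apply: eq_bigr => k _; rewrite Ex_sum => [|l]; last first.
    by have ? := Hm p k; have ? := Hm p l; intg_tac.
  rewrite mulr_sumr; apply: eq_bigr => l _; rewrite ExZ; last first.
    by have ? := Hm p k; have ? := Hm p l; intg_tac.
  by rewrite (Ex_herm2 GF c1); ring.
move=> w; rewrite /chaos mulr_suml; apply: eq_bigr => k _.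
by rewrite mulr_sumr; apply: eq_bigr => l _; ring.
Qed.

Lemma Ex_carre p a b : (0 < p)%N ->
  Ex P (carre p a b) = Ex P (fun w => chaos p a w * chaos p b w).
Proof.
case: p => // p _; rewrite Ex_chaos2 /carre ExZ; last first.
  apply: mom_intg; apply: mom_sum => k; apply: mom_sum => l.
  by have ? := Hm p k; have ? := Hm p l; mom_tac.
rewrite Ex_sum => [|k]; last first.
  by apply: mom_intg; apply: mom_sum => l; have ? := Hm p k; have ? := Hm p l; mom_tac.
rewrite !mulr_sumr; apply: eq_bigr => k _; rewrite Ex_sum => [|l]; last first.
  by have ? := Hm p k; have ? := Hm p l; intg_tac.
rewrite !mulr_sumr; apply: eq_bigr => l _; rewrite ExZ; last first.
  by have ? := Hm p k; have ? := Hm p l; intg_tac.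
by rewrite (Ex_herm2 GF c1) factS natrM exprS; ring.
Qed.

Let Ex_herm_form n (u : 'I_m * 'I_m -> R) :
  Ex P (fun w => (\sum_(x : 'I_m * 'I_m) u x * (herm n (V x.1 w) * herm n (V x.2 w))) ^+ 2) =
  \sum_(i < n.+1) diagram R n i ^+ 2 * ((n - i)`! ^ 2)%:R * \sum_(j < (n - i).+1) ('C(n - i, j) ^ 2)%:R *
    (\sum_(x : 'I_m * 'I_m) \sum_(y : 'I_m * 'I_m) u x * u y * (c x.1 x.2 * c y.1 y.2) ^+ i *
      ((c x.1 y.1 * c x.2 y.2) ^+ j * (c x.1 y.2 * c x.2 y.1) ^+ (n - i - j))).
Proof.
pose F (x y : 'I_m * 'I_m) w :=
  herm n (V x.1 w) * herm n (V x.2 w) * (herm n (V y.1 w) * herm n (V y.2 w)).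
have Fm x y : mom P (F x y).
  by have ? := Hm n x.1; have ? := Hm n x.2; have ? := Hm n y.1; have ? := Hm n y.2; rewrite /F; mom_tac.
rewrite (eq_Ex _ (g := fun w => \sum_(x : 'I_m * 'I_m) \sum_(y : 'I_m * 'I_m) u x * u y * F x y w)); last first.
  move=> w; rewrite expr2 mulr_suml; apply: eq_bigr => x _; rewrite mulr_sumr.
  by apply: eq_bigr => y _; rewrite /F; ring.
rewrite Ex_sum => [|x]; last first.
  by apply: mom_intg; apply: mom_sum => y; have ? := Fm x y; mom_tac.
transitivity (\sum_(x : 'I_m * 'I_m) \sum_(y : 'I_m * 'I_m) u x * u y *
   (\sum_(i < n.+1) diagram R n i ^+ 2 * (c x.1 x.2 * c y.1 y.2) ^+ i * cross c (n - i) x.1 x.2 y.1 y.2)).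
  apply: eq_bigr => x _; rewrite Ex_sum => [|y]; last by have ? := Fm x y; intg_tac.
  apply: eq_bigr => y _; rewrite ExZ; last by have ? := Fm x y; intg_tac.
  by rewrite (Ex_herm4 GF c1).
under eq_bigr do (under eq_bigr do rewrite mulr_sumr; rewrite exchange_big/=).
rewrite exchange_big/=; apply: eq_bigr => i _.
rewrite /cross; under eq_bigr do (under eq_bigr do rewrite !mulr_sumr; rewrite exchange_big/=).
rewrite exchange_big/= mulr_sumr; apply: eq_bigr => j _.
rewrite !mulr_sumr; apply: eq_bigr => x _; rewrite !mulr_sumr; apply: eq_bigr => y _.
by ring.
Qed.

(** Times [(n - i)!^2], this is the second moment of the sum of [u_x c_x^i W_x], which is
    proportional to the component left after [i] contractions. *)
Let herm_form_ge0 n (u : 'I_m * 'I_m -> R) i : (i <= n)%N ->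
  0 <= \sum_(j < (n - i).+1) ('C(n - i, j) ^ 2)%:R *
    (\sum_(x : 'I_m * 'I_m) \sum_(y : 'I_m * 'I_m) u x * u y * (c x.1 x.2 * c y.1 y.2) ^+ i *
      ((c x.1 y.1 * c x.2 y.2) ^+ j * (c x.1 y.2 * c x.2 y.1) ^+ (n - i - j))).
Proof.
move=> im; pose W (x : 'I_m * 'I_m) w := wick (c x.1 x.2) (n - i) (n - i) (V x.1 w) (V x.2 w).
have Wm x : mom P (W x) by have [] := wder_mom GF (wder_wick V c x.1 (n - i) (n - i) x.1 x.2).
have := Ex_ge0 P (f := fun w => (\sum_(x : 'I_m * 'I_m) u x * c x.1 x.2 ^+ i * W x w) ^+ 2) (fun w => sqr_ge0 _).
rewrite (eq_Ex _ (g := fun w => \sum_(x : 'I_m * 'I_m) \sum_(y : 'I_m * 'I_m)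
   (u x * u y * (c x.1 x.2 * c y.1 y.2) ^+ i) * (W x w * W y w))); last first.
  move=> w; rewrite expr2 mulr_suml; apply: eq_bigr => x _; rewrite mulr_sumr.
  by apply: eq_bigr => y _; rewrite exprMn; ring.
rewrite Ex_sum => [|x]; last first.
  by apply: mom_intg; apply: mom_sum => y; have ? := Wm x; have ? := Wm y; mom_tac.
rewrite (eq_bigr (fun x => \sum_(y : 'I_m * 'I_m) (u x * u y * (c x.1 x.2 * c y.1 y.2) ^+ i) *
    cross c (n - i) x.1 x.2 y.1 y.2)) => [|x _]; last first.
  rewrite Ex_sum => [|y]; last by have ? := Wm x; have ? := Wm y; intg_tac.
  apply: eq_bigr => y _; rewrite ExZ; last by have ? := Wm x; have ? := Wm y; intg_tac.
  by rewrite (Ex_wick_diag GF c1) eqxx mul1r.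
rewrite /cross; under eq_bigr do (under eq_bigr do rewrite !mulr_sumr; rewrite exchange_big/=).
rewrite exchange_big/=.
have f0 : 0 < ((n - i)`! ^ 2)%:R :> R by rewrite ltr0n expn_gt0 fact_gt0.
move=> H; rewrite -(pmulr_rge0 _ f0); move: H; congr (0 <= _); rewrite mulr_sumr; apply: eq_bigr => j _.
rewrite !mulr_sumr; apply: eq_bigr => x _; rewrite !mulr_sumr; apply: eq_bigr => y _.
by ring.
Qed.

Lemma chaosM p a b w : chaos p a w * chaos p b w =
  \sum_(x : 'I_m * 'I_m) (a x.1 * b x.2) * (herm p (V x.1 w) * herm p (V x.2 w)).
Proof.
rewrite /chaos mulr_suml.
rewrite -(pair_bigA _ (fun k l => (a k * b l) * (herm p (V k w) * herm p (V l w))))/=.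
by apply: eq_bigr => k _; rewrite mulr_sumr; apply: eq_bigr => l _; ring.
Qed.

Let dsumE n s a b i j : \sum_(x : 'I_m * 'I_m) \sum_(y : 'I_m * 'I_m)
    (a x.1 * b x.2 * c x.1 x.2 ^+ s) * (a y.1 * b y.2 * c y.1 y.2 ^+ s) * (c x.1 x.2 * c y.1 y.2) ^+ n *
      ((c x.1 y.1 * c x.2 y.2) ^+ i * (c x.1 y.2 * c x.2 y.1) ^+ j) = dsum a b (s + n) i j.
Proof.
apply: eq_bigr => x _; apply: eq_bigr => y _.
by rewrite [(c x.1 x.2 * _) ^+ n]exprMn !exprD; ring.
Qed.

(** With all [p] edges inside the two pairs, the four-index sum factors. *)
Let dsum_top p a b : p`!%:R ^+ 2 * dsum a b p 0 0 = Ex P (fun w => chaos p a w * chaos p b w) ^+ 2.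
Proof.
rewrite Ex_chaos2 exprMn; congr (_ * _).
rewrite (pair_bigA _ (fun k l => a k * b l * c k l ^+ p))/= expr2 mulr_suml.
apply: eq_bigr => x _; rewrite mulr_sumr; apply: eq_bigr => y _.
by rewrite !expr0 !mulr1.
Qed.

Definition kurtosis p a : R :=
  Ex P (fun w => chaos p a w ^+ 4) - 3 * Ex P (fun w => chaos p a w ^+ 2) ^+ 2.

(** In the diagram expansion of [E F^4] three terms equal [(E F^2)^2]: two without contraction
    inside the pairs and one with full contraction. They cancel the [3 (E F^2)^2]. What remains is a
    sum of nonnegative blocks, and the stated [dsum] occurs in it, with a coefficient at least [1],
    among the terms without inner contraction. *)
Lemma dsum_le_kurtosis p a i : (0 < i < p)%N -> dsum a a i (p - i) 0 <= kurtosis p a.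
Proof.
case: p => [|p]; first by rewrite ltn0 andbF.
move=> /andP[i0 ip].
have H : Ex P (fun w => chaos p.+1 a w ^+ 4) =
    \sum_(j < p.+2) diagram R p.+1 j ^+ 2 * ((p.+1 - j)`! ^ 2)%:R *
    \sum_(q < (p.+1 - j).+1) ('C(p.+1 - j, q) ^ 2)%:R * dsum a a j q (p.+1 - j - q).
  rewrite (eq_Ex _ (g := fun w => (\sum_(x : 'I_m * 'I_m) (a x.1 * a x.2) *
     (herm p.+1 (V x.1 w) * herm p.+1 (V x.2 w))) ^+ 2)); last first.
    by move=> w; rewrite -chaosM; ring.
  rewrite Ex_herm_form; apply: eq_bigr => j _; congr (_ * _); apply: eq_bigr => q _; congr (_ * _).
  rewrite -[X in dsum _ _ X](add0n j) -dsumE.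
  by apply: eq_bigr => x _; apply: eq_bigr => y _; rewrite !expr0 !mulr1.
have top : p.+1`!%:R ^+ 2 * dsum a a p.+1 0 0 = Ex P (fun w => chaos p.+1 a w ^+ 2) ^+ 2.
  by rewrite dsum_top; congr (_ ^+ 2); apply: eq_Ex => w; rewrite expr2.
set S := Ex P (fun w => chaos p.+1 a w ^+ 2) ^+ 2 in top *.
have split3 (F : nat -> R) : \sum_(j < p.+2) F j = F 0%N + F p.+1 + \sum_(j < p) F j.+1.
  by rewrite big_ord_recr/= big_ord_recl/= addrAC.
pose G q := ('C(p.+1, q) ^ 2)%:R * dsum a a 0 q (p.+1 - q).
pose F j := diagram R p.+1 j ^+ 2 * ((p.+1 - j)`! ^ 2)%:R *
    \sum_(q < (p.+1 - j).+1) ('C(p.+1 - j, q) ^ 2)%:R * dsum a a j q (p.+1 - j - q).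
(* The extreme values [q = 0] and [q = p + 1] each contribute [S]. *)
have F0 : F 0%N = 2 * S + p.+1`!%:R ^+ 2 * \sum_(q < p) G q.+1.
  rewrite /F /diagram bin0 ffactn0 mul1n expr1n mul1r subn0 natrX.
  rewrite (split3 G) mulrDr; congr (_ + _).
  rewrite /G bin0 binn exp1n !mul1r subn0 subnn mulrDr.
  rewrite (_ : dsum a a 0 p.+1 0 = dsum a a p.+1 0 0); last by rewrite dsum_rot.
  have -> : dsum a a 0 0 p.+1 = dsum a a p.+1 0 0.
    rewrite dsum_rot /dsum (sum4 (fun k l q r => a k * a l * c k l ^+ 0 * (a q * a r * c q r ^+ 0) *
      ((c k q * c l r) ^+ p.+1 * (c k r * c l q) ^+ 0))).
    rewrite (sum4 (fun k l q r => a k * a l * c k l ^+ p.+1 * (a q * a r * c q r ^+ p.+1) *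
      ((c k q * c l r) ^+ 0 * (c k r * c l q) ^+ 0))).
    apply: eq_bigr => k _; rewrite exchange_big/=; apply: eq_bigr => q _.
    by apply: eq_bigr => r _; apply: eq_bigr => l _; rewrite !expr0 !exprMn; ring.
  by rewrite top; ring.
have Fp : F p.+1 = S.
  rewrite /F /diagram subnn binn ffactnn mul1n fact0 exp1n mulr1 big_ord_recl big_ord0 addr0.
  by rewrite bin0 exp1n mul1r subn0 top.
have Gge q : 0 <= G q by rewrite /G mulr_ge0// dsum_rot dsum_ge0.
have Fge (j : 'I_p) : 0 <= F j.+1.
  rewrite /F mulr_ge0 ?mulr_ge0 ?sqr_ge0//.
  have := herm_form_ge0 (fun x => a x.1 * a x.2) (i := j.+1) (n := p.+1) (leqW (ltn_ord j)).
  congr (0 <= _); apply: eq_bigr => q _; congr (_ * _); rewrite -[X in dsum _ _ X](add0n j.+1) -dsumE.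
  by apply: eq_bigr => x _; apply: eq_bigr => y _; rewrite !expr0 !mulr1.
rewrite /kurtosis -/S H (split3 F) F0 Fp.
rewrite (_ : _ - _ = p.+1`!%:R ^+ 2 * \sum_(q < p) G q.+1 + \sum_(j < p) F j.+1); last by ring.
have Fs : 0 <= \sum_(j < p) F j.+1 by apply: sumr_ge0.
case: i i0 ip => // i _ ip; rewrite ltnS in ip.
have GG : G i.+1 <= \sum_(q < p) G q.+1.
  by rewrite (bigD1 (Ordinal ip))//= lerDl sumr_ge0.
rewrite -dsum_rot (@le_trans _ _ (G i.+1))//.
  by rewrite /G ler_peMl ?dsum_rot ?dsum_ge0// ler1n expn_gt0 bin_gt0 ltnW.
rewrite (le_trans GG)// -[leLHS]addr0 lerD// ler_peMl ?sumr_ge0//.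
by rewrite exprn_ege1// ler1n fact_gt0.
Qed.

(** The sum of all coefficients in the expansion of [E <DF, DG>^2], including that of the squared
    mean, which only enlarges the bound. *)
Definition carre_const p : R := p%:R ^+ 2 * \sum_(i < p) diagram R p.-1 i ^+ 2 *
  ((p.-1 - i)`! ^ 2)%:R * \sum_(j < (p.-1 - i).+1) ('C(p.-1 - i, j) ^ 2)%:R.

(** The fully contracted term of the second moment is the squared mean. Every other term reduces, by
    two Cauchy-Schwarz inequalities, to contractions of [F] with itself and of [G] with itself, each
    below a fourth cumulant. *)
Lemma carre_variance p a b : (0 < p)%N ->
  Ex P (fun w => (carre p a b w - Ex P (fun w => chaos p a w * chaos p b w)) ^+ 2) <=
  carre_const p * Num.sqrt (kurtosis p a * kurtosis p b).
Proof.
case: p => // p _; set S := Ex P (fun w => chaos p.+1 a w * chaos p.+1 b w).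
have Gm := mom_carre p.+1 a b.
have -> : Ex P (fun w => (carre p.+1 a b w - S) ^+ 2) = Ex P (fun w => carre p.+1 a b w ^+ 2) - S ^+ 2.
  rewrite (eq_Ex _ (g := fun w => carre p.+1 a b w ^+ 2 + (- 2 * S * carre p.+1 a b w + S ^+ 2))); last by move=> w; ring.
  rewrite ExD; [|intg_tac|intg_tac]; rewrite ExD; [|intg_tac|intg_tac].
  by rewrite ExZ; [|intg_tac]; rewrite Ex_cst Ex_carre// -/S; ring.
pose K i := diagram R p i ^+ 2 * ((p - i)`! ^ 2)%:R.
have H : Ex P (fun w => carre p.+1 a b w ^+ 2) = p.+1%:R ^+ 2 *
    \sum_(i < p.+1) K i * \sum_(j < (p - i).+1) ('C(p - i, j) ^ 2)%:R * dsum a b i.+1 j (p - i - j).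
  rewrite (eq_Ex _ (g := fun w => p.+1%:R ^+ 2 * (\sum_(x : 'I_m * 'I_m) (a x.1 * b x.2 * c x.1 x.2) *
     (herm p (V x.1 w) * herm p (V x.2 w))) ^+ 2)); last first.
    move=> w; rewrite /carre exprMn; congr (_ * _ ^+ 2).
    by rewrite (pair_bigA _ (fun k l => a k * b l * c k l * (herm p (V k w) * herm p (V l w)))).
  rewrite ExZ; last first.
    apply: mom_intg; apply: momX; apply: mom_sum => x.
    by have ? := Hm p x.1; have ? := Hm p x.2; mom_tac.
  rewrite Ex_herm_form; congr (_ * _); apply: eq_bigr => i _; congr (_ * _).
  apply: eq_bigr => j _; congr (_ * _); rewrite -[X in dsum _ _ X]add1n -dsumE.
  by apply: eq_bigr => x _; apply: eq_bigr => y _; rewrite !expr1.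
have top : p.+1%:R ^+ 2 * (K p * \sum_(j < (p - p).+1) ('C(p - p, j) ^ 2)%:R * dsum a b p.+1 j (p - p - j)) = S ^+ 2.
  rewrite -dsum_top subnn big_ord_recl big_ord0 addr0 /K /diagram subnn binn ffactnn mul1n fact0 exp1n mulr1.
  by rewrite mul1r factS natrM exprMn; ring.
rewrite H big_ord_recr/= mulrDr top addrK.
rewrite /carre_const/= big_ord_recr/= mulrDr mulrDl.
have K0 i : 0 <= K i by rewrite mulr_ge0// sqr_ge0.
have r0 : 0 <= p.+1%:R ^+ 2 :> R by rewrite sqr_ge0.
rewrite -[leLHS]addr0 lerD//; last first.
  rewrite mulr_ge0 ?sqrtr_ge0// mulr_ge0// mulr_ge0//; first exact: K0.
  by apply: sumr_ge0 => j _.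
rewrite -mulrA ler_wpM2l// mulr_suml; apply: ler_sum => i _.
rewrite -[leRHS]mulrA -/(K i) ler_wpM2l ?K0//.
rewrite mulr_suml; apply: ler_sum => j _; rewrite ler_wpM2l//.
(* The exponents [p - i] and [i + 1] are positive and add up to the order [p + 1], as
   [dsum_le_kurtosis] requires. *)
have ip : (0 < p - i)%N by rewrite subn_gt0.
rewrite (le_trans (ler_norm _))// (le_trans (norm_dsum_le _ _ _ _ _))//.
rewrite subnKC; last by rewrite -ltnS.
rewrite -(ger0_norm (dsum_ge0 a b i.+1 (p - i))) -sqrtr_sqr.
have pi : (p.+1 - (p - i) = i.+1)%N by rewrite subSn ?leq_subr// subKn// ltnW.
have ik e : dsum e e (p - i) i.+1 0 <= kurtosis p.+1 e.
  by rewrite -{1}pi; apply: dsum_le_kurtosis; rewrite ip ltnS leq_subr.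
rewrite ler_sqrt; last by rewrite mulr_ge0// (le_trans _ (ik _))// dsum_ge0.
by rewrite (le_trans (dsum_cauchy _ _ _ _))// ler_pM// dsum_ge0.
Qed.

Lemma kurtosis_ge0 p a : (1 < p)%N -> 0 <= kurtosis p a.
Proof.
move=> p1; rewrite (le_trans _ (dsum_le_kurtosis a (i := 1%N) _))// ?dsum_ge0//.
Qed.

End chaos.

(** * Hypercontractivity *)

Section chaos_calculus.
Context (R : realType) d (T : measurableType d) (P : probability T R) (m : nat).
Context (V : 'I_m -> T -> R) (c : 'I_m -> 'I_m -> R).
Hypothesis GF : gaussian_family P V c.
Hypothesis c1 : forall k, c k k = 1.
Implicit Types a b : 'I_m -> R.

Let Hm n k : mom P (fun w => herm n (V k w)).
Proof. by have [] := wder_mom GF (wder_herm V c k n k). Qed.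

Definition dchaos p b k w : R := p%:R * \sum_l b l * c k l * herm p.-1 (V l w).

Lemma wder_chaos p b k : wder V c k (chaos V p b) (dchaos p b k).
Proof.
apply: wder_ext (wder_sum (index_enum 'I_m) (fun l => wderZ (b l) (wder_herm V c k p l))) _ _ => w //.
by rewrite /dchaos mulr_sumr; apply: eq_bigr => l _; ring.
Qed.

Let Dm p b k : mom P (dchaos p b k).
Proof. by have [] := wder_mom GF (wder_chaos p b k). Qed.

Lemma carre_dchaos p a b w :
  carre V c p a b w = \sum_k a k * (herm p.-1 (V k w) * dchaos p b k w).
Proof.
rewrite /carre mulr_sumr; apply: eq_bigr => k _; rewrite /dchaos !mulr_sumr.
by apply: eq_bigr => l _; ring.
Qed.

(** Each Hermite polynomial is lowered by one integration by parts in its own direction [h_k]. *)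
Lemma chaos_ibp p a f (g : 'I_m -> T -> R) : (0 < p)%N -> (forall k, wder V c k f (g k)) ->
  Ex P (fun w => chaos V p a w * f w) =
  Ex P (fun w => \sum_k a k * (herm p.-1 (V k w) * g k w)).
Proof.
case: p => // p _ fg.
have fm (k : 'I_m) : mom P f by have [] := wder_mom GF (fg k).
have gm k : mom P (g k) by have [] := wder_mom GF (fg k).
rewrite (eq_Ex _ (g := fun w => \sum_k a k * (herm p.+1 (V k w) * f w))); last first.
  by move=> w; rewrite mulr_suml; apply: eq_bigr => k _; rewrite mulrA.
rewrite !Ex_sum => [|k|k]; last 2 first.
- by have ? := Hm p k; have ? := gm k; intg_tac.
- by have ? := Hm p.+1 k; have ? := fm k; intg_tac.
apply: eq_bigr => k _; rewrite !ExZ; last 2 first.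
- by have ? := Hm p k; have ? := gm k; intg_tac.
- by have ? := Hm p.+1 k; have ? := fm k; intg_tac.
by congr (_ * _); have := wick_ibp0 GF c1 k p (fg k); under eq_Ex do rewrite wick0; move=> /= ->;
  apply: eq_Ex => w.
Qed.

Lemma chaos_sin_ibp p a b u t : (0 < p)%N ->
  Ex P (fun w => chaos V p a w * sin (u * chaos V p a w + (chaos V p b w + t))) =
  Ex P (fun w => (u * carre V c p a a w + carre V c p a b w) *
    cos (u * chaos V p a w + (chaos V p b w + t))).
Proof.
move=> p0.
pose g k w := (u * dchaos p a k w + dchaos p b k w) * cos (u * chaos V p a w + (chaos V p b w + t)).
rewrite (@chaos_ibp p a _ g)//; last first.
  move=> k; apply: wder_ext (wder_sin (wderD (wderZ u (wder_chaos p a k))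
    (wderD (wder_chaos p b k) (wder_cst V c k t)))) _ _ => w //.
  by rewrite /g addr0.
apply: eq_Ex => w; rewrite !carre_dchaos mulr_sumr -big_split mulr_suml.
by apply: eq_bigr => k _; rewrite /g/=; ring.
Qed.

Lemma chaos_ibpX p a n : (0 < p)%N ->
  Ex P (fun w => chaos V p a w ^+ n.+1) =
  n%:R * Ex P (fun w => chaos V p a w ^+ n.-1 * carre V c p a a w).
Proof.
move=> p0; have Fm := mom_chaos GF p a; have Gm := mom_carre GF p a a.
rewrite -ExZ; last by intg_tac.
rewrite (eq_Ex _ (g := fun w => chaos V p a w * chaos V p a w ^+ n)); last by move=> w; rewrite exprS.
rewrite (@chaos_ibp p a _ (fun k w => n%:R * chaos V p a w ^+ n.-1 * dchaos p a k w))//; last first.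
  by move=> k; apply: wderX; exact: wder_chaos.
apply: eq_Ex => w; rewrite carre_dchaos !mulr_sumr.
by apply: eq_bigr => k _; ring.
Qed.

(** [c] is the expectation of [V_k V_l], so the hypothesis at [y = V(w)] can be averaged over
    [w]. *)
Lemma quad_form_gf_le (A B : 'I_m -> 'I_m -> R) :
  (forall y : 'I_m -> R, \sum_k \sum_l y k * y l * A k l <= \sum_k \sum_l y k * y l * B k l) ->
  \sum_k \sum_l c k l * A k l <= \sum_k \sum_l c k l * B k l.
Proof.
move=> AB.
have Vm k : mom P (V k) := gf_mom GF k.
have E D : \sum_k \sum_l c k l * D k l = Ex P (fun w => \sum_k \sum_l V k w * V l w * D k l).
  rewrite Ex_sum => [|k]; last first.
    by apply: mom_intg; apply: mom_sum => l; have ? := Vm k; have ? := Vm l; mom_tac.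
  apply: eq_bigr => k _; rewrite Ex_sum => [|l]; last by have ? := Vm k; have ? := Vm l; intg_tac.
  apply: eq_bigr => l _; rewrite -(gf_cov GF) [RHS](eq_Ex _ (g := fun w => D k l * (V k w * V l w))).
    by rewrite ExZ 1?mulrC//; have ? := Vm k; have ? := Vm l; intg_tac.
  by move=> w; rewrite mulrC.
by rewrite !E; apply: Ex_le => //;
  try (apply: mom_intg; do 2![apply: mom_sum => ?]; mom_tac; exact: Vm).
Qed.

Lemma young_cube (x y : R) : 0 <= x -> 0 <= y -> 3 * (x ^+ 2 * y) <= 2 * x ^+ 3 + y ^+ 3.
Proof.
move=> x0 y0; rewrite -subr_ge0 (_ : _ - _ = (x - y) ^+ 2 * (2 * x + y)); last by ring.
by rewrite mulr_ge0 ?sqr_ge0// addr_ge0// mulr_ge0.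
Qed.

Lemma cube_root (s : R) : 0 <= s -> exists2 x : R, 0 <= x & x ^+ 3 = s.
Proof.
move=> s0; exists (s `^ 3^-1); first exact: powR_ge0.
by rewrite -powR_mulrn ?powR_ge0// -powRrM mulVf// powRr1.
Qed.

(** Hoelder's inequality with exponents [3/2] and [3], obtained by scaling [young_cube]; replacing
    [g] by [r = g + e] keeps the scale finite when [g = 0]. *)
Lemma Ex_young (F G : T -> R) (x g : R) : mom P F -> mom P G -> 0 < x -> 0 <= g ->
  Ex P (fun w => F w ^+ 6) = x ^+ 3 -> Ex P (fun w => G w ^+ 6) <= g ^+ 3 ->
  Ex P (fun w => F w ^+ 4 * G w ^+ 2) <= x ^+ 2 * g.
Proof.
move=> Fm Gm x0 g0 Fx Gg.
rewrite -ler_pdivrMl ?exprn_gt0//; apply/ler_addgt0Pr => e e0.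
set E := Ex P _; rewrite ler_pdivrMl ?exprn_gt0//.
set r := (g + e); have r0 : 0 < r by rewrite ltr_pwDr.
have r1 := lt0r_neq0 r0; have x1 := lt0r_neq0 x0.
have : 3 * E <= 2 * (r / x) * x ^+ 3 + (x / r) ^+ 2 * Ex P (fun w => G w ^+ 6).
  rewrite -Fx /E -!ExZ; try by intg_tac.
  rewrite -ExD; try by intg_tac.
  apply: Ex_le; try by intg_tac.
  move=> w; have xr : 0 < x / r by rewrite divr_gt0.
  have := @young_cube (F w ^+ 2) (G w ^+ 2 * (x / r)) (sqr_ge0 _) (mulr_ge0 (sqr_ge0 _) (ltW xr)).
  rewrite -(ler_pM2l (_ : 0 < r / x)) ?divr_gt0//.
  rewrite (_ : r / x * _ = 3 * (F w ^+ 4 * G w ^+ 2)); last by field; apply/andP.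
  by rewrite (_ : r / x * _ = 2 * (r / x) * F w ^+ 6 + (x / r) ^+ 2 * G w ^+ 6)//; field; apply/andP.
have : (x / r) ^+ 2 * Ex P (fun w => G w ^+ 6) <= x ^+ 2 * r.
  rewrite (le_trans (ler_wpM2l (sqr_ge0 _) Gg))// expr_div_n -mulrA ler_wpM2l ?sqr_ge0//.
  rewrite ler_pdivrMl ?exprn_gt0// -exprSr lerXn2r// ?nnegrE// ?ltW// /r.
  by rewrite ltrDl.
have -> : 2 * (r / x) * x ^+ 3 = 2 * (x ^+ 2 * r) by field.
by lra.
Qed.

(* Induction on [p]: [E F^6 = 5 E (F^4 <DF, DF>)], and [<DF, DF>] is the average over
   [y = V] of the squares of the chaoses of order [p - 1] with coefficients [a_k y_k]. *)
Lemma chaos_hypercontractive p a :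
  Ex P (fun w => chaos V p a w ^+ 6) <= 125 ^+ p * Ex P (fun w => chaos V p a w ^+ 2) ^+ 3.
Proof.
elim: p a => [|p IH] a.
  have E n : Ex P (fun w => chaos V 0 a w ^+ n) = (\sum_k a k) ^+ n.
    rewrite -[RHS](Ex_cst P); apply: eq_Ex => w; congr (_ ^+ _); apply: eq_bigr => k _.
    by rewrite herm0 mulr1.
  by rewrite !E expr0 mul1r -exprM.
have Fm := mom_chaos GF p.+1 a.
have F60 : 0 <= Ex P (fun w => chaos V p.+1 a w ^+ 6).
  by apply: Ex_ge0 => w; rewrite (exprM _ 2 3) exprn_ge0 ?sqr_ge0.
set e := Ex P (fun w => chaos V p.+1 a w ^+ 2).
have e0 : 0 <= e by apply: Ex_ge0 => w; exact: sqr_ge0.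
(* With [x^3 = E F^6] the claim becomes [x <= 5^(p+1) e]. Multiplied by [x^2], its left side is
   [E F^6] again, to which integration by parts applies. *)
have [x x0 xE] := cube_root F60; rewrite -xE.
move: x0; rewrite le_eqVlt => /predU1P[<-|x0].
  by rewrite expr0n mulr_ge0 ?exprn_ge0.
rewrite (_ : 125 ^+ p.+1 * e ^+ 3 = (5 ^+ p.+1 * e) ^+ 3); last first.
  by rewrite exprMn -exprM mulnC exprM; congr (_ ^+ _ * _); ring.
rewrite lerXn2r ?nnegrE ?mulr_ge0 ?exprn_ge0 ?(ltW x0)//.
rewrite -(ler_pM2l (_ : 0 < x ^+ 2)) ?exprn_gt0// -exprSr xE (chaos_ibpX a 5)//=.
rewrite [5 ^+ _]exprS -[5 * _ * e]mulrA [leRHS]mulrCA ler_pM2l// [leRHS]mulrCA /e.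
have -> : Ex P (fun w => chaos V p.+1 a w ^+ 2) = Ex P (carre V c p.+1 a a).
  by rewrite (Ex_carre GF c1)//; apply: eq_Ex => w; rewrite expr2.
(* [A] and [B] give the two sides before averaging with [c]; they are compared as quadratic forms in
   a deterministic [y]. *)
pose A k l := p.+1%:R * (a k * a l) *
  Ex P (fun w => chaos V p.+1 a w ^+ 4 * (herm p (V k w) * herm p (V l w))).
pose B k l := p.+1%:R * (a k * a l) * (x ^+ 2 * 5 ^+ p * Ex P (fun w => herm p (V k w) * herm p (V l w))).
have Hi (Z : T -> R) (y : 'I_m -> 'I_m -> R) : mom P Z ->
    Ex P (fun w => Z w * \sum_k \sum_l y k l * (herm p (V k w) * herm p (V l w))) =
    \sum_k \sum_l y k l * Ex P (fun w => Z w * (herm p (V k w) * herm p (V l w))).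
  move=> Zm.
  rewrite (eq_Ex _ (g := fun w => \sum_k \sum_l y k l * (Z w * (herm p (V k w) * herm p (V l w))))).
    rewrite Ex_sum => [|k]; last first.
      by apply: mom_intg; apply: mom_sum => l; have ? := Hm p k; have ? := Hm p l; mom_tac.
    apply: eq_bigr => k _; rewrite Ex_sum => [|l]; last first.
      by have ? := Hm p k; have ? := Hm p l; intg_tac.
    by apply: eq_bigr => l _; rewrite ExZ//; have ? := Hm p k; have ? := Hm p l; intg_tac.
  move=> w; rewrite mulr_sumr; apply: eq_bigr => k _; rewrite mulr_sumr.
  by apply: eq_bigr => l _; rewrite mulrCA.
have -> : Ex P (fun w => chaos V p.+1 a w ^+ 4 * carre V c p.+1 a a w) = \sum_k \sum_l c k l * A k l.
  have ? : mom P (fun w => p.+1%:R * chaos V p.+1 a w ^+ 4) by mom_tac.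
  rewrite (eq_Ex _ (g := fun w => (p.+1%:R * chaos V p.+1 a w ^+ 4) *
    \sum_k \sum_l (a k * a l * c k l) * (herm p (V k w) * herm p (V l w)))); last first.
    by move=> w; rewrite /carre mulrCA mulrA.
  rewrite Hi//; apply: eq_bigr => k _; apply: eq_bigr => l _; rewrite /A.
  under eq_Ex do rewrite -mulrA.
  by rewrite ExZ; [ring|have ? := Hm p k; have ? := Hm p l; intg_tac].
have -> : 5 ^+ p * (x ^+ 2 * Ex P (carre V c p.+1 a a)) = \sum_k \sum_l c k l * B k l.
  rewrite (eq_Ex _ (g := fun w => p.+1%:R *
    \sum_k \sum_l (a k * a l * c k l) * (herm p (V k w) * herm p (V l w)))); last by [].
  rewrite Hi; last exact: mom_cst.
  rewrite !mulr_sumr; apply: eq_bigr => k _; rewrite !mulr_sumr; apply: eq_bigr => l _; rewrite /B.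
  by rewrite ExZ; [ring|have ? := Hm p k; have ? := Hm p l; intg_tac].
apply: quad_form_gf_le => y.
pose G := chaos V p (fun k => a k * y k).
have Gm : mom P G := mom_chaos GF p _.
have G2 w : G w ^+ 2 = \sum_k \sum_l (a k * y k * (a l * y l)) * (herm p (V k w) * herm p (V l w)).
  rewrite /G expr2 /chaos mulr_suml; apply: eq_bigr => k _; rewrite mulr_sumr.
  by apply: eq_bigr => l _; ring.
have -> : \sum_k \sum_l y k * y l * A k l = p.+1%:R * Ex P (fun w => chaos V p.+1 a w ^+ 4 * G w ^+ 2).
  under [in RHS]eq_Ex do rewrite G2; rewrite Hi; last by mom_tac.
  rewrite mulr_sumr; apply: eq_bigr => k _; rewrite mulr_sumr; apply: eq_bigr => l _.
  by rewrite /A; ring.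
have -> : \sum_k \sum_l y k * y l * B k l = p.+1%:R * (x ^+ 2 * (5 ^+ p * Ex P (fun w => G w ^+ 2))).
  rewrite (_ : Ex P (fun w => G w ^+ 2) = Ex P (fun w => 1 * G w ^+ 2)); last first.
    by apply: eq_Ex => w; rewrite mul1r.
  under [in RHS]eq_Ex do rewrite G2; rewrite Hi; last exact: mom_cst.
  rewrite !mulr_sumr; apply: eq_bigr => k _; rewrite !mulr_sumr; apply: eq_bigr => l _.
  rewrite /B; have -> : Ex P (fun w => 1 * (herm p (V k w) * herm p (V l w))) =
    Ex P (fun w => herm p (V k w) * herm p (V l w)) by apply: eq_Ex => w; rewrite mul1r.
  by ring.
rewrite ler_pM2l ?ltr0Sn//; apply: Ex_young => //.
  by rewrite mulr_ge0 ?exprn_ge0//; apply: Ex_ge0 => w; exact: sqr_ge0.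
(* Here [125^p = (5^p)^3]. *)
rewrite (le_trans (IH _))// exprMn -exprM mulnC exprM.
by rewrite (_ : 5 ^+ 3 = 125)//; ring.
Qed.

End chaos_calculus.

(** * Square-integrable variables *)

Section square_integrable.
Context (R : realType) d (T : measurableType d) (P : probability T R).
Implicit Types f g : T -> R.

Definition sqintg f := measurable_fun setT f /\ intg P (fun w => f w ^+ 2).

Lemma mom_sqintg f : mom P f -> sqintg f.
Proof. by move=> fm; split; [exact: mom_measurable fm|intg_tac]. Qed.

Lemma sqintgM f g : sqintg f -> sqintg g -> intg P (fun w => f w * g w).
Proof.
move=> [mf fi] [mg gi]; apply: (intg_le (g := fun w => f w ^+ 2 + g w ^+ 2)).
- exact: measurable_funM.
- move=> w; rewrite -[f w ^+ 2]real_normK ?num_real// -[g w ^+ 2]real_normK ?num_real// normrM.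
  have := normr_ge0 (f w); have := normr_ge0 (g w); nra.
- exact: intgD.
Qed.

Lemma sqintg_intg f : sqintg f -> intg P f.
Proof.
move=> fi; have := sqintgM fi (mom_sqintg (mom_cst P 1)).
by under eq_fun do rewrite mulr1.
Qed.

Lemma sqintgD f g : sqintg f -> sqintg g -> sqintg (fun w => f w + g w).
Proof.
move=> fi gi; have fg := sqintgM fi gi; move: fi gi => [mf fi] [mg gi].
split; first exact: measurable_funD.
rewrite (_ : (fun _ => _) = (fun w => f w ^+ 2 + (2 * (f w * g w) + g w ^+ 2))); last first.
  by apply/funext => w; ring.
by apply: intgD => //; apply: intgD => //; exact: intgZ.
Qed.

Lemma Ex_sqr_ge0 f : 0 <= Ex P (fun w => f w ^+ 2).
Proof. by apply: Ex_ge0 => w; exact: sqr_ge0. Qed.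

Lemma Ex_mul_sqrt f g : sqintg f -> sqintg g ->
  `|Ex P (fun w => f w * g w)| <= Num.sqrt (Ex P (fun w => f w ^+ 2)) * Num.sqrt (Ex P (fun w => g w ^+ 2)).
Proof.
move=> fi gi; rewrite -sqrtrM ?Ex_sqr_ge0// -sqrtr_sqr ler_sqrt ?mulr_ge0 ?Ex_sqr_ge0//.
by apply: Ex_sqr_cauchy; [exact: fi.2|exact: gi.2|exact: sqintgM].
Qed.

Lemma sqintg_norm f : sqintg f -> sqintg (fun w => `|f w|).
Proof.
move=> [mf fi]; split; first exact: measurableT_comp.
by under eq_fun do rewrite real_normK ?num_real//.
Qed.

Lemma Ex_norm_sqrt f : sqintg f -> Ex P (fun w => `|f w|) <= Num.sqrt (Ex P (fun w => f w ^+ 2)).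
Proof.
move=> fi; have := Ex_mul_sqrt (sqintg_norm fi) (mom_sqintg (mom_cst P 1)).
have -> : Ex P (fun w => `|f w| ^+ 2) = Ex P (fun w => f w ^+ 2).
  by apply: eq_Ex => w; rewrite real_normK ?num_real.
rewrite expr1n Ex_cst sqrtr1 mulr1; under eq_Ex do rewrite mulr1.
by apply: le_trans; exact: ler_norm.
Qed.

Lemma Ex_sqrD f g : sqintg f -> sqintg g -> Ex P (fun w => (f w + g w) ^+ 2) <=
  2 * Ex P (fun w => f w ^+ 2) + 2 * Ex P (fun w => g w ^+ 2).
Proof.
move=> fi gi; have fgi := sqintgD fi gi; move: fi gi fgi => [mf fi] [mg gi] [_ fgi].
rewrite -!ExZ// -ExD; [|exact: intgZ|exact: intgZ].
apply: Ex_le => //; first by apply: intgD; exact: intgZ.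
by move=> w; have := sqr_ge0 (f w - g w); nra.
Qed.

End square_integrable.

(** * The approximate differential equation of the characteristic function *)

Section chaos_pair.
Context (R : realType) d (T : measurableType d) (P : probability T R).
Implicit Types F G Z : T -> R.

(* The fourth cumulant of a centered variable. *)
Definition excess F : R := Ex P (fun w => F w ^+ 4) - 3 * Ex P (fun w => F w ^+ 2) ^+ 2.

(* In [cp_ibp] the carre du champ of [F] and [G], which integration by parts produces,
   has been replaced by its expectation, at a cost governed by the fourth cumulants. *)
Record chaos_pair (B C : R) F G : Prop := {
  cp_mom1 : mom P F ;
  cp_mom2 : mom P G ;
  cp_hyp1 : Ex P (fun w => F w ^+ 6) <= B * Ex P (fun w => F w ^+ 2) ^+ 3 ;
  cp_hyp2 : Ex P (fun w => G w ^+ 6) <= B * Ex P (fun w => G w ^+ 2) ^+ 3 ;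
  cp_ibp : forall u t,
    `|Ex P (fun w => F w * sin (u * F w + (G w + t))) -
      (u * Ex P (fun w => F w ^+ 2) + Ex P (fun w => F w * G w)) *
        Ex P (fun w => cos (u * F w + (G w + t)))| <=
    `|u| * Num.sqrt (C * excess F) + Num.sqrt (C * Num.sqrt (excess F * excess G)) }.

Lemma chaos_chaos_pair m (V : 'I_m -> T -> R) c p (a b : 'I_m -> R) :
  gaussian_family P V c -> (forall k, c k k = 1) -> (1 < p)%N ->
  chaos_pair (125 ^+ p) (carre_const R p) (chaos V p a) (chaos V p b).
Proof.
move=> GF c1 p1; have p0 : (0 < p)%N := ltnW p1.
have Fm := mom_chaos GF p a; have Gm := mom_chaos GF p b.
split=> //; [exact: (chaos_hypercontractive GF c1)|exact: (chaos_hypercontractive GF c1)|move=> u t].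
have aam := mom_carre GF p a a; have abm := mom_carre GF p a b.
have tm : measurable_fun setT (fun w => u * chaos V p a w + (chaos V p b w + t)).
  by apply: (@mom_measurable _ _ _ P); mom_tac.
set s := Ex P (fun w => _ ^+ 2); set r := Ex P (fun w => chaos V p a w * chaos V p b w).
rewrite (chaos_sin_ibp GF c1)// -ExZ; last by intg_tac.
rewrite -ExB; [|intg_tac|intg_tac].
rewrite (eq_Ex _ (g := fun w => u * (carre V c p a a w - s) * cos (u * chaos V p a w + (chaos V p b w + t))
  + (carre V c p a b w - r) * cos (u * chaos V p a w + (chaos V p b w + t)))); last by move=> w; ring.
rewrite ExD; [|intg_tac|intg_tac]; rewrite (le_trans (ler_normD _ _))// lerD//.
  rewrite (@le_trans _ _ (Ex P (fun w => `|u| * `|carre V c p a a w - s|)))//.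
    apply: Ex_norm_le; [intg_tac|intg_tac|move=> w].
    by rewrite !normrM ler_piMr ?mulr_ge0// ler_norml cos_geN1 cos_le1.
  rewrite ExZ; last by intg_tac.
  rewrite ler_wpM2l// (le_trans (Ex_norm_sqrt (mom_sqintg _)))//; first by mom_tac.
  rewrite ler_sqrt; last first.
    rewrite mulr_ge0//; last exact: (kurtosis_ge0 GF c1).
    by rewrite /carre_const mulr_ge0 ?sqr_ge0// sumr_ge0// => i _;
      rewrite !mulr_ge0 ?sqr_ge0// sumr_ge0.
  have := carre_variance GF c1 a a p0; rewrite -expr2 sqrtr_sqr ger0_norm; last exact: (kurtosis_ge0 GF c1).
  by congr (Ex P _ <= _); apply/funext => w; congr ((_ - _) ^+ 2); apply: eq_Ex => v; rewrite expr2.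
rewrite (@le_trans _ _ (Ex P (fun w => `|carre V c p a b w - r|)))//.
  apply: Ex_norm_le; [intg_tac|intg_tac|move=> w].
  by rewrite !normrM ler_piMr// ler_norml cos_geN1 cos_le1.
rewrite (le_trans (Ex_norm_sqrt (mom_sqintg _)))//; first by mom_tac.
rewrite ler_sqrt; first by have := carre_variance GF c1 a b p0; rewrite /kurtosis -/(excess _) -/(excess _).
rewrite mulr_ge0 ?sqrtr_ge0//.
by rewrite /carre_const mulr_ge0 ?sqr_ge0// sumr_ge0// => i _;
  rewrite !mulr_ge0 ?sqr_ge0// sumr_ge0.
Qed.

(* Gronwall's argument: the bound [cp_ibp] says that [A u = E cos(uF + G + t)] almost
   solves [A' = - (u s + r) A], the equation of the Gaussian factor. *)
Lemma chaos_pair_charfun B C F G u t s r : chaos_pair B C F G ->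
  s = Ex P (fun w => F w ^+ 2) -> r = Ex P (fun w => F w * G w) ->
  `|Ex P (fun w => cos (u * F w + (G w + t))) -
    Ex P (fun w => cos (G w + t)) * expR (- (u ^+ 2 * s / 2 + u * r))| <=
  `|u| * (`|u| * Num.sqrt (C * excess F) + Num.sqrt (C * Num.sqrt (excess F * excess G))) *
    expR (u ^+ 2 * s / 2 + 2 * (`|u| * `|r|)).
Proof.
move=> [Fm Gm _ _ ibp] sE rE; rewrite -sE -rE in ibp.
set k := Num.sqrt (C * excess F) in ibp *; set l := Num.sqrt (C * Num.sqrt _) in ibp *.
pose A x := Ex P (fun w => 1 * cos (x * F w + (G w + t))).
(* Integrating factor: the derivative of [A E] is the defect in the equation times [E]. *)
pose E x : R := expR (x ^+ 2 * s / 2 + x * r).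
have mGt : measurable_fun setT (fun w => G w + t) by apply: (@mom_measurable _ _ _ P); mom_tac.
have dA (x : R) := is_derive_Ex_cos x (mom_cst P 1) Fm mGt.
have dE (x : R) : is_derive x 1 E ((x * s + r) * E x).
  have ? : is_derive x (1 : R) (fun x => x ^+ 2 * s / 2 + x * r) (x * s + r).
    by apply: is_derive_eq; rewrite /GRing.scale/=; field.
  by apply: is_derive_eq; rewrite /GRing.scale/= mulrC.
have dH (x : R) : is_derive x 1 (fun x => A x * E x)
    ((- Ex P (fun w => 1 * F w * sin (x * F w + (G w + t))) + (x * s + r) * A x) * E x).
  by have ? := dA x; have ? := dE x; apply: is_derive_eq; rewrite /GRing.scale/= /A; ring.
have s0 : 0 <= s by rewrite sE; apply: Ex_ge0 => w; exact: sqr_ge0.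
have k0 : 0 <= k by exact: sqrtr_ge0.
have l0 : 0 <= l by exact: sqrtr_ge0.
have [x] := @MVT_norm _ _ _ 0 u dH; rewrite !subr0 => xu HE.
have AE y : A y = Ex P (fun w => cos (y * F w + (G w + t))) by apply: eq_Ex => w; rewrite mul1r.
have A0 : Ex P (fun w => cos (G w + t)) = A 0 by rewrite AE; apply: eq_Ex => w; rewrite mul0r add0r.
have E0 : E 0 = 1 by rewrite /E expr0n/= !mul0r addr0 expR0.
have -> : Ex P (fun w => cos (u * F w + (G w + t))) -
    Ex P (fun w => cos (G w + t)) * expR (- (u ^+ 2 * s / 2 + u * r)) =
    (A u * E u - A 0 * E 0) * expR (- (u ^+ 2 * s / 2 + u * r)).
  by rewrite A0 -AE E0 mulr1 mulrBl -[A u * E u * _]mulrA /E -expRD subrr expR0 mulr1.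
have nE (y : R) : `|expR y| = expR y := ger0_norm (expR_ge0 y).
rewrite HE !normrM /E !nE.
(* Between [0] and [u] the factor [E] is at most [e^(u^2 s / 2 + |u r|)], and [1 / E u] is at most
   [e^|u r|]; hence the coefficient [2]. *)
have -> : `|u| * (`|u| * k + l) * expR (u ^+ 2 * s / 2 + 2 * (`|u| * `|r|)) =
    (`|u| * k + l) * expR (u ^+ 2 * s / 2 + `|u| * `|r|) * `|u| * expR (`|u| * `|r|).
  rewrite (_ : _ + 2 * _ = (u ^+ 2 * s / 2 + `|u| * `|r|) + `|u| * `|r|); last by ring.
  by rewrite [expR (_ + _ + _)]expRD; ring.
have ur y : `|y| <= `|u| -> y * r <= `|u| * `|r|.
  by move=> yu; rewrite (le_trans (ler_norm _))// normrM ler_wpM2r.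
rewrite ler_pM ?mulr_ge0 ?expR_ge0//; last first.
  rewrite ler_expR opprD -[leRHS]add0r lerD//.
    by rewrite oppr_le0 divr_ge0// mulr_ge0// sqr_ge0.
  by rewrite -mulNr ur// normrN.
rewrite ler_wpM2r// ler_pM ?expR_ge0//.
  rewrite -normrN.
  rewrite AE (_ : Ex P (fun w => 1 * F w * sin (x * F w + (G w + t))) =
    Ex P (fun w => F w * sin (x * F w + (G w + t)))); last by apply: eq_Ex => w; rewrite mul1r.
  rewrite [X in `|X|](_ : _ = Ex P (fun w => F w * sin (x * F w + (G w + t))) -
    (x * s + r) * Ex P (fun w => cos (x * F w + (G w + t)))); last by ring.
  by rewrite (le_trans (ibp x t))// lerD// ler_wpM2r.
rewrite ler_expR lerD ?ur// ler_wpM2r// ler_wpM2r//.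
by rewrite -[x ^+ 2]real_normK ?num_real// -[u ^+ 2]real_normK ?num_real// lerXn2r ?nnegrE.
Qed.

End chaos_pair.

(** * Limits of pairs of chaoses *)

Section l2_close.
Context (R : realType) d (T : measurableType d) (P : probability T R).
Implicit Types X Y F G : nat -> T -> R.

(** The approximants [F N] have all moments, while [X N] is only known to differ from them by a
    square-integrable function. *)
Record l2_close X F : Prop := {
  l2_measurable : forall N, measurable_fun setT (X N) ;
  l2_mom : forall N, mom P (F N) ;
  l2_intg : forall N, sqintg P (fun w => X N w - F N w) ;
  l2_le : forall N, Ex P (fun w => (X N w - F N w) ^+ 2) <= N.+1%:R^-1 }.

Lemma sqintg_l2 X F N : l2_close X F -> sqintg P (X N).
Proof.
move=> XF; have := sqintgD (l2_intg XF N) (mom_sqintg (l2_mom XF N)).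
by under eq_fun do rewrite subrK.
Qed.

Lemma Ex_sqr_l2 X F N : l2_close X F ->
  Ex P (fun w => X N w ^+ 2) <= 2 * Ex P (fun w => F N w ^+ 2) + 2.
Proof.
move=> XF; have := Ex_sqrD (l2_intg XF N) (mom_sqintg (l2_mom XF N)).
under eq_Ex do rewrite subrK; move=> /le_trans; apply.
rewrite addrC lerD2l ger_pMr// (le_trans (l2_le XF N))//.
by rewrite invf_le1// ler1n.
Qed.

Definition slack N : R := Num.sqrt N.+1%:R^-1.

Lemma cvg_slack : slack N @[N --> \oo] --> (0 : R).
Proof.
rewrite -(sqrtr0 R); apply: (continuous_cvg _ (@sqrt_continuous R 0)).
apply/cvgrPdist_le => e e0; have := near_infty_natSinv_lt (PosNum e0).
apply: filterS => N /= /ltW; rewrite sub0r normrN ger0_norm//.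
Qed.

Lemma Ex_norm_l2 X F N : l2_close X F -> Ex P (fun w => `|X N w - F N w|) <= slack N.
Proof.
move=> XF; rewrite (le_trans (Ex_norm_sqrt (l2_intg XF N)))// ler_sqrt ?invr_ge0//.
exact: l2_le.
Qed.

Lemma Ex_lipschitz X F (phi : R -> R) c M : l2_close X F -> continuous phi ->
  (forall x, `|phi x| <= M) -> (forall x y, `|phi x - phi y| <= c * `|x - y|) ->
  forall N, `|Ex P (fun w => phi (X N w)) - Ex P (fun w => phi (F N w))| <= c * slack N.
Proof.
move=> XF cphi phiM phic N.
have c0 : 0 <= c by have := phic 1 0; rewrite subr0 normr1 mulr1; apply: le_trans.
have mX := l2_measurable XF N; have mF := mom_measurable (l2_mom XF N).
have mp : measurable_fun setT phi by exact: continuous_measurable_fun.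
have pi (g : T -> R) : measurable_fun setT g -> intg P (fun w => phi (g w)).
  by move=> mg; apply: (@intg_bounded _ _ _ P _ M) => //; exact: measurableT_comp.
rewrite -ExB; [|exact: pi|exact: pi].
have D := sqintg_intg (l2_intg XF N).
apply: (@le_trans _ _ (Ex P (fun w => c * `|X N w - F N w|))).
  apply: Ex_norm_le => [||w]; last exact: phic.
    by apply: intgB; exact: pi.
  by apply: intgZ; exact: intg_norm.
by rewrite ExZ; [rewrite ler_wpM2l// Ex_norm_l2|exact: intg_norm].
Qed.

End l2_close.

Section truncated_square.
Context (R : realType).
Implicit Types e x y : R.

(** A truncated square: bounded by [1 / e] and Lipschitz, hence admissible as a test function, and
    tending to [x^2] with [e]. *)
Definition tsq e x : R := x ^+ 2 / (1 + e * x ^+ 2).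

Lemma tsq_den_gt0 e x : 0 < e -> 0 < 1 + e * x ^+ 2.
Proof. by move=> e0; rewrite ltr_pwDl// mulr_ge0 ?sqr_ge0// ltW. Qed.

Lemma tsq_ge0 e x : 0 < e -> 0 <= tsq e x.
Proof. by move=> e0; rewrite divr_ge0 ?sqr_ge0// ltW// tsq_den_gt0. Qed.

Lemma tsq_le e x : 0 < e -> tsq e x <= e^-1.
Proof.
move=> e0; rewrite ler_pdivrMr ?tsq_den_gt0// -ler_pdivrMl ?invr_gt0// invrK.
by rewrite lerDr.
Qed.

Lemma tsq_le_sqr e x : 0 < e -> tsq e x <= x ^+ 2.
Proof.
move=> e0; rewrite ler_pdivrMr ?tsq_den_gt0// ler_peMr ?sqr_ge0//.
by rewrite lerDl mulr_ge0 ?sqr_ge0// ltW.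
Qed.

Lemma tsq_sub e x : 0 < e -> `|x ^+ 2 - tsq e x| <= e * x ^+ 4.
Proof.
move=> e0; have D0 := tsq_den_gt0 x e0; rewrite ger0_norm ?subr_ge0 ?tsq_le_sqr//.
rewrite (_ : _ - _ = e * x ^+ 4 / (1 + e * x ^+ 2)); last by rewrite /tsq; field; rewrite lt0r_neq0.
have x4 : 0 <= x ^+ 4 by rewrite (exprM x 2 2) sqr_ge0.
have ex : 0 <= e * x ^+ 4 := mulr_ge0 (ltW e0) x4.
by rewrite ler_pdivrMr// ler_peMr// lerDl mulr_ge0 ?sqr_ge0// ltW.
Qed.

Lemma tsq_sqr_sub e x : 0 < e -> `|x ^+ 4 - tsq e x ^+ 2| <= 2 * e * x ^+ 6.
Proof.
move=> e0; rewrite (_ : _ - _ = (x ^+ 2 - tsq e x) * (x ^+ 2 + tsq e x)); last by ring.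
rewrite normrM (_ : 2 * e * x ^+ 6 = e * x ^+ 4 * (2 * x ^+ 2)); last by ring.
rewrite ler_pM// ?tsq_sub// ger0_norm ?addr_ge0 ?sqr_ge0 ?tsq_ge0//.
by rewrite mulr_natl mulr2n lerD2l tsq_le_sqr.
Qed.

Lemma continuous_tsq e : 0 < e -> continuous (tsq e).
Proof.
move=> e0 x; have c2 : {for x, continuous (fun x : R => x ^+ 2)} by exact: exprn_continuous.
apply: (cvgM c2); apply: cvgV; first by rewrite lt0r_neq0// tsq_den_gt0.
exact: (cvgD (cvg_cst (1 : R)) (cvgM (cvg_cst e) c2)).
Qed.

Lemma tsq_lipschitz e x y : 0 < e <= 1 -> `|tsq e x - tsq e y| <= 2 / e * `|x - y|.
Proof.
move=> /andP[e0 e1]; have Dx := tsq_den_gt0 x e0; have Dy := tsq_den_gt0 y e0.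
have B (z : R) : `|z| / (1 + e * z ^+ 2) <= e^-1.
  rewrite ler_pdivrMr ?tsq_den_gt0// -ler_pdivrMl ?invr_gt0// invrK.
  rewrite -[z ^+ 2]real_normK ?num_real//.
  by have := mulr_ge0 (ltW e0) (sqr_ge0 (`|z| - 2^-1)); nra.
have D1 (z : R) : (1 + e * z ^+ 2)^-1 <= 1.
  by rewrite invf_le1 ?tsq_den_gt0// lerDl mulr_ge0 ?sqr_ge0// ltW.
have D2 (z : R) : 0 <= (1 + e * z ^+ 2)^-1 by rewrite invr_ge0 ltW// tsq_den_gt0.
rewrite (_ : tsq e x - tsq e y = (x / (1 + e * x ^+ 2) / (1 + e * y ^+ 2) +
   y / (1 + e * y ^+ 2) / (1 + e * x ^+ 2)) * (x - y)); last first.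
  by rewrite /tsq; field; rewrite !lt0r_neq0.
rewrite normrM ler_wpM2r// (le_trans (ler_normD _ _))// mulr_natl mulr2n.
by rewrite lerD// normrM (ger0_norm (D2 _)) normrM (ger0_norm (D2 _)) -[leRHS]mulr1
  ler_pM ?mulr_ge0 ?divr_ge0// ltW// tsq_den_gt0.
Qed.

End truncated_square.

(** * Tightness and bounds on second moments *)

Section tightness.
Context (R : realType) d (T : measurableType d) (P : probability T R).
Implicit Types X F : nat -> T -> R.

Definition cvg_law X d' (T' : measurableType d') (Q : probability T' R) (Y : T' -> R) :=
  forall phi : R -> R, continuous phi -> (exists M, forall x, `|phi x| <= M) ->
    Ex P (fun w => phi (X N w)) @[N --> \oo] --> Ex Q (fun w => phi (Y w)).

(** [e * tsq e x] is a continuous substitute, with values in [[0, 1]], for the indicator of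
    [|x| > e^(-1/2)]. *)
Definition tight X := forall dl : R, 0 < dl -> exists2 e : R, 0 < e <= 1 &
  \forall N \near \oo, Ex P (fun w => e * tsq e (X N w)) <= dl.

Let etsq_ge0 (e x : R) : 0 < e -> 0 <= e * tsq e x.
Proof. by move=> e0; exact: mulr_ge0 (ltW e0) (tsq_ge0 x e0). Qed.

Let norm_etsq (e x : R) : 0 < e -> `|e * tsq e x| <= 1.
Proof.
move=> e0; rewrite ger0_norm ?etsq_ge0//.
by rewrite -ler_pdivlMl// mulr1 tsq_le.
Qed.

Let continuous_etsq (e : R) : 0 < e -> continuous (fun x : R => e * tsq e x).
Proof. by move=> e0 x; apply: cvgM; [exact: cvg_cst|exact: continuous_tsq]. Qed.

Lemma cvg_law_tight X d' (T' : measurableType d') (Q : probability T' R) (Y : T' -> R) :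
  measurable_fun setT Y -> cvg_law X Q Y -> tight X.
Proof.
move=> mY XY dl dl0.
pose e n : R := n.+1%:R^-1.
have e0 n : 0 < e n by rewrite invr_gt0 ltr0n.
have e1 n : e n <= 1 by rewrite invf_le1 ?ler1n ?ltr0n.
have me n : measurable_fun setT (fun w => e n * tsq (e n) (Y w)).
  by apply: (measurableT_comp (continuous_measurable_fun (continuous_etsq (e0 n)))).
have H : (\int[Q]_w (e n * tsq (e n) (Y w))%:E)%E @[n --> \oo] --> (\int[Q]_w (0 : R)%:E)%E.
  apply: (@dominated_cvg _ _ _ Q setT measurableT _ _ (fun=> 1%:E)) => //.
  - by move=> n; apply/measurable_EFinP.
  - move=> w _; apply: cvg_EFin; first by near=> n.
    have D0 : 0 < 1 + Y w ^+ 2 by rewrite ltr_pwDl ?sqr_ge0.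
    apply/cvgrPdist_le => t t0; have y0 : 0 < t / (1 + Y w ^+ 2) by rewrite divr_gt0.
    have := near_infty_natSinv_lt (PosNum y0); apply: filterS => n /= nt.
    rewrite sub0r normrN ger0_norm ?etsq_ge0//.
    rewrite (le_trans (ler_wpM2l (ltW (e0 n)) (tsq_le_sqr (Y w) (e0 n))))//.
    rewrite (@le_trans _ _ (e n * (1 + Y w ^+ 2)))//.
      by rewrite ler_wpM2l ?(ltW (e0 n))// lerDr.
    by rewrite -ler_pdivlMr//; exact: ltW.
  - exact: finite_measure_integrable_cst.
  - by move=> n w _; rewrite /= lee_fin norm_etsq.
move: H; rewrite integral0 => /fine_cvgP[_] /cvgrPdist_le /(_ (dl / 2)).
rewrite divr_gt0// => /(_ isT)[n _ /(_ n (leqnn n))]/=.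
rewrite sub0r normrN => Hn; exists (e n); first by rewrite e0 e1.
have bd : exists M : R, forall x : R, `|e n * tsq (e n) x| <= M by exists 1 => x; exact: norm_etsq.
have := XY _ (continuous_etsq (e0 n)) bd.
move=> /cvgrPdist_le /(_ (dl / 2)); rewrite divr_gt0// => /(_ isT).
apply: filterS => N; rewrite ler_distl => /andP[N1 _]; move: Hn; rewrite ler_norml => /andP[_].
by rewrite -/(Rintegral _ _ _) -/(Ex _ _); lra.
Unshelve. all: by end_near. Qed.

(** Cauchy-Schwarz for [F] and [F^3] gives [(E F^4)^2 <= B (E F^2)^4]; the constant [1 + B]
    dominates the square root of [B]. *)
Lemma Ex4_le (F : T -> R) (B : R) : mom P F -> 0 <= B ->
  Ex P (fun w => F w ^+ 6) <= B * Ex P (fun w => F w ^+ 2) ^+ 3 ->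
  Ex P (fun w => F w ^+ 4) <= (1 + B) * Ex P (fun w => F w ^+ 2) ^+ 2.
Proof.
move=> Fm B0; set s := Ex P (fun w => F w ^+ 2); set q := Ex P (fun w => F w ^+ 4) => FB.
have s0 : 0 <= s by exact: Ex_sqr_ge0.
have q0 : 0 <= q by apply: Ex_ge0 => w; rewrite (exprM _ 2 2) sqr_ge0.
have := @Ex_sqr_cauchy _ _ _ P F (fun w => F w ^+ 3).
have -> : Ex P (fun w => F w * F w ^+ 3) = q by apply: eq_Ex => w; rewrite -exprS.
have -> : Ex P (fun w => (F w ^+ 3) ^+ 2) = Ex P (fun w => F w ^+ 6) by apply: eq_Ex => w; rewrite -exprM.
move=> H; have {H} := H (ltac:(intg_tac)) (ltac:(intg_tac)) (ltac:(intg_tac)).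
rewrite -/s => H; rewrite -(ler_pXn2r (_ : (0 < 2)%N)) ?nnegrE ?mulr_ge0 ?addr_ge0 ?sqr_ge0//.
rewrite (le_trans H)// (le_trans (ler_wpM2l s0 FB))//.
rewrite [leLHS](_ : _ = B * s ^+ 4); last by ring.
rewrite [leRHS](_ : _ = (1 + B) ^+ 2 * s ^+ 4); last by ring.
by rewrite ler_wpM2r ?exprn_ge0//; nra.
Qed.

Lemma cvg0_slackM (c : R) : c * slack R N @[N --> \oo] --> (0 : R).
Proof. by rewrite -(mulr0 c); exact: (cvgM (cvg_cst c) (@cvg_slack R)). Qed.

(** An argument of Paley-Zygmund type: hypercontractivity prevents a large second moment from being
    carried by an event of small probability, and tightness makes large values improbable. *)
Lemma tight_moment2 X F (B : R) : 0 <= B -> l2_close P X F ->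
  (forall N, Ex P (fun w => F N w ^+ 6) <= B * Ex P (fun w => F N w ^+ 2) ^+ 3) ->
  tight X -> exists S : R, \forall N \near \oo, Ex P (fun w => F N w ^+ 2) <= S.
Proof.
move=> B0 XF FB tX; pose b := 1 + B; have b0 : 0 < b by rewrite ltr_pwDl.
have [|e /andP[e0 e1] He] := tX ((4 * b)^-1); first by rewrite invr_gt0 mulr_gt0.
exists (e * b)^-1.
have sl : \forall N \near \oo, 2 * slack R N <= (4 * b)^-1.
  have /cvgrPdist_le /(_ ((4 * b)^-1)) := cvg0_slackM 2.
  rewrite invr_gt0 mulr_gt0// => /(_ isT); apply: filterS => N.
  by rewrite sub0r normrN; apply: le_trans; exact: ler_norm.
have Ft := Ex_lipschitz XF (continuous_etsq e0) (fun x => norm_etsq x e0) (c := 2) _.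
near=> N; have Fm := l2_mom XF N.
set s := Ex P (fun w => F N w ^+ 2).
have s0 : 0 <= s by exact: Ex_sqr_ge0.
have mt : mom P (fun w => tsq e (F N w)).
  apply: (@mom_bounded _ _ _ P _ e^-1).
    by apply: (measurableT_comp (continuous_measurable_fun (continuous_tsq e0))); exact: mom_measurable Fm.
  by move=> w; rewrite ger0_norm ?tsq_ge0 ?tsq_le.
have E1 : e * Ex P (fun w => tsq e (F N w)) <= (2 * b)^-1.
  have : Ex P (fun w => e * tsq e (X N w)) <= (4 * b)^-1 by near: N.
  have : 2 * slack R N <= (4 * b)^-1 by near: N.
  have := Ft _ N; rewrite ler_distl => /(_ _)/andP[|+ _].
    move=> x y; rewrite -mulrBr normrM gtr0_norm//.
    rewrite (le_trans (ler_wpM2l (ltW e0) (tsq_lipschitz x y _)))// ?e0//.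
    by rewrite mulrA mulrCA divff ?mulr1// lt0r_neq0.
  rewrite [X in X - _ <= _](_ : _ = e * Ex P (fun w => tsq e (F N w))); last by rewrite ExZ//; intg_tac.
  by rewrite !invfM; lra.
(* Cauchy-Schwarz, with [F^2] as the geometric mean of [F^2 / (1 + e F^2)] and [F^2 (1 + e F^2)]. *)
have E2 : s ^+ 2 <= Ex P (fun w => tsq e (F N w)) * (s + e * Ex P (fun w => F N w ^+ 4)).
  apply: quad_form_cauchy => x y.
  have <- : Ex P (fun w => F N w ^+ 2 + e * F N w ^+ 4) = s + e * Ex P (fun w => F N w ^+ 4).
    by rewrite ExD; [rewrite ExZ//; intg_tac|intg_tac|intg_tac].
  rewrite -!ExZ; try by intg_tac.
  rewrite -ExD; [|intg_tac|intg_tac]; rewrite -ExD; [|intg_tac|intg_tac].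
  apply: Ex_ge0 => w; have D0 := tsq_den_gt0 (F N w) e0.
  rewrite [leRHS](_ : _ = F N w ^+ 2 / (1 + e * F N w ^+ 2) * (x + y * (1 + e * F N w ^+ 2)) ^+ 2).
    by rewrite mulr_ge0 ?sqr_ge0// tsq_ge0.
  by rewrite /tsq; field; rewrite lt0r_neq0.
have E3 := Ex4_le Fm B0 (FB N); rewrite -/s -/b in E3.
have t0 : 0 <= Ex P (fun w => tsq e (F N w)) by apply: Ex_ge0 => w; exact: tsq_ge0.
(* The second term on the right is half of the left side, so [s <= 1 / (e b)]. *)
have E4 : e * s ^+ 2 <= (2 * b)^-1 * (s + e * (b * s ^+ 2)).
  rewrite (le_trans (ler_wpM2l (ltW e0) E2))// [leLHS]mulrA ler_pM//.
  - exact: mulr_ge0 (ltW e0) t0.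
  - rewrite addr_ge0// mulr_ge0 ?(ltW e0)//; apply: Ex_ge0 => w; by rewrite (exprM _ 2 2) sqr_ge0.
  - by rewrite lerD2l ler_wpM2l// ltW.
move: s0; rewrite le_eqVlt => /predU1P[<-|s0]; first by rewrite invr_ge0 mulr_ge0 ?ltW.
rewrite -[_^-1]mul1r ler_pdivlMr ?mulr_gt0//.
have : 2 * b * (e * s ^+ 2) <= s + e * (b * s ^+ 2).
  by rewrite -ler_pdivlMl ?mulr_gt0.
move=> H; rewrite -(ler_pM2r s0) mul1r.
rewrite (_ : s * (e * b) * s = e * (b * s ^+ 2)); last by ring.
by rewrite -subr_ge0; move: H; rewrite -subr_ge0; congr (0 <= _); ring.
Unshelve. all: by end_near. Qed.

End tightness.

Section moment_limits.
Context (R : realType) d (T : measurableType d) (P : probability T R).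
Context d' (T' : measurableType d') (Q : probability T' R).
Implicit Types (X F : nat -> T -> R) (Z : T' -> R).

(** Interchange of limits: [phi e] is bounded and Lipschitz, and it replaces the unbounded [f] at a
    cost [e M], both in the limit and for all large [N]. *)
Lemma approx_limit X F Z (f : R -> R) (phi : R -> R -> R) (M : R) :
  l2_close P X F -> cvg_law P X Q Z ->
  (forall e, 0 < e <= 1 -> [/\ continuous (phi e), exists C : R, forall x, `|phi e x| <= C &
    exists c : R, forall x y, `|phi e x - phi e y| <= c * `|x - y|]) ->
  (forall e, 0 < e -> `|Ex Q (fun w => f (Z w)) - Ex Q (fun w => phi e (Z w))| <= e * M) ->
  (forall e, 0 < e -> \forall N \near \oo,
    `|Ex P (fun w => f (F N w)) - Ex P (fun w => phi e (F N w))| <= e * M) ->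
  Ex P (fun w => f (F N w)) @[N --> \oo] --> Ex Q (fun w => f (Z w)).
Proof.
move=> XF XZ phiP HZ HF; have M0 : 0 <= M by have := HZ 1 ltr01; rewrite mul1r; apply: le_trans.
apply/cvgrPdist_le => t t0; pose e : R := Num.min 1 (t / (4 * (M + 1))).
have tM : 0 < t / (4 * (M + 1)) by rewrite divr_gt0// mulr_gt0// ltr_wpDl.
have e0 : 0 < e by rewrite lt_min ltr01.
have e1 : e <= 1 by rewrite ge_min lexx.
have eM : e * M <= t / 4.
  rewrite (@le_trans _ _ (t / (4 * (M + 1)) * (M + 1)))//; last first.
    by rewrite invfM -!mulrA mulVf ?mulr1// lt0r_neq0// ltr_wpDl.
  by rewrite ler_pM ?(ltW e0)// ?lerDl// ge_min lexx orbT.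
have [|cphi [C phiC] [c phic]] := phiP e; first by rewrite e0.
have /cvgrPdist_le /(_ (t / 4)) H1 := XZ _ cphi (ex_intro _ C phiC).
have /cvgrPdist_le /(_ (t / 4)) H2 := cvg0_slackM c.
have t4 : 0 < t / 4 by rewrite divr_gt0.
near=> N.
have := HZ e e0; have : `|Ex P (fun w => f (F N w)) - Ex P (fun w => phi e (F N w))| <= e * M.
  by near: N; exact: HF.
have : `|Ex Q (fun w => phi e (Z w)) - Ex P (fun w => phi e (X N w))| <= t / 4.
  by near: N; exact: H1.
have : `|0 - c * slack R N| <= t / 4 by near: N; exact: H2.
have := Ex_lipschitz XF cphi phiC phic N.
rewrite sub0r normrN !ler_distl [`|c * _| <= _]ler_norml.
by move=> /andP[? ?] /andP[? ?] /andP[? ?] /andP[? ?] /andP[? ?]; apply/andP; split; lra.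
Unshelve. all: by end_near. Qed.

Lemma moment_limits X F Z (M : R) : l2_close P X F -> cvg_law P X Q Z -> mom Q Z ->
  (\forall N \near \oo, Ex P (fun w => F N w ^+ 4) <= M) ->
  (\forall N \near \oo, Ex P (fun w => F N w ^+ 6) <= M) ->
  Ex P (fun w => F N w ^+ 2) @[N --> \oo] --> Ex Q (fun w => Z w ^+ 2) /\
  Ex P (fun w => F N w ^+ 4) @[N --> \oo] --> Ex Q (fun w => Z w ^+ 4).
Proof.
move=> XF XZ Zm M4 M6.
(* One constant for the moments of [F N] and of [Z], so that [B2] and [B4] apply to both. *)
pose M' := Num.max M (Num.max (Ex Q (fun w => Z w ^+ 4)) (Ex Q (fun w => Z w ^+ 6))).
have MM : M <= M' by rewrite le_max lexx.
have MZ4 : Ex Q (fun w => Z w ^+ 4) <= M' by rewrite !le_max lexx orbT.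
have MZ6 : Ex Q (fun w => Z w ^+ 6) <= M' by rewrite !le_max lexx !orbT.
have mt d0 (T0 : measurableType d0) (P0 : probability T0 R) (g : T0 -> R) e : 0 < e ->
    mom P0 g -> mom P0 (fun w => tsq e (g w)).
  move=> e0 gm; apply: (@mom_bounded _ _ _ P0 _ e^-1).
    apply: (measurableT_comp (continuous_measurable_fun (continuous_tsq e0))).
    exact: mom_measurable gm.
  by move=> w; rewrite ger0_norm ?tsq_ge0 ?tsq_le.
have B2 d0 (T0 : measurableType d0) (P0 : probability T0 R) (g : T0 -> R) e : 0 < e -> mom P0 g ->
    Ex P0 (fun w => g w ^+ 4) <= M' ->
    `|Ex P0 (fun w => g w ^+ 2) - Ex P0 (fun w => tsq e (g w))| <= e * M'.
  move=> e0 gm g4; have tm := mt _ _ _ _ _ e0 gm; rewrite -ExB; [|intg_tac|intg_tac].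
  rewrite (@le_trans _ _ (Ex P0 (fun w => e * g w ^+ 4)))//.
    by apply: Ex_norm_le; [intg_tac|intg_tac|move=> w; exact: tsq_sub].
  by rewrite ExZ; [rewrite ler_wpM2l// ltW|intg_tac].
have B4 d0 (T0 : measurableType d0) (P0 : probability T0 R) (g : T0 -> R) e : 0 < e -> mom P0 g ->
    Ex P0 (fun w => g w ^+ 6) <= M' ->
    `|Ex P0 (fun w => g w ^+ 4) - Ex P0 (fun w => tsq e (g w) ^+ 2)| <= e * (2 * M').
  move=> e0 gm g4; have tm := mt _ _ _ _ _ e0 gm; rewrite -ExB; [|intg_tac|intg_tac].
  rewrite (@le_trans _ _ (Ex P0 (fun w => 2 * e * g w ^+ 6)))//.
    by apply: Ex_norm_le; [intg_tac|intg_tac|move=> w; exact: tsq_sqr_sub].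
  by rewrite ExZ; [rewrite mulrCA mulrA ler_wpM2l// mulr_ge0// ltW|intg_tac].
split.
  apply: (@approx_limit X F Z (fun x => x ^+ 2) (@tsq R) M') => // [e /andP[e0 e1]|e e0|e e0].
  - split; first exact: continuous_tsq.
      by exists e^-1 => x; rewrite ger0_norm ?tsq_ge0 ?tsq_le.
    by exists (2 / e) => x y; apply: tsq_lipschitz; rewrite e0.
  - exact: B2.
  - apply: filterS M4 => N MN; apply: B2 => //; first exact: l2_mom XF N.
    exact: le_trans MN MM.
apply: (@approx_limit X F Z (fun x => x ^+ 4) (fun e x => tsq e x ^+ 2) (2 * M')) => // [e /andP[e0 e1]|e e0|e e0].
- have tb x : `|tsq e x| <= e^-1 by rewrite ger0_norm ?tsq_ge0 ?tsq_le.
  split.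
  + by under eq_fun do rewrite expr2; move=> x; apply: cvgM; exact: continuous_tsq.
  + by exists (e^-1 ^+ 2) => x; rewrite normrX lerXn2r ?nnegrE ?invr_ge0 ?(ltW e0).
  + exists (2 / e * (e^-1 + e^-1)) => x y; rewrite subr_sqr normrM mulrAC.
    rewrite ler_pM// ?tsq_lipschitz ?e0//.
    by rewrite (le_trans (ler_normD _ _))// lerD.
- exact: B4.
- apply: filterS M6 => N MN; apply: B4 => //; first exact: l2_mom XF N.
  exact: le_trans MN MM.
Qed.

End moment_limits.

Section chaos_pair_limit.
Context (R : realType) d (T : measurableType d) (P : probability T R).
Context d' (T' : measurableType d') (Q : probability T' R) (Z : T' -> R).
Context (B C r : R) (X Y F G : nat -> T -> R).
Hypotheses (B0 : 0 <= B) (FG : forall N, chaos_pair P B C (F N) (G N)).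
Hypotheses (XF : l2_close P X F) (YG : l2_close P Y G).
Hypotheses (Zm : mom Q Z) (Z4 : Ex Q (fun w => Z w ^+ 4) = 3 * Ex Q (fun w => Z w ^+ 2) ^+ 2).
Hypotheses (XZ : cvg_law P X Q Z) (tY : tight P Y).
Hypothesis XYr : Ex P (fun w => X N w * Y N w) @[N --> \oo] --> (r : R).

Let s := Ex Q (fun w => Z w ^+ 2).
Let Fm N : mom P (F N). Proof. exact: l2_mom XF N. Qed.
Let Gm N : mom P (G N). Proof. exact: l2_mom YG N. Qed.

(** Tightness bounds the second moments, and hypercontractivity then the fourth and sixth. Hence the
    second and fourth moments converge to those of [Z], whose fourth cumulant is [0]. *)
Let excess_F : [/\ Ex P (fun w => F N w ^+ 2) @[N --> \oo] --> s,
  excess P (F N) @[N --> \oo] --> (0 : R) &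
  exists S : R, \forall N \near \oo, Ex P (fun w => F N w ^+ 2) <= S].
Proof.
have tX := cvg_law_tight (mom_measurable Zm) XZ.
have [S FS] := tight_moment2 B0 XF (fun N => cp_hyp1 (FG N)) tX.
pose M := Num.max ((1 + B) * S ^+ 2) (B * S ^+ 3).
have [||l2 l4] := @moment_limits _ _ _ P _ _ Q X F Z M XF XZ Zm.
- apply: filterS FS => N FS; rewrite (le_trans (Ex4_le (Fm N) B0 (cp_hyp1 (FG N))))//.
  rewrite le_max; apply/orP; left; rewrite ler_wpM2l ?addr_ge0//.
  by rewrite lerXn2r ?nnegrE ?(le_trans _ FS) ?Ex_sqr_ge0.
- apply: filterS FS => N FS; rewrite (le_trans (cp_hyp1 (FG N)))//.
  rewrite le_max; apply/orP; right; rewrite ler_wpM2l//.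
  by rewrite lerXn2r ?nnegrE ?(le_trans _ FS) ?Ex_sqr_ge0.
split=> //; last by exists S.
rewrite -(subrr (Ex Q (fun w => Z w ^+ 4))) [X in _ - X]Z4.
apply: cvgB => //; apply: cvgM; first exact: cvg_cst.
exact: (cvgM l2 l2).
Qed.

Let bounded_G : exists S : R, \forall N \near \oo, Ex P (fun w => G N w ^+ 2) <= S.
Proof. exact: tight_moment2 B0 YG (fun N => cp_hyp2 (FG N)) tY. Qed.

(** Convergence of the covariances is assumed for [X] and [Y]; Cauchy-Schwarz transfers it to the
    approximants at the cost [b N]. *)
Let cvg_Ex_FG : Ex P (fun w => F N w * G N w) @[N --> \oo] --> (r : R).
Proof.
have [_ _ [S FS]] := excess_F; have [S' GS] := bounded_G.
pose b N : R := slack R N * (1 + Num.sqrt S + Num.sqrt S').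
have b0 : b N @[N --> \oo] --> (0 : R).
  by rewrite -(mul0r (1 + Num.sqrt S + Num.sqrt S')); apply: cvgM; [exact: cvg_slack|exact: cvg_cst].
have FGE : \forall N \near \oo, `|Ex P (fun w => F N w * G N w) - Ex P (fun w => X N w * Y N w)| <= b N.
  near=> N; have FSN : Ex P (fun w => F N w ^+ 2) <= S by near: N.
  have GSN : Ex P (fun w => G N w ^+ 2) <= S' by near: N.
  have dX := l2_intg XF N; have dY := l2_intg YG N.
  have Fi := mom_sqintg (Fm N); have Gi := mom_sqintg (Gm N).
  have -> : Ex P (fun w => X N w * Y N w) = Ex P (fun w => F N w * G N w) +
      (Ex P (fun w => (X N w - F N w) * (Y N w - G N w)) +
      (Ex P (fun w => (X N w - F N w) * G N w) + Ex P (fun w => F N w * (Y N w - G N w)))).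
    have i1 := sqintgM dX dY; have i2 := sqintgM dX Gi; have i3 := sqintgM Fi dY; have i4 := sqintgM Fi Gi.
    rewrite -ExD//; rewrite -ExD//; last exact: intgD.
    rewrite -ExD//; last by do ?[apply: intgD].
    by apply: eq_Ex => w; ring.
  rewrite opprD addNKr normrN.
  have sl Z1 Z2 : l2_close P Z1 Z2 -> Num.sqrt (Ex P (fun w => (Z1 N w - Z2 N w) ^+ 2)) <= slack R N.
    by move=> ZZ; rewrite ler_sqrt ?invr_ge0//; exact: l2_le ZZ N.
  have sl1 : slack R N <= 1 by rewrite -[leRHS]sqrtr1 ler_sqrt// invf_le1 ?ler1n.
  have E1 := Ex_mul_sqrt dX dY; have E2 := Ex_mul_sqrt dX Gi; have E3 := Ex_mul_sqrt Fi dY.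
  rewrite (le_trans (ler_normD _ _))// /b mulrDr mulrDr mulr1 -addrA lerD//.
    rewrite (le_trans E1)// -[leRHS]mulr1 ler_pM ?sqrtr_ge0 ?sl//.
    by rewrite (le_trans _ sl1)// sl.
  rewrite (le_trans (ler_normD _ _))// [leLHS]addrC lerD//.
    rewrite (le_trans E3)// mulrC ler_pM ?sqrtr_ge0 ?sl// ler_sqrt//.
    by rewrite (le_trans _ FSN)// Ex_sqr_ge0.
  rewrite (le_trans E2)// ler_pM ?sqrtr_ge0 ?sl// ler_sqrt//.
  by rewrite (le_trans _ GSN)// Ex_sqr_ge0.
apply/cvgrPdist_le => t t0; have t2 : 0 < t / 2 by rewrite divr_gt0.
have /cvgrPdist_le /(_ _ t2) H1 := XYr; have /cvgrPdist_le /(_ _ t2) H2 := b0.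
near=> N.
have : `|r - Ex P (fun w => X N w * Y N w)| <= t / 2 by near: N.
have : `|0 - b N| <= t / 2 by near: N.
have : `|Ex P (fun w => F N w * G N w) - Ex P (fun w => X N w * Y N w)| <= b N by near: N.
rewrite sub0r normrN !ler_distl [`|b N| <= _]ler_norml.
by move=> /andP[? ?] /andP[? ?] /andP[? ?]; apply/andP; split; lra.
Unshelve. all: by end_near. Qed.

Lemma chaos_pair_bounded : exists S : R,
  \forall N \near \oo, Ex P (fun w => X N w ^+ 2) <= S /\ Ex P (fun w => Y N w ^+ 2) <= S.
Proof.
have [_ _ [S FS]] := excess_F; have [S' GS] := bounded_G.
exists (2 * Num.max S S' + 2); near=> N.
have FSN : Ex P (fun w => F N w ^+ 2) <= S by near: N.
have GSN : Ex P (fun w => G N w ^+ 2) <= S' by near: N.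
split; [rewrite (le_trans (Ex_sqr_l2 N XF))//|rewrite (le_trans (Ex_sqr_l2 N YG))//];
  rewrite lerD2r ler_pM2l// le_max ?FSN ?GSN ?orbT//.
Unshelve. all: by end_near. Qed.

Lemma chaos_pair_limit u t :
  (Ex P (fun w => cos (u * X N w + (Y N w + t))) -
   Ex P (fun w => cos (Y N w + t)) * expR (- (u ^+ 2 * s / 2 + u * r))) @[N --> \oo] --> (0 : R).
Proof.
have [Fs Fk [S FS]] := excess_F; have [S' GS] := bounded_G.
have sc (k : R) : {for k, continuous (@Num.sqrt R)} by exact: sqrt_continuous.
pose sF N := Ex P (fun w => F N w ^+ 2); pose rF N := Ex P (fun w => F N w * G N w).
(* The excess of [G] need not vanish; it has to stay bounded, since it multiplies that of [F]. *)
have G4 : \forall N \near \oo, `|excess P (G N)| <= 4 * ((1 + B) * S' ^+ 2 + S' ^+ 2).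
  apply: filterS GS => N GS; have s0 := Ex_sqr_ge0 P (G N).
  have := Ex4_le (Gm N) B0 (cp_hyp2 (FG N)).
  have : 0 <= Ex P (fun w => G N w ^+ 4) by apply: Ex_ge0 => w; rewrite (exprM _ 2 2) sqr_ge0.
  rewrite /excess ler_norml; set q := Ex P (fun w => G N w ^+ 4); set g := Ex P (fun w => G N w ^+ 2) in GS s0 *.
  have g2 : g ^+ 2 <= S' ^+ 2 by rewrite lerXn2r ?nnegrE// (le_trans s0).
  have := ler_wpM2l (_ : 0 <= 1 + B) g2; rewrite addr_ge0// => /(_ isT).
  have := sqr_ge0 g; nra.
have ex0 : Num.sqrt (C * Num.sqrt (excess P (F N) * excess P (G N))) @[N --> \oo] --> (0 : R).
  rewrite -sqrtr0; apply: (continuous_cvg _ (sc 0)); rewrite -(mulr0 C).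
  apply: cvgM; first exact: cvg_cst.
  rewrite -[X in _ --> X]sqrtr0; apply: (continuous_cvg _ (sc 0)).
  pose K := 4 * ((1 + B) * S' ^+ 2 + S' ^+ 2).
  apply/norm_cvg0P; apply: (@squeeze_cvgr _ _ _ _ (fun=> 0) (fun N => `|excess P (F N)| * K)).
  - near=> N; rewrite normr_ge0 normrM ler_wpM2l//; near: N; exact: G4.
  - exact: cvg_cst.
  - by rewrite -(mul0r K); apply: cvgM; [rewrite -(@normr0 _ R); exact: cvg_norm|exact: cvg_cst].
pose bd N := `|u| * (`|u| * Num.sqrt (C * excess P (F N)) +
    Num.sqrt (C * Num.sqrt (excess P (F N) * excess P (G N)))) *
    expR (u ^+ 2 * sF N / 2 + 2 * (`|u| * `|rF N|)).
have bd0 : bd N @[N --> \oo] --> (0 : R).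
  rewrite -(mul0r (expR (u ^+ 2 * s / 2 + 2 * (`|u| * `|r|)))); apply: cvgM.
    rewrite -(mulr0 `|u|); apply: cvgM; first exact: cvg_cst.
    rewrite -(addr0 (0 : R)); apply: cvgD => //; rewrite -[X in _ --> X](mulr0 `|u|).
    apply: cvgM; first exact: cvg_cst.
    rewrite -sqrtr0; apply: (continuous_cvg _ (sc 0)); rewrite -(mulr0 C).
    by apply: cvgM; [exact: cvg_cst|].
  apply: (continuous_cvg _ (@continuous_expR R _)); apply: cvgD.
    by apply: cvgM; [apply: cvgM; [exact: cvg_cst|]|exact: cvg_cst].
  apply: cvgM; first exact: cvg_cst.
  by apply: cvgM; [exact: cvg_cst|apply: cvg_norm; exact: cvg_Ex_FG].
pose e N := expR (- (u ^+ 2 * sF N / 2 + u * rF N)).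
pose e1 := expR (- (u ^+ 2 * s / 2 + u * r)).
have ee : (e N - e1) @[N --> \oo] --> (0 : R).
  rewrite -(subrr e1); apply: cvgB; last exact: cvg_cst.
  apply: (continuous_cvg _ (@continuous_expR R _)); apply: cvgN; apply: cvgD.
    by apply: cvgM; [apply: cvgM; [exact: cvg_cst|]|exact: cvg_cst].
  by apply: cvgM; [exact: cvg_cst|exact: cvg_Ex_FG].
have e10 : 0 <= e1 by exact: expR_ge0.
have lip x y : `|cos x - cos y| <= 1 * `|x - y| :> R by rewrite mul1r; exact: le_norm_sub_cos.
(* The costs of passing from [X], [Y] to [F], [G], of the approximate equation, of replacing the
   moments by their limits, and of returning from [G] to [Y]. *)
pose b N := `|u| * slack R N + slack R N + bd N + `|e N - e1| + slack R N * e1.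
have b0 : b N @[N --> \oo] --> (0 : R).
  suff : b N @[N --> \oo] --> `|u| * 0 + 0 + 0 + `|0 : R| + 0 * e1 by rewrite normr0 mulr0 mul0r !addr0.
  apply: cvgD; last by apply: cvgM; [exact: cvg_slack|exact: cvg_cst].
  apply: cvgD; last exact: cvg_norm.
  apply: cvgD => //; apply: cvgD; last exact: cvg_slack.
  by apply: cvgM; [exact: cvg_cst|exact: cvg_slack].
apply/norm_cvg0P; apply: (squeeze_cvgr _ (cvg_cst 0) b0); near=> N; rewrite normr_ge0/=.
have mXN := l2_measurable XF N; have mYN := l2_measurable YG N.
have mFN := mom_measurable (Fm N); have mGN := mom_measurable (Gm N).
have cm (h : T -> R) : measurable_fun setT h -> intg P (fun w => cos (h w)).
  by move=> mh; exact: mom_intg (mom_cos P mh).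
have m1 : measurable_fun setT (fun w => u * X N w + (Y N w + t)).
  by apply: measurable_funD; [exact: measurable_funM|exact: measurable_funD].
have m2 : measurable_fun setT (fun w => u * F N w + (G N w + t)).
  by apply: measurable_funD; [exact: measurable_funM|exact: measurable_funD].
have m3 : measurable_fun setT (fun w => Y N w + t) by exact: measurable_funD.
have m4 : measurable_fun setT (fun w => G N w + t) by exact: measurable_funD.
have iX := intg_norm (sqintg_intg (l2_intg XF N)); have iY := intg_norm (sqintg_intg (l2_intg YG N)).
have D1 : `|Ex P (fun w => cos (u * X N w + (Y N w + t))) -
    Ex P (fun w => cos (u * F N w + (G N w + t)))| <= `|u| * slack R N + slack R N.
  rewrite -ExB; [|exact: cm|exact: cm].
  apply: (@le_trans _ _ (Ex P (fun w => `|u| * `|X N w - F N w| + `|Y N w - G N w|))).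
    apply: Ex_norm_le => [||w]; first by apply: intgB; exact: cm.
      by apply: intgD => //; exact: intgZ.
    rewrite (le_trans (le_norm_sub_cos _ _))//.
    rewrite (_ : _ - _ = u * (X N w - F N w) + (Y N w - G N w)); last by ring.
    by rewrite (le_trans (ler_normD _ _))// normrM.
  rewrite ExD//; last exact: intgZ.
  by rewrite ExZ// lerD ?ler_wpM2l// Ex_norm_l2.
have D2 := chaos_pair_charfun u t (FG N) erefl erefl; rewrite -/(sF N) -/(rF N) -/(bd N) -/(e N) in D2.
have D3 : `|Ex P (fun w => cos (G N w + t)) - Ex P (fun w => cos (Y N w + t))| <= slack R N.
  rewrite distrC -ExB; [|exact: cm|exact: cm].
  apply: (@le_trans _ _ (Ex P (fun w => `|Y N w - G N w|))); last exact: Ex_norm_l2.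
  apply: Ex_norm_le => // [|w]; first by apply: intgB; exact: cm.
  rewrite (le_trans (le_norm_sub_cos _ _))//.
  by rewrite (_ : _ - _ = Y N w - G N w)//; ring.
have c1 : `|Ex P (fun w => cos (G N w + t))| <= 1.
  rewrite -[leRHS](Ex_cst P) Ex_norm_le//; [exact: cm|exact: intg_cst|move=> w].
  by rewrite ler_norml cos_geN1 cos_le1.
rewrite -/e1 [X in `|X|](_ : _ =
  (Ex P (fun w => cos (u * X N w + (Y N w + t))) - Ex P (fun w => cos (u * F N w + (G N w + t)))) +
  (Ex P (fun w => cos (u * F N w + (G N w + t))) - Ex P (fun w => cos (G N w + t)) * e N) +
  Ex P (fun w => cos (G N w + t)) * (e N - e1) +
  (Ex P (fun w => cos (G N w + t)) - Ex P (fun w => cos (Y N w + t))) * e1); last by ring.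
rewrite (le_trans (ler_normD _ _))// lerD//; last first.
  by rewrite normrM (ger0_norm e10) ler_wpM2r.
rewrite (le_trans (ler_normD _ _))// lerD//; last by rewrite normrM ler_piMl.
by rewrite (le_trans (ler_normD _ _))// lerD.
Unshelve. all: by end_near. Qed.

End chaos_pair_limit.

(** * Multiple integrals as Hermite sums *)

(** Ryser's formula for the permanent. Expanding the products gives a sum over all maps [f]; the
    signed sum over the sets [A] that contain its image is [1] if [f] is onto and [0] otherwise, and
    onto means injective here. *)
Lemma ryser (R : comPzRingType) n (M : 'I_n -> 'I_n -> R) :
  \sum_(s : 'S_n) \prod_i M i (s i) =
  \sum_(A : {set 'I_n}) \prod_j (if j \in A then 1 else -1) * \prod_i \sum_(j in A) M i j.
Proof.
pose F := {ffun 'I_n -> 'I_n}.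
have sgnE (f : F) : \sum_(A : {set 'I_n}) \prod_j (if j \in A then 1 else -1) * \prod_i (f i \in A)%:R =
    (injectiveb f)%:R :> R.
  (* Each [j] outside the image of [f] contributes the factor [1 - 1]. *)
  transitivity (\prod_j (1 + - (j \notin codom f)%:R : R)).
    rewrite bigA_distr; apply: eq_bigr => A _; have [/forallP fA|] := boolP [forall i, f i \in A].
      rewrite [X in _ * X]big1 ?mulr1 => [|i _]; last by rewrite fA.
      apply: eq_bigr => j _; case: ifPn => // jA; rewrite (_ : j \notin codom f)//.
      by apply: contra jA => /codomP[i ->].
    rewrite negb_forall => /existsP[i fiA].
    rewrite [X in _ * X](bigD1 i)//= (negbTE fiA) mul0r mulr0 (bigD1 (f i))//= (negbTE fiA).
    by rewrite codom_f oppr0 mul0r.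
  have [/injectiveP finj|fNinj] := boolP (injectiveb f).
    by rewrite big1// => j _; rewrite injF_onto// oppr0 addr0.
  have [j jf] : exists j, j \notin codom f.
    apply/existsP; apply: contraNT fNinj; rewrite negb_exists => /forallP fs.
    apply/injectiveP => x y; have := @image_injP _ _ f predT; rewrite -/(codom f).
    have -> : #|codom f| == #|'I_n|.
      by apply/eqP; apply: eq_card => j; rewrite inE; have := fs j; rewrite negbK.
    by move=> H; have /(_ x y isT isT) := elimT H isT.
  by rewrite (bigD1 j)//= jf subrr mul0r.
under [RHS]eq_bigr => A _.
  have -> : \prod_i \sum_(j in A) M i j = \sum_(f : F) (\prod_i (f i \in A)%:R) * \prod_i M i (f i).
    under eq_bigr do rewrite big_mkcond.
    rewrite bigA_distr_bigA; apply: eq_bigr => f _; rewrite -big_split; apply: eq_bigr => i _ /=.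
    by case: ifP; rewrite ?mul1r ?mul0r.
  rewrite mulr_sumr; over.
rewrite exchange_big/= [RHS](eq_bigr (fun f : F => (injectiveb f)%:R * \prod_i M i (f i))); last first.
  by move=> f _; rewrite -sgnE mulr_suml; apply: eq_bigr => A _; rewrite mulrA.
rewrite [RHS](bigID (fun f : F => injectiveb f))/= [X in _ + X]big1 ?addr0; last first.
  by move=> f /negbTE->; rewrite mul0r.
rewrite (reindex (@pval _)) /=; last first.
  pose in_Sn := insubd (1%g : 'S_n).
  by exists in_Sn => /= f Uf; first apply: val_inj; exact: insubdK.
by apply: eq_big => /= [s|s _]; rewrite ?(valP s)// mul1r pvalE.
Qed.

Section inner_product.
Context (R : realType) (H : hilbertType R).
Implicit Types x y z : H.

Lemma ip0l z : ip 0 z = 0.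
Proof.
have := ip_linear 1 0 0 z; rewrite scaler0 addr0 mul1r => /eqP.
by rewrite -subr_eq0 opprD addNKr oppr_eq0 => /eqP.
Qed.

Lemma ipDl x y z : ip (x + y) z = ip x z + ip y z.
Proof. by have := ip_linear 1 x y z; rewrite scale1r mul1r. Qed.

Lemma ipZl a x z : ip (a *: x) z = a * ip x z.
Proof. by have := ip_linear a x 0 z; rewrite !addr0 ip0l addr0. Qed.

Lemma ip_suml (J : Type) (s : seq J) (P : pred J) (F : J -> H) z :
  ip (\sum_(j <- s | P j) F j) z = \sum_(j <- s | P j) ip (F j) z.
Proof. by apply: (big_morph (fun x => ip x z)); [move=> x y; exact: ipDl|exact: ip0l]. Qed.

Lemma ip_sqr_sub x y : `|x - y| ^+ 2 = `|x| ^+ 2 - 2 * ip x y + `|y| ^+ 2.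
Proof.
rewrite -!ip_norm -scaleN1r !ipDl !ipZl ![ip _ (_ + _)]ipC !ipDl !ipZl (ipC y x); ring.
Qed.

End inner_product.

Section symmetric_tensors.
Context (R : realType) (H : hilbertType R) (p : nat) (K : tensor_power H p).
Implicit Types (f g x : K) (h : 'I_p -> H).

Local Notation pow v := (tens K (fun=> v)).

Lemma tens_approx f (e : R) : 0 < e ->
  exists (s : seq (R * ('I_p -> H))), `|f - \sum_(y <- s) y.1 *: tens K y.2| < e.
Proof.
move=> e0; have [|_ [/interior_subset] /[swap] [[m [c [h ->]]]]] :=
    @tens_dense _ _ _ K ((ball f e)°) _ (open_interior _).
  by exists f; exact: nbhsx_ballx.
rewrite -ball_normE/= => B; exists [seq (c k, h k) | k <- enum 'I_m].
by rewrite big_map big_enum.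
Qed.

(** [f - g] is orthogonal to the dense span of the pure tensors, hence no closer to it than to
    [0]. *)
Lemma tens_ext f g : (forall h, ip f (tens K h) = ip g (tens K h)) -> f = g.
Proof.
move=> fg; apply/eqP; rewrite -subr_eq0 -normr_le0; apply/ler_addgt0Pr => e e0; rewrite add0r.
have [s /ltW se] := tens_approx (f - g) e0; apply: le_trans se.
rewrite -(ler_pXn2r (_ : (0 < 2)%N)) ?nnegrE// [leRHS]ip_sqr_sub.
have -> : ip (f - g) (\sum_(y <- s) y.1 *: tens K y.2) = 0.
  rewrite ipC ip_suml big1// => y _; rewrite ipZl ipC -scaleN1r ipDl ipZl fg.
  by rewrite mulN1r subrr mulr0.
by rewrite mulr0 subr0 lerDl sqr_ge0.
Qed.

Lemma symmetric_comb a f g : symmetric_tensor f -> symmetric_tensor g -> symmetric_tensor (a *: f + g).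
Proof. by move=> fs gs s h; rewrite !ip_linear fs gs. Qed.

Lemma symmetric_pow v : symmetric_tensor (pow v).
Proof. by move=> s h; rewrite !tens_ip [RHS](reindex_inj (@perm_inj _ s)). Qed.

Lemma symmetric_pow_sum (s : seq (R * H)) : symmetric_tensor (\sum_(y <- s) y.1 *: pow y.2).
Proof.
elim: s => [|y s IH]; first by move=> s h; rewrite big_nil !ip0l.
by rewrite big_cons; exact: symmetric_comb (symmetric_pow _) IH.
Qed.

Lemma pow_scale a v : pow (a *: v) = a ^+ p *: pow v.
Proof.
apply: tens_ext => h; rewrite ipZl !tens_ip; under eq_bigr do rewrite ipZl.
by rewrite big_split/= prodr_const card_ord.
Qed.

(** Polarization. Tested against a pure tensor, the two sides are the permanent of the matrix
    [ip (h j) (g i)] and its expansion by [ryser]. *)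
Lemma tens_symmetrization h : \sum_(s : 'S_p) tens K (h \o s) =
  \sum_(A : {set 'I_p}) \prod_j (if j \in A then 1 else -1) *: pow (\sum_(j in A) h j).
Proof.
apply: tens_ext => g; rewrite !ip_suml.
under eq_bigr do rewrite tens_ip; under [RHS]eq_bigr do rewrite ipZl tens_ip.
rewrite (ryser (fun i j => ip (h j) (g i))); apply: eq_bigr => A _; congr (_ * _).
by apply: eq_bigr => i _; rewrite ip_suml.
Qed.

Definition unit_span x := exists s : seq (R * H),
  (forall y, y \in s -> `|y.2| = 1) /\ x = \sum_(y <- s) y.1 *: pow y.2.

Lemma unit_span_comb a x y : unit_span x -> unit_span y -> unit_span (a *: x + y).
Proof.
move=> [s [s1 ->]] [t [t1 ->]]; exists ([seq (a * z.1, z.2) | z <- s] ++ t); split.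
  move=> z; rewrite mem_cat => /orP[/mapP[z' /s1 z1 ->]//|]; exact: t1.
by rewrite big_cat big_map scaler_sumr; congr (_ + _); apply: eq_bigr => z _; rewrite scalerA.
Qed.

Lemma unit_span0 : unit_span 0.
Proof. by exists [::]; split=> //; rewrite big_nil. Qed.

Lemma unit_span_sum (J : Type) (s : seq J) (a : J -> R) (F : J -> K) :
  (forall j, unit_span (F j)) -> unit_span (\sum_(j <- s) a j *: F j).
Proof.
move=> Fs; elim: s => [|j s IH]; first by rewrite big_nil; exact: unit_span0.
by rewrite big_cons; exact: unit_span_comb.
Qed.

(** The zero vector cannot be normalized; its power vanishes because [p > 0]. *)
Lemma unit_span_pow v : (0 < p)%N -> unit_span (pow v).
Proof.
move=> p0; have [->|v0] := eqVneq v 0.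
  by rewrite -(scale0r (0 : H)) pow_scale expr0n eqn0Ngt p0 scale0r; exact: unit_span0.
rewrite -[v]scale1r -(divff (_ : `|v| != 0)) ?normr_eq0// -scalerA pow_scale.
rewrite -[_ *: _]addr0; apply: unit_span_comb; last exact: unit_span0.
exists [:: (1, `|v|^-1 *: v)]; split; last by rewrite big_seq1 scale1r.
move=> y; rewrite inE => /eqP-> /=.
by rewrite normrZ ger0_norm ?invr_ge0// mulVf// normr_eq0.
Qed.

(** Permuting the factors of an approximant does not change its distance to a symmetric [f], so the
    average over all permutations is as close; by polarization this average is a combination of
    powers. *)
Lemma symmetric_approx f (e : R) : (0 < p)%N -> symmetric_tensor f -> 0 < e ->
  exists2 x, unit_span x & `|f - x| < e.
Proof.
move=> p0 fs e0; have [s se] := tens_approx f e0.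
pose U (t : 'S_p) : K := \sum_(y <- s) y.1 *: tens K (y.2 \o t).
have fU t : `|f - U t| = `|f - U 1%g|.
  apply/eqP; rewrite -(eqrXn2 (_ : (0 < 2)%N))//; apply/eqP; rewrite !ip_sqr_sub.
  have -> : ip f (U t) = ip f (U 1%g).
    rewrite ipC [RHS]ipC !ip_suml; apply: eq_bigr => y _; rewrite !ipZl; congr (_ * _).
    by rewrite ipC [RHS]ipC fs fs.
  congr (_ + _); rewrite -!ip_norm !ip_suml; apply: eq_bigr => y _; rewrite !ipZl; congr (_ * _).
  rewrite ipC [RHS]ipC !ip_suml; apply: eq_bigr => z _; rewrite !ipZl; congr (_ * _).
  rewrite !tens_ip (reindex_inj (@perm_inj _ t^-1%g))/=.
  by apply: eq_bigr => i _; rewrite permKV perm1.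
have U1 : U 1%g = \sum_(y <- s) y.1 *: tens K y.2.
  by apply: eq_bigr => y _; congr (_ *: tens K _); apply/funext => i /=; rewrite perm1.
pose q : R := #|'S_p|%:R; have q0 : 0 < q by rewrite ltr0n; apply/card_gt0P; exists 1%g.
exists (q^-1 *: \sum_t U t).
  have -> : \sum_t U t = \sum_(y <- s) y.1 *: \sum_(t : 'S_p) tens K (y.2 \o t).
    by rewrite exchange_big/=; apply: eq_bigr => y _; rewrite scaler_sumr.
  rewrite -[_ *: _]addr0; apply: unit_span_comb; last exact: unit_span0.
  apply: unit_span_sum => y; rewrite tens_symmetrization; apply: unit_span_sum => A.
  exact: unit_span_pow.
have -> : f - q^-1 *: \sum_t U t = q^-1 *: \sum_t (f - U t).
  rewrite sumrB scalerBr sumr_const -[f *+ _]scaler_nat scalerA mulVf ?scale1r//.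
  by rewrite lt0r_neq0.
rewrite normrZ ger0_norm ?invr_ge0 ?ltW// ltr_pdivrMl//.
rewrite (le_lt_trans (ler_norm_sum _ _ _))//.
under eq_bigr do rewrite fU.
by rewrite sumr_const -mulr_natl ltr_pM2l// U1.
Qed.

End symmetric_tensors.

Section multiple_integrals.
Context (R : realType) d (T : measurableType d) (P : probability T R).
Context (H : hilbertType R) (W : H -> {RV P >-> R}) (HW : isonormal W).
Context (p : nat) (K : tensor_power H p) (I : K -> {RV P >-> R}).
Hypothesis HI : multiple_integral W I.
Implicit Types (f g x : K) (s t : seq (R * H)).

Local Notation pow v := (tens K (fun=> v)).
Let mI f : measurable_fun setT (I f). Proof. exact: measurable_funPT. Qed.

Definition power_sum s : K := \sum_(y <- s) y.1 *: pow y.2.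

Definition hermite_sum s w : R := \sum_(y <- s) y.1 * herm p (W y.2 w).

Lemma symmetric0 : symmetric_tensor (0 : K).
Proof. by move=> s h; rewrite !ip0l. Qed.

Lemma mi0 : {ae P, forall w, I 0 w = 0}.
Proof.
have := mi_linear HI 1 symmetric0 symmetric0; rewrite scaler0 addr0.
by apply: filterS => w; rewrite mul1r => /eqP; rewrite -subr_eq0 opprD addNKr oppr_eq0 => /eqP.
Qed.

Lemma mi_power_sum s : (forall y, y \in s -> `|y.2| = 1) ->
  {ae P, forall w, I (power_sum s) w = hermite_sum s w}.
Proof.
rewrite /power_sum; elim: s => [|y s IH] s1.
  by rewrite big_nil; apply: filterS mi0 => w ->; rewrite /hermite_sum big_nil.
have {}IH := IH (fun z zs => s1 z (@mem_behead _ (y :: s) z zs)).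
have y1 := mi_hermite HI (s1 y (mem_head y s)).
rewrite big_cons; apply: filterS3 (mi_linear HI y.1 (symmetric_pow K y.2) (symmetric_pow_sum K s)) IH y1.
by move=> w -> -> ->; rewrite /hermite_sum big_cons.
Qed.

Lemma mi_sqintg f : symmetric_tensor f -> sqintg P (I f) /\ Ex P (fun w => I f w ^+ 2) = p`!%:R * `|f| ^+ 2.
Proof.
move=> fs; have E := mi_isometry HI fs fs.
have E2 : 'E_P[fun w => I f w ^+ 2] = (p`!%:R * `|f| ^+ 2)%:E.
  by rewrite -ip_norm -E; congr expectation; apply/funext => w; rewrite expr2.
split; last by rewrite ExE E2.
split=> //; apply/integrableP; split; first by apply/measurable_EFinP; exact: measurable_funX.
(* That the expectation is a real number rules out an infinite integral of the square. *)
move: E2; rewrite unlock; under eq_integral do rewrite /= -[X in X%:E]ger0_norm ?sqr_ge0//.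
by move=> ->; rewrite ltry.
Qed.

Lemma mom_hermite_sum s : mom P (hermite_sum s).
Proof.
apply: mom_sum => y; apply: momZ.
have GF := isonormal_family (fun _ : 'I_1 => y.2) HW.
by have [] := wder_mom GF (wder_herm (fun=> W y.2 : T -> R) _ ord0 p ord0).
Qed.

Lemma mi_hermite_sum_dist (X : T -> R) f s : symmetric_tensor f -> measurable_fun setT X ->
  {ae P, forall w, X w = I f w} -> (forall y, y \in s -> `|y.2| = 1) ->
  sqintg P (fun w => X w - hermite_sum s w) /\
  Ex P (fun w => (X w - hermite_sum s w) ^+ 2) = p`!%:R * `|f - power_sum s| ^+ 2.
Proof.
move=> fs mX Xf s1; have ss := symmetric_pow_sum K s.
have gs := symmetric_comb (-1) ss fs.
have [[mg gi] gE] := mi_sqintg gs.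
have mhs := mom_measurable (mom_hermite_sum s).
have ae : {ae P, forall w, X w - hermite_sum s w = I (-1 *: power_sum s + f) w}.
  apply: filterS3 (mi_linear HI (-1) ss fs) (mi_power_sum s1) Xf => w ->.
  by rewrite -/(power_sum s) => -> ->; rewrite mulN1r addrC.
have m2 : measurable_fun setT (fun w => (X w - hermite_sum s w) ^+ 2).
  by apply: measurable_funX; exact: measurable_funB.
have ae2 : {ae P, forall w, (X w - hermite_sum s w) ^+ 2 = I (-1 *: power_sum s + f) w ^+ 2}.
  by apply: filterS ae => w ->.
split.
  split; first exact: measurable_funB.
  by apply: ae_eq_intg ae2 gi.
rewrite (ae_eq_Ex _ _ ae2)// ?gE; last exact: measurable_funX.
by rewrite scaleN1r addrC.
Qed.

Lemma chaos_pair_hermite_sum s t : (1 < p)%N -> (forall y, y \in s -> `|y.2| = 1) ->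
  (forall y, y \in t -> `|y.2| = 1) ->
  chaos_pair P (125 ^+ p) (carre_const R p) (hermite_sum s) (hermite_sum t).
Proof.
move=> p1 s1 t1.
(* Both sums are written over one list of vectors, padded with zero coefficients. *)
pose u := [seq (y.1, 0 : R, y.2) | y <- s] ++ [seq (0 : R, y.1, y.2) | y <- t].
pose y k := tnth (in_tuple u) k.
have y1 k : `|(y k).2| = 1.
  have := mem_tnth k (in_tuple u); rewrite -/(y k) /u /= mem_cat.
  by move=> /orP[] /mapP[z zs ->] /=; [exact: s1|exact: t1].
have GF := isonormal_family (fun k => (y k).2) HW.
have := chaos_chaos_pair (fun k => (y k).1.1) (fun k => (y k).1.2) GF _ p1.
have -> : chaos (fun k => W (y k).2 : T -> R) p (fun k => (y k).1.1) = hermite_sum s.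
  apply/funext => w; rewrite /chaos /y -(big_tnth _ _ u xpredT (fun z => z.1.1 * herm p (W z.2 w))).
  rewrite big_cat !big_map/= [X in _ + X]big1 ?addr0// => z _; exact: mul0r.
have -> : chaos (fun k => W (y k).2 : T -> R) p (fun k => (y k).1.2) = hermite_sum t.
  apply/funext => w; rewrite /chaos /y -(big_tnth _ _ u xpredT (fun z => z.1.2 * herm p (W z.2 w))).
  rewrite big_cat !big_map/= [X in X + _]big1 ?add0r// => z _; exact: mul0r.
by apply=> k; rewrite ip_norm y1 expr1n.
Qed.

Lemma hermite_sum_approx (X : nat -> T -> R) (f : nat -> K) : (0 < p)%N ->
  (forall N, symmetric_tensor (f N)) -> (forall N, measurable_fun setT (X N)) ->
  (forall N, {ae P, forall w, X N w = I (f N) w}) ->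
  exists2 s : nat -> seq (R * H), (forall N y, y \in s N -> `|y.2| = 1) &
    l2_close P X (fun N => hermite_sum (s N)).
Proof.
move=> p0 fs mX Xf.
have E N : exists s, (forall y, y \in s -> `|y.2| = 1) /\
    p`!%:R * `|f N - power_sum s| ^+ 2 <= N.+1%:R^-1.
  pose e : R := N.+1%:R^-1 / p`!%:R.
  have f0 : 0 < p`!%:R :> R by rewrite ltr0n fact_gt0.
  have e0 : 0 < e by rewrite divr_gt0// invr_gt0 ltr0n.
  (* Below [1] the squared distance is at most the distance. *)
  have m0 : 0 < Num.min 1 e by rewrite lt_min ltr01.
  have [_ [s [s1 ->]] /ltW fx] := symmetric_approx p0 (fs N) m0.
  exists s; split=> //; rewrite -/(power_sum s) in fx *.
  rewrite -ler_pdivlMl// mulrC -/e (@le_trans _ _ `|f N - power_sum s|)//.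
    by rewrite expr2 ler_piMr// (le_trans fx)// ge_min lexx.
  by rewrite (le_trans fx)// ge_min lexx orbT.
have [s sP] := choice E; exists s; first by move=> N; exact: (sP N).1.
split=> // N; first exact: mom_hermite_sum.
  exact: (mi_hermite_sum_dist (fs N) (mX N) (Xf N) (sP N).1).1.
by rewrite (mi_hermite_sum_dist (fs N) (mX N) (Xf N) (sP N).1).2 (sP N).2.
Qed.

Lemma wiener_chaos_comb n (c : 'I_n -> R) (Y : 'I_n -> {RV P >-> R}) :
  (forall j, wiener_chaos I (Y j)) ->
  exists2 f : K, symmetric_tensor f & {ae P, forall w, \sum_j c j * Y j w = I f w}.
Proof.
move=> YI.
have E j : exists f : K, symmetric_tensor f /\ {ae P, forall w, Y j w = I f w}.
  by have [f fs Yf] := YI j; exists f.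
have [g gs] := choice E.
suff [f [fs fI]] : exists f, symmetric_tensor f /\
    {ae P, forall w, \sum_(j <- index_enum 'I_n) c j * Y j w = I f w} by exists f.
elim: (index_enum _) => [|j l [f [fs fI]]].
  exists 0; split; first exact: symmetric0.
  by apply: filterS mi0 => w ->; rewrite big_nil.
exists (c j *: g j + f); split; first exact: symmetric_comb (gs j).1 fs.
apply: filterS3 (mi_linear HI (c j) (gs j).1 fs) fI (gs j).2 => w -> <- <-.
by rewrite big_cons.
Qed.

End multiple_integrals.

(** * Realization of the limit law *)

(** Compactness of [[-M, M]] gives a cluster point, and an ultrafilter converges to its cluster
    points. *)
Lemma ultra_bounded_cvg (R : realType) (T : Type) (G : set_system T) (u : T -> R) (M : R) :
  UltraFilter G -> (forall x, `|u x| <= M) -> exists l : R, u x @[x --> G] --> l.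
Proof.
move=> GU uM; have [|l [_ lc]] := @segment_compact R (- M) M (u x @[x --> G]) _.
  by apply: (@filterE _ G) => x; rewrite /= in_itv/= -ler_norml; exact: uM.
exists l => B lB; have [//|nB] := in_ultra_setVsetC (u @^-1` B) GU.
by have [x [/= nBx Bx]] := lc (~` B) B nB lB.
Qed.

Section bit_prefixes.
Context (R : realType) d (T : measurableType d) (P : probability T R).
Implicit Types (b : nat -> T -> bool) (q g : seq bool -> R) (w : seq bool).

(* The latest bit comes first. *)
Fixpoint prefix b n t : seq bool := if n is m.+1 then b m t :: prefix b m t else [::].

Lemma size_prefix b n t : size (prefix b n t) = n.
Proof. by elim: n => //= n ->. Qed.

Lemma nth_prefix b n k t : (k < n)%N -> nth false (prefix b n t) (n - k.+1) = b k t.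
Proof.
elim: n => // n IH; rewrite ltnS leq_eqVlt => /predU1P[->|kn]; first by rewrite subnn.
by rewrite subSS -(subnSK kn)/= IH.
Qed.

(** When [q] is the law of the prefixes, this computes the expectation of [g] of the first bits;
    being a finite sum, it passes to limits of [q]. *)
Fixpoint tree_sum q g n w : R :=
  if n is m.+1 then tree_sum q g m (false :: w) + tree_sum q g m (true :: w) else g w * q w.

Lemma measurable_prefix b n g : (forall k, measurable_fun setT (b k)) ->
  measurable_fun setT (fun t => g (prefix b n t)).
Proof.
move=> mb; elim: n g => [|n IH] g; first exact: (measurable_cst (g [::])).
rewrite (_ : (fun _ => _) = fun t => if b n t then g (true :: prefix b n t) else g (false :: prefix b n t)).
  by apply: measurable_fun_ifT => //; [exact: (IH (fun w => g (true :: w)))|exact: (IH (fun w => g (false :: w)))].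
by apply/funext => t /=; case: (b n t).
Qed.

Definition prefix_law b w : R := Ex P (fun t => (prefix b (size w) t == w)%:R).

Lemma mom_prefix b n g : (forall k, measurable_fun setT (b k)) -> mom P (fun t => g (prefix b n t)).
Proof.
move=> mb; apply: (@mom_bounded _ _ _ P _ (\sum_(w : n.-tuple bool) `|g w|)).
  exact: measurable_prefix.
move=> t; have sp : size (prefix b n t) == n by rewrite size_prefix.
by rewrite (bigD1 (Tuple sp))//= lerDl sumr_ge0.
Qed.

Lemma prefix_law0 b : prefix_law b [::] = 1.
Proof. by rewrite /prefix_law /= -[RHS](Ex_cst P); apply: eq_Ex => t. Qed.

Lemma prefix_law_ge0 b w : 0 <= prefix_law b w.
Proof. by apply: Ex_ge0 => t. Qed.

Lemma prefix_law_le1 b w : (forall k, measurable_fun setT (b k)) -> prefix_law b w <= 1.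
Proof.
move=> mb; rewrite -[leRHS](Ex_cst P); apply: Ex_le.
- exact: mom_intg (mom_prefix _ (fun v => (v == w)%:R) mb).
- exact: intg_cst.
- by move=> t; rewrite lern1 leq_b1.
Qed.

Lemma prefix_lawS b w : (forall k, measurable_fun setT (b k)) ->
  prefix_law b w = prefix_law b (false :: w) + prefix_law b (true :: w).
Proof.
move=> mb; rewrite /prefix_law -ExD.
- by apply: eq_Ex => t /=; rewrite !eqseq_cons; case: (b _ t); rewrite ?add0r ?addr0.
- exact: mom_intg (mom_prefix (size w).+1 (fun v => (v == false :: w)%:R) mb).
- exact: mom_intg (mom_prefix (size w).+1 (fun v => (v == true :: w)%:R) mb).
Qed.

Lemma Ex_prefix b g n w : (forall k, measurable_fun setT (b k)) ->
  Ex P (fun t => (prefix b (size w) t == w)%:R * g (prefix b (n + size w) t)) =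
  tree_sum (prefix_law b) g n w.
Proof.
move=> mb; elim: n w => [|n IH] w /=.
  rewrite add0n -ExZ; last exact: mom_intg (mom_prefix _ (fun v => (v == w)%:R) mb).
  by apply: eq_Ex => t; case: eqP => [->|_]; rewrite ?mul0r ?mulr0// mulrC.
rewrite -!IH/= -ExD.
- apply: eq_Ex => t /=; rewrite !addnS/= !eqseq_cons -mulrDl; congr (_ * _).
  by case: (b (size w) t); rewrite ?add0r ?addr0.
- apply: mom_intg; apply: momM; first exact: (mom_prefix (size w).+1 (fun v => (v == false :: w)%:R) mb).
  exact: (mom_prefix _ g mb).
- apply: mom_intg; apply: momM; first exact: (mom_prefix (size w).+1 (fun v => (v == true :: w)%:R) mb).
  exact: (mom_prefix _ g mb).
Qed.

Lemma Ex_prefix0 b g n : (forall k, measurable_fun setT (b k)) ->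
  Ex P (fun t => g (prefix b n t)) = tree_sum (prefix_law b) g n [::].
Proof.
by move=> mb; rewrite -Ex_prefix//; apply: eq_Ex => t /=; rewrite mul1r addn0.
Qed.

End bit_prefixes.

Lemma cvg_tree_sum (R : realType) (T : Type) (G : set_system T) (q : T -> seq bool -> R) (l g : seq bool -> R) n w :
  Filter G -> (forall w, q x w @[x --> G] --> l w) ->
  tree_sum (q x) g n w @[x --> G] --> tree_sum l g n w.
Proof.
move=> FG ql; elim: n w => [|n IH] w /=; first by apply: cvgM => //; exact: cvg_cst.
by apply: cvgD; exact: IH.
Qed.

Section bit_realization.
Context (R : realType) (q : seq bool -> R).
Hypotheses (q0 : q [::] = 1) (q_ge0 : forall w, 0 <= q w).
Hypothesis qS : forall w, q w = q (false :: w) + q (true :: w).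

Let U : probability (measurableTypeR R) R := uniform_prob (@ltr01 R).

(* The bits of [t] start with [w] when [t] lies in [[left_end w, left_end w + q w[]. *)
Fixpoint left_end (w : seq bool) : R :=
  if w is b :: v then left_end v + (if b then q (false :: v) else 0) else 0.

Fixpoint rprefix n (t : R) : seq bool :=
  if n is m.+1 then let w := rprefix m t in (left_end w + q (false :: w) <= t) :: w else [::].

Definition rbit n (t : R) : bool := left_end (rprefix n t) + q (false :: rprefix n t) <= t.

Lemma prefix_rbit n t : prefix (rbit : nat -> measurableTypeR R -> bool) n t = rprefix n t.
Proof. by elim: n => //= n ->. Qed.

Lemma measurable_rbit n : @measurable_fun _ _ (measurableTypeR R) _ setT (rbit n).
Proof.
(* All functions of the prefix are treated at once, since the threshold for the next bit is one of
   them. *)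
suff H (g : seq bool -> R) : @measurable_fun _ _ (measurableTypeR R) R setT (fun t => g (rprefix n t)).
  by apply: measurable_fun_ler; [exact: (H (fun w => left_end w + q (false :: w)))|exact: measurable_id].
elim: n g => [|n IH] g; first exact: (measurable_cst (g [::])).
rewrite (_ : (fun _ => _) = fun t => if rbit n t then g (true :: rprefix n t) else g (false :: rprefix n t)).
  apply: measurable_fun_ifT; [|exact: (IH (fun w => g (true :: w)))|exact: (IH (fun w => g (false :: w)))].
  by apply: measurable_fun_ler; [exact: (IH (fun w => left_end w + q (false :: w)))|exact: measurable_id].
by apply/funext => t; rewrite /= -/(rbit n t); case: (rbit n t).
Qed.

Lemma left_end_ge0 w : 0 <= left_end w.
Proof. by elim: w => //= b w IH; rewrite addr_ge0//; case: b. Qed.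

Lemma right_end_le1 w : left_end w + q w <= 1.
Proof.
elim: w => [|b w IH] /=; first by rewrite add0r q0.
by apply: le_trans IH; have := qS w; have := q_ge0 (true :: w); case: b; lra.
Qed.

(** The interval of [w] is cut at [left_end w + q (false :: w)] into the intervals of its two
    extensions. *)
Lemma rprefixP w t : 0 <= t < 1 ->
  (rprefix (size w) t == w) = (left_end w <= t < left_end w + q w).
Proof.
move=> t01; elim: w => [|b w IH]; first by rewrite /= add0r q0 t01.
rewrite [LHS]/= eqseq_cons [left_end (b :: w)]/=.
have q1 := q_ge0 (false :: w); have q2 := q_ge0 (true :: w); have := qS w.
have [/eqP E qw|neq qw] := boolP (rprefix (size w) t == w).
  have /andP[tl tr] : left_end w <= t < left_end w + q w by rewrite -IH E.
  rewrite E andbT; case: b => /=.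
    by rewrite (_ : t < _) ?andbT ?eqb_id//; lra.
  by rewrite addr0 tl/= eqbF_neg -ltNge.
rewrite andbF; apply/esym/negbTE; apply: contra neq; rewrite IH.
by case: b => /andP[h1 h2]; apply/andP; split; lra.
Qed.

Lemma uniform_itv (a b : R) : 0 <= a -> a <= b -> b <= 1 -> (U `[a, b[%classic = (b - a)%:E)%E.
Proof.
move=> a0 ab b1; rewrite /U/= /uniform_prob integral_uniform_pdf.
have sub : `[a, b[ `<=` `[0 : R, 1].
  by move=> x /=; rewrite !in_itv/= => /andP[ax xb]; rewrite (le_trans a0 ax) (le_trans (ltW xb) b1).
rewrite setIidl//.
transitivity (\int[lebesgue_measure]_(x in `[a, b[) (cst 1%:E x : \bar R))%E.
  apply: eq_integral => x; rewrite inE => /sub/=; rewrite in_itv/= /uniform_pdf => ->.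
  by rewrite subr0 invr1.
rewrite integral_cst//= mul1e lebesgue_measure_itv/= lte_fin.
by case: ltP => // ba; rewrite (_ : b = a) ?subrr//; apply/le_anti; rewrite ab ba.
Qed.

Lemma prefix_law_rbit w : prefix_law U (rbit : nat -> measurableTypeR R -> bool) w = q w.
Proof.
pose A : set R := `[left_end w, left_end w + q w[%classic.
have mA : @measurable _ (measurableTypeR R) A by exact: measurable_itv.
have UA : U A = (q w)%:E.
  rewrite uniform_itv ?left_end_ge0 ?lerDl ?right_end_le1//.
  by congr EFin; rewrite addrC addKr.
have U1 : {ae U, forall t : measurableTypeR R, 0 <= t < 1}.
  exists (~` `[0 : R, 1[%classic); split.
  - by apply: measurableC; exact: measurable_itv.
  - rewrite probability_setC; last exact: measurable_itv.
    by rewrite uniform_itv// subr0 subee.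
  - by move=> t /= nt; rewrite in_itv/=.
rewrite /prefix_law (ae_eq_Ex (g := fun t : measurableTypeR R => \1_A t)).
- by rewrite /Ex /Rintegral integral_indic ?setIT//= UA.
- have := @measurable_prefix R _ (measurableTypeR R) rbit (size w) (fun v => (v == w)%:R).
  by apply => k; exact: measurable_rbit.
- exact: measurable_indic.
- apply: filterS U1 => t t01; rewrite prefix_rbit rprefixP// indicE /A mem_setE.
  by rewrite in_itv.
Qed.

End bit_realization.

Section almost_sure_limits.
Context (R : realType) d (T : measurableType d) (P : probability T R).

Lemma Ex_cvg_ae (f : nat -> T -> R) (g : T -> R) (M : R) :
  (forall k, measurable_fun setT (f k)) -> measurable_fun setT g ->
  (forall k w, `|f k w| <= M) -> {ae P, forall w, f k w @[k --> \oo] --> g w} ->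
  Ex P (f k) @[k --> \oo] --> Ex P g.
Proof.
move=> mf mg fM fg.
have [|||||gi _] := @dominated_convergence _ T R P setT measurableT
  (fun k => EFin \o f k) (EFin \o g) (fun=> M%:E).
- by move=> k; apply/measurable_EFinP.
- exact/measurable_EFinP.
- by apply: filterS fg => w fw _; apply: cvg_EFin => //; exact: nearW.
- exact: finite_measure_integrable_cst.
- by apply: aeW => w k _; rewrite /= lee_fin.
by rewrite /Ex /Rintegral => H; apply: fine_cvg; rewrite fineK//; exact: integrable_fin_num gi.
Qed.

(** The increments are summable in [L^1], so their series converges absolutely almost everywhere.
    Taking [Z] as an upper limit makes it measurable on the whole space. *)
Lemma ae_cvg_geometric (z : nat -> T -> R) (C : R) :
  (forall k, measurable_fun setT (z k)) ->
  (forall k, intg P (fun w => `|z k.+1 w - z k w|)) ->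
  (forall k, Ex P (fun w => `|z k.+1 w - z k w|) <= C / 2 ^+ k) ->
  exists2 Z : T -> R, measurable_fun setT Z & {ae P, forall w, z k w @[k --> \oo] --> Z w}.
Proof.
move=> mz zi zC.
have C0 : 0 <= C by have := zC 0%N; rewrite divr1; apply: le_trans; exact: Ex_ge0.
pose f k w : \bar R := `|z k.+1 w - z k w|%:E.
have f0 k w : (0 <= f k w)%E by rewrite lee_fin.
have mf k : measurable_fun setT (f k).
  by apply/measurable_EFinP; apply: measurableT_comp => //; exact: measurable_funB.
have sC k : \sum_(i < k) C / 2 ^+ i <= 2 * C.
  have -> : \sum_(i < k) C / 2 ^+ i = 2 * C - 2 * C / 2 ^+ k.
    elim: k => [|k IH]; first by rewrite big_ord0 divr1 subrr.
    by rewrite big_ord_recr/= IH exprS; field; rewrite expf_neq0.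
  by rewrite gerBl divr_ge0// ?exprn_ge0// mulr_ge0.
pose S w : \bar R := (\big[+%E/0]_(0 <= k <oo) f k w)%E.
have mS : measurable_fun setT S.
  by apply: (@ge0_emeasurable_sum _ _ _ setT f xpredT) => // k _; exact: mf.
have Si : P.-integrable setT S.
  apply/integrableP; split=> //.
  under eq_integral do rewrite gee0_abs ?nneseries_ge0//.
  rewrite integral_nneseries//; apply: (@le_lt_trans _ _ (2 * C)%:E); last exact: ltry.
  apply: lime_le; first by apply: is_cvg_nneseries => k _ _; exact: integral_ge0.
  apply: nearW => k; rewrite big_mkord (@le_trans _ _ (\sum_(i < k) (C / 2 ^+ i)%:E)%E)//.
    apply: lee_sum => i _; have := zC i; rewrite -lee_fin; congr (_ <= _)%E.
    by rewrite /Ex /Rintegral fineK//; apply: integrable_fin_num => //; exact: zi.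
  by rewrite sumEFin lee_fin.
pose Z w := fine (limn_esup (fun k => (z k w)%:E)).
exists Z.
  apply: (measurableT_comp (fine_measurable measurableT)).
  by apply: (@measurable_fun_limn_esup _ _ _ setT (fun k w => (z k w)%:E)) => k; exact/measurable_EFinP.
have := integrable_ae measurableT Si; apply: filterS => w /(_ Logic.I) Sw.
have cz : cvgn (fun k => z k w).
  pose u k := z k.+1 w - z k w.
  have cu : cvgn [normed series u].
    apply: nondecreasing_is_cvgn.
      by apply: nondecreasing_series => k _ _; exact: normr_ge0.
    exists (fine (S w)) => _ [k _ <-]; rewrite -lee_fin fineK//.
    apply: le_trans (nneseries_lim_ge k _); last by move=> *; exact: f0.
    by rewrite /series/= -sumEFin.
  have su k : series u k = z k w - z 0%N w by rewrite /series/= telescope_sumr.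
  have -> : (fun k => z k w) = (fun k => series u k + z 0%N w).
    by apply/funext => k; rewrite su subrK.
  by apply: is_cvgD; [exact: normed_cvg cu|exact: is_cvg_cst].
have ce : (z k w)%:E @[k --> \oo] --> (limn (fun k => z k w))%:E.
  by apply: cvg_EFin; [exact: nearW|exact: cz].
have -> : Z w = limn (fun k => z k w); last exact: cz.
by rewrite /Z is_cvg_limn_esupE ?(cvg_lim _ ce)//; apply/cvg_ex; eexists; exact: ce.
Qed.

End almost_sure_limits.

(** * Coding of real numbers by bits *)

Section dyadic.
Context (R : realType).
Implicit Types x y : R.

Definition dyadic_threshold k j : R := - 2 ^+ k + j.+1%:R / 2 ^+ k.

Definition dyadic_size k := (2 * 4 ^ k)%N.

(** Rounds [x] down to a multiple of [2^-k] and clips it to [[- 2^k, 2^k]]. Written as a count of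
    passed thresholds, it depends on finitely many bits. *)
Definition dyadic k x : R :=
  - 2 ^+ k + (\sum_(j < dyadic_size k) (dyadic_threshold k j <= x)%R%:R) / 2 ^+ k.

Lemma count_le (m : nat) y : 0 <= y <= m%:R ->
  `|\sum_(j < m) (j.+1%:R <= y)%R%:R - y| <= 1.
Proof.
move=> /andP[y0 ym].
have all1 k : k%:R <= y -> \sum_(j < k) (j.+1%:R <= y)%R%:R = k%:R :> R.
  move=> ky; under eq_bigr => j _.
    rewrite (_ : _ <= y = true); last by rewrite (le_trans _ ky)// ler_nat.
    over.
  by rewrite sumr_const card_ord.
elim: m ym => [|m IH] ym.
  by rewrite big_ord0 (_ : y = 0) ?subrr ?normr0//; apply/le_anti; rewrite ym.
rewrite big_ord_recr/=; have [my|ym1] := leP m.+1%:R y.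
  rewrite all1; last by rewrite (le_trans _ my)// ler_nat.
  have -> : y = m.+1%:R by apply/le_anti; rewrite ym.
  by rewrite natr1 subrr normr0.
rewrite addr0; have [|my] := leP y m%:R; first exact: IH.
rewrite all1 ?(ltW my)// distrC ger0_norm ?subr_ge0 ?(ltW my)//.
by rewrite lerBlDr addrC natr1 ltW.
Qed.

(** Within the range the error is at most one cell; outside it [|x| > 2^k], and the error is at most
    [|x| <= x^2 / 2^k]. *)
Lemma dyadic_sub k x : `|dyadic k x - x| <= (1 + x ^+ 2) / 2 ^+ k.
Proof.
set c : R := 2 ^+ k; have c0 : 0 < c by rewrite exprn_gt0.
have c1 : 1 <= c by rewrite exprn_ege1// ler1n.
have mE : (dyadic_size k)%:R = 2 * c ^+ 2 :> R.
  by rewrite natrM natrX -exprM mulnC exprM; congr (_ * _ ^+ _); rewrite -natrX.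
pose y := c * x + c ^+ 2.
have E : dyadic k x - x = (\sum_(j < dyadic_size k) (j.+1%:R <= y)%R%:R - y) / c.
  rewrite /dyadic -/c mulrBl (_ : y / c = x + c); last by rewrite /y; field; rewrite lt0r_neq0.
  under eq_bigr => j _.
    rewrite (_ : (dyadic_threshold k j <= x) = (j.+1%:R <= y)); last first.
      by rewrite /dyadic_threshold -/c -lerBrDl opprK ler_pdivrMr// mulrDl mulrC -expr2.
    over.
  by ring.
have x2 : 0 <= x ^+ 2 := sqr_ge0 x.
rewrite E normrM (ger0_norm (ltW (_ : 0 < c^-1))) ?invr_gt0// ler_pM2r ?invr_gt0//.
have [y0|y0] := ltP y 0.
  rewrite big1 => [|j _]; last by rewrite (_ : _ <= y = false)//; apply/negbTE; rewrite -ltNge (lt_le_trans y0).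
  rewrite sub0r normrN ltr0_norm// /y; rewrite /y in y0.
  have xc : x < - c by nra.
  by nra.
have [ym|ym] := leP y (dyadic_size k)%:R.
  by rewrite (le_trans (count_le _))// ?y0// lerDl.
rewrite (eq_bigr (fun=> 1)) => [|j _]; last first.
  by rewrite (_ : _ <= y = true)//; rewrite (le_trans _ (ltW ym))// ler_nat.
rewrite sumr_const card_ord mE in ym *; rewrite ler0_norm ?subr_le0 ?(ltW ym)// opprB.
have xc : c < x by rewrite /y in ym; nra.
by rewrite /y; nra.
Qed.

End dyadic.

Section bit_limits.
Context (R : realType).
Implicit Types (Phi : (nat -> bool) -> R).

(** The functions whose expectations are finite sums of prefix probabilities, and so survive limits
    of these. *)
Definition finitary Phi := exists n, forall b1 b2 : nat -> bool,
  (forall m, (m < n)%N -> b1 m = b2 m) -> Phi b1 = Phi b2.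

Lemma finitary_bit m : finitary (fun b => (b m)%:R).
Proof. by exists m.+1 => b1 b2 ->. Qed.

Lemma finitary_comb (I : finType) (Phi : I -> (nat -> bool) -> R) (F : (I -> R) -> R) :
  (forall i, finitary (Phi i)) -> finitary (fun b => F (fun i => Phi i b)).
Proof.
move=> /choice[n nP]; exists (\max_i n i) => b1 b2 b12; congr F; apply/funext => i.
by apply: nP => m mi; apply: b12; rewrite (leq_trans mi)// leq_bigmax.
Qed.

Lemma finitary_prefix Phi : finitary Phi -> exists n (g : seq bool -> R),
  forall d (T : measurableType d) (b : nat -> T -> bool) t, Phi (b^~ t) = g (prefix b n t).
Proof.
move=> [n nP]; exists n, (fun w => Phi (fun m => nth false w (n - m.+1))) => d T b t.
by apply: nP => m mn; rewrite nth_prefix.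
Qed.

Lemma mom_finitary d (T : measurableType d) (P : probability T R) (b : nat -> T -> bool) Phi :
  (forall k, measurable_fun setT (b k)) -> finitary Phi -> mom P (fun t => Phi (b^~ t)).
Proof.
move=> mb /finitary_prefix[n [g gP]].
by under eq_fun do rewrite gP; exact: mom_prefix.
Qed.

(* Compactness of the space of bit sequences, whose laws are realized on [[0, 1]]. *)
Lemma bit_limit d (T : measurableType d) (P : probability T R) (G : set_system nat)
    (b : nat -> nat -> T -> bool) : UltraFilter G ->
  (forall N k, measurable_fun setT (b N k)) ->
  exists2 b' : nat -> measurableTypeR R -> bool, (forall k, measurable_fun setT (b' k)) &
    forall Phi, finitary Phi ->
      Ex P (fun t => Phi ((b N)^~ t)) @[N --> G] --> Ex (uniform_prob (@ltr01 R)) (fun t => Phi (b'^~ t)).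
Proof.
move=> GU mb; have GP : ProperFilter G by exact: ultra_proper.
(* Bounded sequences converge along [G], and the limits [q] inherit the relations between prefix
   probabilities, each of which involves finitely many words. *)
have E w : exists l : R, prefix_law P (b N) w @[N --> G] --> l.
  apply: (@ultra_bounded_cvg R nat G _ 1) => N.
  by rewrite ger0_norm ?prefix_law_ge0 ?prefix_law_le1.
have [q ql] := choice E.
have q0 : q [::] = 1.
  have E0 : (fun N => prefix_law P (b N) [::]) = fun=> 1 by apply/funext => N; exact: prefix_law0.
  by have := ql [::]; rewrite E0 => /(cvg_unique (@Rhausdorff R) (cvg_cst (1 : R))).
have q_ge0 w : 0 <= q w.
  by apply: (ler_cvg_to (cvg_cst (0 : R)) (ql w)); apply: nearW => N; exact: prefix_law_ge0.
have qS w : q w = q (false :: w) + q (true :: w).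
  have ES : (fun N => prefix_law P (b N) w) =
      (fun N => prefix_law P (b N) (false :: w) + prefix_law P (b N) (true :: w)).
    by apply/funext => N; exact: prefix_lawS.
  have := ql w; rewrite ES => qw.
  exact: (cvg_unique (@Rhausdorff R) qw (cvgD (ql (false :: w)) (ql (true :: w)))).
exists (rbit q : nat -> measurableTypeR R -> bool); first by move=> k; exact: measurable_rbit.
move=> Phi /finitary_prefix[n [g gP]].
have -> : (fun N => Ex P (fun t => Phi ((b N)^~ t))) = fun N => tree_sum (prefix_law P (b N)) g n [::].
  by apply/funext => N; rewrite -Ex_prefix0//; apply: eq_Ex => t; exact: gP.
have -> : Ex (uniform_prob (@ltr01 R)) (fun t => Phi ((rbit q : nat -> measurableTypeR R -> bool)^~ t)) =
    tree_sum q g n [::].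
  have pE : prefix_law (uniform_prob (@ltr01 R)) (rbit q : nat -> measurableTypeR R -> bool) = q.
    by apply/funext => w; exact: prefix_law_rbit.
  rewrite -[X in tree_sum X]pE -Ex_prefix0; last by move=> k; exact: measurable_rbit.
  by apply: eq_Ex => t; exact: gP.
exact: cvg_tree_sum.
Qed.

End bit_limits.

Section limit_law.
Context (R : realType) d (T : measurableType d) (P : probability T R) (n : nat).
Context (V : nat -> 'I_n -> T -> R) (S : R).
Hypothesis Vsq : forall N i, sqintg P (V N i).
Hypothesis S0 : 0 <= S.
Hypothesis VS : \forall N \near \oo, forall i, Ex P (fun w => V N i w ^+ 2) <= S.

Local Notation U := (uniform_prob (@ltr01 R)).

Let code (i : 'I_n) (k j : nat) : nat := pickle (i, k, j).

Let bitV N m w : bool :=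
  if @unpickle ('I_n * nat * nat)%type m is Some (i, k, j) then dyadic_threshold R k j <= V N i w else false.

(** Decodes the dyadic approximation of level [k] of coordinate [i]. It is defined on all bit
    sequences, since a limiting sequence need not code a real number. *)
Let digits i k (b : nat -> bool) : R :=
  - 2 ^+ k + (\sum_(j < dyadic_size k) (b (code i k j))%:R) / 2 ^+ k.

Let digitsV N i k w : digits i k ((bitV N)^~ w) = dyadic k (V N i w).
Proof.
rewrite /digits /dyadic; congr (_ + _ / _); apply: eq_bigr => j _.
by rewrite /bitV pickleK.
Qed.

Let finitary_digits i k : finitary (digits i k).
Proof.
exact: (@finitary_comb R 'I_(dyadic_size k) (fun j b => (b (code i k j))%:R)
  (fun x => - 2 ^+ k + (\sum_j x j) / 2 ^+ k) (fun j => @finitary_bit R _)).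
Qed.

Let measurable_bitV N m : measurable_fun setT (bitV N m).
Proof.
rewrite /bitV; case: (unpickle m) => [[[i k] j]|]; last exact: measurable_cst.
by apply: measurable_fun_ler; [exact: measurable_cst|have [] := Vsq N i].
Qed.

Let mVd N i k : mom P (fun w => dyadic k (V N i w)).
Proof.
under eq_fun do rewrite -digitsV.
by apply: (@mom_finitary _ _ _ _ (bitV N)) => //; exact: finitary_digits.
Qed.

Let dyadic_dist k : \forall N \near \oo, forall i, Ex P (fun w => `|dyadic k (V N i w) - V N i w|) <= (1 + S) / 2 ^+ k.
Proof.
apply: filterS VS => N VN i.
have i1 : intg P (fun w => dyadic k (V N i w) - V N i w).
  by apply: intgB; [have ? := mVd N i k; intg_tac|exact: sqintg_intg].
have i2 : intg P (fun w => 1 + V N i w ^+ 2) by apply: intgD; [exact: intg_cst|exact: (Vsq N i).2].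
apply: (@le_trans _ _ (Ex P (fun w => (2 ^+ k)^-1 * (1 + V N i w ^+ 2)))).
  by apply: Ex_le; [exact: intg_norm|exact: intgZ|move=> w; rewrite mulrC; exact: dyadic_sub].
rewrite ExZ// mulrC ler_pM2r ?invr_gt0 ?exprn_gt0// ExD; [|exact: intg_cst|exact: (Vsq N i).2].
by rewrite Ex_cst lerD2l.
Qed.

(** Along an ultrafilter the bits of [V N] have a limit in law. Decoded values of successive levels
    differ in [L^1] by [O(2^-k)] uniformly for large [N], so in the limit they converge almost
    everywhere, which defines [Z]. A limit that exists along the whole sequence equals the one along
    the ultrafilter, and this identifies the cosine expectations. *)
Lemma limit_law : exists2 Z : 'I_n -> measurableTypeR R -> R, forall i, measurable_fun setT (Z i) &
  forall (u : 'I_n -> R) (t l : R), Ex P (fun w => cos (\sum_i u i * V N i w + t)) @[N --> \oo] --> l ->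
    Ex U (fun w => cos (\sum_i u i * Z i w + t)) = l.
Proof.
have [G [GU ooG]] := @ultraFilterLemma nat (nbhs \oo) _.
have GP : ProperFilter G by exact: ultra_proper.
have toG (f : nat -> R) (l : R) : f N @[N --> \oo] --> l -> f N @[N --> G] --> l.
  by move=> fl A /fl /ooG.
have [b mb bl] := bit_limit P GU measurable_bitV.
pose z i k w := digits i k (b^~ w).
have zm i k : mom U (z i k) by apply: mom_finitary => //; exact: finitary_digits.
have zC i k : Ex U (fun w => `|z i k.+1 w - z i k w|) <= (2 * (1 + S)) / 2 ^+ k.
  have fin : finitary (fun b => `|digits i k.+1 b - digits i k b|).
    apply: (@finitary_comb R bool (fun c => digits i (if c then k.+1 else k))
      (fun x => `|x true - x false|)) => c; exact: finitary_digits.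
  apply: (ler_cvg_to (bl _ fin) (cvg_cst _)); apply: ooG.
  have := dyadic_dist k.+1; have := dyadic_dist k; apply: filterS2 => N /(_ i) d1 /(_ i) d2.
  rewrite (eq_Ex _ (g := fun w => `|dyadic k.+1 (V N i w) - dyadic k (V N i w)|)); last first.
    by move=> w; rewrite !digitsV.
  have vi := sqintg_intg (Vsq N i).
  have i1 j : intg P (fun w => `|dyadic j (V N i w) - V N i w|).
    by apply: intg_norm; apply: intgB => //; have ? := mVd N i j; intg_tac.
  apply: (@le_trans _ _ (Ex P (fun w => `|dyadic k.+1 (V N i w) - V N i w| + `|dyadic k (V N i w) - V N i w|))).
    apply: Ex_le; [|exact: intgD|].
      by apply: intg_norm; have ? := mVd N i k; have ? := mVd N i k.+1; intg_tac.
    move=> w; rewrite -[X in X <= _](_ : `|(dyadic k.+1 (V N i w) - V N i w) - (dyadic k (V N i w) - V N i w)| = _).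
      exact: ler_normB.
    by congr `|_|; ring.
  rewrite ExD// (le_trans (lerD d2 d1))// [leRHS](_ : _ = (1 + S) / 2 ^+ k + (1 + S) / 2 ^+ k); last by ring.
  rewrite lerD2r.
  by rewrite ler_wpM2l ?addr_ge0// lef_pV2 ?posrE ?exprn_gt0// ler_eXn2l// ltr1n.
have zi i k : intg U (fun w => `|z i k.+1 w - z i k w|).
  by have ? := zm i k; have ? := zm i k.+1; intg_tac.
have Zex i : exists Z : measurableTypeR R -> R, measurable_fun setT Z /\ {ae U, forall w, z i k w @[k --> \oo] --> Z w}.
  by have [Z mZ cZ] := ae_cvg_geometric (fun k => mom_measurable (zm i k)) (zi i) (zC i); exists Z.
have [Z ZP] := choice Zex.
exists Z => [i|u t l Vl]; first exact: (ZP i).1.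
have mZ i := (ZP i).1.
have mz i k := mom_measurable (zm i k).
have lim1 : Ex U (fun w => cos (\sum_i u i * z i k w + t)) @[k --> \oo] --> Ex U (fun w => cos (\sum_i u i * Z i w + t)).
  have mc (x : 'I_n -> measurableTypeR R -> R) : (forall i, measurable_fun setT (x i)) ->
      measurable_fun setT (fun w => cos (\sum_i u i * x i w + t)).
    move=> mx; apply: measurableT_comp; first exact: continuous_measurable_fun (@continuous_cos R).
    apply: measurable_funD => //; apply: measurable_sum => i.
    by apply: measurable_funM => //; exact: mx.
  apply: (@Ex_cvg_ae _ _ _ U _ _ 1) => [k||k w|]; [by apply: mc => i|exact: mc| |].
    by rewrite ler_norml cos_geN1 cos_le1.
  have : {ae U, forall w, forall i, z i k w @[k --> \oo] --> Z i w}.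
    by apply: filter_forall => i; exact: (ZP i).2.
  apply: filterS => w zw; apply: (continuous_cvg _ (@continuous_cos R _)).
  apply: cvgD; last exact: cvg_cst.
  elim: (index_enum _) => [|i s IH].
    by under eq_fun do rewrite big_nil; rewrite big_nil; exact: cvg_cst.
  under eq_fun do rewrite big_cons; rewrite big_cons; apply: cvgD => //.
  by apply: cvgM; [exact: cvg_cst|exact: zw].
(* The error at level [k] is uniform for large [N], so it survives the limit in [N] before [k] tends
   to infinity. *)
have lim2 k : `|Ex U (fun w => cos (\sum_i u i * z i k w + t)) - l| <= (\sum_i `|u i|) * ((1 + S) / 2 ^+ k).
  have fin : finitary (fun b => cos (\sum_i u i * digits i k b + t)).
    exact: (@finitary_comb R 'I_n (fun i => digits i k) (fun x => cos (\sum_i u i * x i + t))).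
  have /(_ (@filter_filter _ _ GP)) c1 := cvgB (bl _ fin) (toG _ l Vl).
  apply: (ler_cvg_to (cvg_norm c1) (cvg_cst _)); apply: ooG.
  apply: filterS (dyadic_dist k) => N dN /=.
  have mVi i : measurable_fun setT (V N i) by have [] := Vsq N i.
  have dE : Ex P (fun w => cos (\sum_i u i * digits i k ((bitV N)^~ w) + t)) =
      Ex P (fun w => cos (\sum_i u i * dyadic k (V N i w) + t)).
    by apply: eq_Ex => w; congr (cos (_ + _)); apply: eq_bigr => i _; rewrite digitsV.
  suff H : `|Ex P (fun w => cos (\sum_i u i * dyadic k (V N i w) + t)) -
      Ex P (fun w => cos (\sum_i u i * V N i w + t))| <= (\sum_i `|u i|) * ((1 + S) / 2 ^+ k).
    by rewrite -dE in H; exact: H.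
  have md i := mom_measurable (mVd N i k).
  have ms (x : 'I_n -> T -> R) : (forall i, measurable_fun setT (x i)) ->
      intg P (fun w => cos (\sum_i u i * x i w + t)).
    move=> mx; apply: mom_intg; apply: mom_cos; apply: measurable_funD => //.
    by apply: measurable_sum => i; apply: measurable_funM.
  have iD i : intg P (fun w => `|dyadic k (V N i w) - V N i w|).
    by apply: intg_norm; apply: intgB; [have ? := mVd N i k; intg_tac|exact: sqintg_intg].
  rewrite -ExB; [|exact: ms|exact: ms].
  apply: (@le_trans _ _ (Ex P (fun w => \sum_i `|u i| * `|dyadic k (V N i w) - V N i w|))).
    apply: Ex_norm_le; [by apply: intgB; exact: ms|by apply: intg_sum => i; exact: intgZ|move=> w].
    rewrite (le_trans (le_norm_sub_cos _ _))// opprD addrACA subrr addr0 -sumrB.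
    by rewrite (le_trans (ler_norm_sum _ _ _))// ler_sum// => i _; rewrite -mulrBr normrM.
  rewrite Ex_sum => [|i]; last exact: intgZ.
  rewrite mulr_suml ler_sum// => i _; rewrite ExZ// ler_wpM2l//.
apply/eqP; rewrite -subr_eq0 -normr_le0.
have c0 : (\sum_i `|u i|) * ((1 + S) / 2 ^+ k) @[k --> \oo] --> (0 : R).
  have -> : (fun k => (\sum_i `|u i|) * ((1 + S) / 2 ^+ k)) = geometric ((\sum_i `|u i|) * (1 + S)) 2^-1.
    by apply/funext => k; rewrite /geometric/= exprVn mulrA.
  by apply: cvg_geometric; rewrite ger0_norm ?invr_ge0// invf_lt1// ltr1n.
apply: (ler_cvg_to (cvg_norm (cvgB lim1 (cvg_cst l))) c0); apply: nearW => k.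
exact: lim2.
Unshelve. all: by end_near. Qed.

End limit_law.

(** * Laws and characteristic functions *)

Section second_moment_from_cos.
Context (R : realType) d (T : measurableType d) (P : probability T R).

Lemma cos_sub1_le (x : R) : 1 - cos x <= x ^+ 2.
Proof.
have [c cx E] := @MVT_norm R (@cos R) (fun x => - sin x) 0 x (fun y => is_derive_cos y).
have : `|1 - cos x| <= `|x| * `|x|.
  rewrite distrC -[X in `|_ - X|]cos0 E !subr0 normrM normrN ler_wpM2r//.
  rewrite !subr0 in cx; rewrite (le_trans _ cx)//.
  by have := le_norm_sub_sin 0 c; rewrite sin0 !subr0.
by move=> /(le_trans (ler_norm _)); rewrite -normrM -expr2 ger0_norm ?sqr_ge0.
Qed.

(** Use [1 - cos x = 2 sin (x/2)^2]; here [|sin (x/2)| >= |x| / 4], because the cosine is at least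
    [1/2] between [0] and [x/2]. *)
Lemma cos_sub1_ge (x : R) : `|x| <= 1 -> x ^+ 2 / 8 <= 1 - cos x.
Proof.
move=> x1; have [c cx E] := @MVT_norm R (@sin R) (@cos R) 0 (x / 2) (fun y => is_derive_sin y).
rewrite sin0 !subr0 in cx E.
have x2 : `|x / 2| <= 2^-1 by rewrite normrM (ger0_norm (_ : 0 <= 2^-1 :> R))// ler_piMl.
have cc : 2^-1 <= cos c.
  have := cos_sub1_le c; rewrite -[c ^+ 2]real_normK ?num_real//.
  have := le_trans cx x2; have := normr_ge0 c; nra.
have -> : 1 - cos x = 2 * sin (x / 2) ^+ 2.
  have := cos_mulr2n (x / 2); rewrite (_ : (x / 2) *+ 2 = x); last by field.
  move=> ->.
  by rewrite sin2cos2; ring.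
have c1 := cos_le1 c; have : 4^-1 <= cos c ^+ 2 by nra.
rewrite E exprMn => c2; have := sqr_ge0 x; nra.
Qed.

(** A quadratic bound on the characteristic function near [0] controls the second moment: on
    [|Z| <= k + 1] take [u = 1 / (k + 1)], and remove the truncation by monotone convergence. *)
Lemma sqintg_of_cos (Z : T -> R) (S : R) : measurable_fun setT Z ->
  (forall u, Ex P (fun w => 1 - cos (u * Z w)) <= u ^+ 2 * S) -> sqintg P Z.
Proof.
move=> mZ ZS; split=> //; apply/integrableP; split.
  by apply/measurable_EFinP; exact: measurable_funX.
pose g k w : R := if `|Z w| <= k.+1%:R then Z w ^+ 2 else 0.
have mg k : measurable_fun setT (g k).
  apply: measurable_fun_ifT => //; last exact: measurable_funX.
  by apply: measurable_fun_ler => //; exact: measurableT_comp.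
have g0 k w : 0 <= g k w by rewrite /g; case: ifP => // _; exact: sqr_ge0.
have gi k : intg P (g k).
  apply: (@intg_bounded _ _ _ P _ (k.+1%:R ^+ 2)) => // w; rewrite ger0_norm// /g.
  case: ifP => [Zk|_]; last exact: sqr_ge0.
  by rewrite -real_normK ?num_real// lerXn2r ?nnegrE.
have gS k : Ex P (g k) <= 8 * S.
  have k0 : 0 < k.+1%:R :> R by rewrite ltr0n.
  have mc : intg P (fun w => 1 - cos (k.+1%:R^-1 * Z w)).
    apply: intgB; first exact: intg_cst.
    by apply: mom_intg; apply: mom_cos; exact: measurable_funM.
  apply: (@le_trans _ _ (Ex P (fun w => 8 * k.+1%:R ^+ 2 * (1 - cos (k.+1%:R^-1 * Z w))))).
    apply: Ex_le => //; first exact: intgZ.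
    move=> w; rewrite /g; case: ifP => [Zk|_]; last first.
      by rewrite mulr_ge0 ?mulr_ge0 ?sqr_ge0// subr_ge0 cos_le1.
    have := @cos_sub1_ge (k.+1%:R^-1 * Z w) _.
    rewrite normrM ger0_norm ?invr_ge0// ler_pdivrMl// mulr1 => /(_ Zk) H.
    rewrite [leLHS](_ : _ = 8 * k.+1%:R ^+ 2 * ((k.+1%:R^-1 * Z w) ^+ 2 / 8)).
      by rewrite ler_wpM2l// mulr_ge0 ?sqr_ge0.
    by field; rewrite lt0r_neq0.
  rewrite ExZ//; apply: le_trans (ler_wpM2l _ (ZS k.+1%:R^-1)) _; first by rewrite mulr_ge0 ?sqr_ge0.
  by rewrite le_eqVlt; apply/orP; left; apply/eqP; field; rewrite lt0r_neq0.
have cvgZ : (\int[P]_w (EFin \o g k) w)%E @[k --> \oo] --> (\int[P]_w limn (fun k => (g k w)%:E))%E.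
  apply: cvg_monotone_convergence => //.
  - by move=> k; exact/measurable_EFinP.
  - by move=> k w _; rewrite lee_fin.
  - move=> w _ k l kl; rewrite lee_fin /g; case: ifP => Zk; last by rewrite g0.
    by rewrite (le_trans Zk)// ler_nat.
have limZ w : limn (fun k => (g k w)%:E) = (Z w ^+ 2)%:E.
  apply: cvg_lim => //; apply: cvg_near_cst.
  near=> k; rewrite /g ifT//; near: k.
  apply: filterS (nbhs_infty_ger `|Z w|) => k /le_trans; apply; by rewrite ler_nat.
rewrite (_ : (fun w => _) = (fun w => limn (fun k => (g k w)%:E))); last first.
  by apply/funext => w; rewrite limZ /= ger0_norm ?sqr_ge0.
rewrite -(cvg_lim _ cvgZ)//; apply: (@le_lt_trans _ _ (8 * S)%:E); last exact: ltry.
apply: lime_le; first by apply/cvg_ex; eexists; exact: cvgZ.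
apply: nearW => k; have := gS k; rewrite -lee_fin; congr (_ <= _)%E.
by rewrite /Ex /Rintegral fineK//; apply: integrable_fin_num => //; exact: gi.
Unshelve. all: by end_near. Qed.

End second_moment_from_cos.

Section convergence_in_law.
Context (R : realType) d (T : measurableType d) (P : probability T R) (n : nat).
Context d' (T' : measurableType d') (Q : probability T' R).
Context (V : nat -> 'I_n -> T -> R) (Z : 'I_n -> T' -> R) (S : R).
Hypotheses (Vsq : forall N i, sqintg P (V N i)) (Zsq : forall i, sqintg Q (Z i)).
Hypothesis VS : \forall N \near \oo, forall i, Ex P (fun w => V N i w ^+ 2) <= S.
Hypothesis Vcos : forall (u : 'I_n -> R) (t : R),
  Ex P (fun w => cos (\sum_i u i * V N i w + t)) @[N --> \oo] --> Ex Q (fun w => cos (\sum_i u i * Z i w + t)).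

Let Ex_weight d0 (T0 : measurableType d0) (P0 : probability T0 R) (X : 'I_n -> T0 -> R) :
  (forall i, sqintg P0 (X i)) ->
  intg P0 (fun w => weight (\row_i X i w)) /\
  Ex P0 (fun w => weight (\row_i X i w)) = 1 + \sum_i Ex P0 (fun w => X i w ^+ 2).
Proof.
move=> Xs; have -> : (fun w => weight (\row_i X i w)) = (fun w => 1 + \sum_i X i w ^+ 2).
  by apply/funext => w; rewrite /weight; congr (_ + _); apply: eq_bigr => i _; rewrite mxE.
have i2 i := (Xs i).2; split; first by apply: intgD; [exact: intg_cst|exact: intg_sum].
by rewrite ExD ?Ex_cst ?Ex_sum//; [exact: intg_cst|exact: intg_sum].
Qed.

Lemma cvg_trig (tau : 'rV[R]_n -> R) : trig tau ->
  Ex P (fun w => tau (\row_i V N i w)) @[N --> \oo] --> Ex Q (fun w => tau (\row_i Z i w)).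
Proof.
have ti d0 (T0 : measurableType d0) (P0 : probability T0 R) (X : 'I_n -> T0 -> R) f :
    (forall i, sqintg P0 (X i)) -> trig f -> intg P0 (fun w => f (\row_i X i w)).
  move=> Xs tf; have [M fM] := trig_bounded tf.
  by apply: (@intg_bounded _ _ _ P0 _ M) => //; apply: measurable_trig => // i; have [] := Xs i.
elim=> [l a|f g tf IHf tg IHg|c f tf IHf].
- have E d0 (T0 : measurableType d0) (P0 : probability T0 R) (X : 'I_n -> T0 -> R) :
      Ex P0 (fun w => cos (euclidean_dot l (\row_i X i w) + a)) =
      Ex P0 (fun w => cos (\sum_i l 0 i * X i w + a)).
    by apply: eq_Ex => w; congr (cos (_ + _)); apply: eq_bigr => i _; rewrite mxE.
  by under eq_fun do rewrite E; rewrite E; exact: Vcos.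
- under eq_fun do rewrite ExD ?ti//; rewrite ExD ?ti//; exact: cvgD.
- by under eq_fun do rewrite ExZ ?ti//; rewrite ExZ ?ti//; apply: cvgM => //; exact: cvg_cst.
Qed.

(** Levy's continuity theorem under bounded second moments: the error in [trig_approx] is a small
    multiple of [weight], whose expectation is bounded for large [N]. *)
Lemma cvg_bounded_continuous (phi : 'rV[R]_n -> R) (M : R) : continuous phi -> (forall x, `|phi x| <= M) ->
  Ex P (fun w => phi (\row_i V N i w)) @[N --> \oo] --> Ex Q (fun w => phi (\row_i Z i w)).
Proof.
move=> cphi phiM; apply/cvgrPdist_le => e e0.
have [iZ EZ] := Ex_weight Zsq.
pose B := Num.max (1 + n%:R * S) (Ex Q (fun w => weight (\row_i Z i w))).
have B0 : 0 < B.
  rewrite lt_max; apply/orP; right; rewrite EZ ltr_pwDl// sumr_ge0// => i _; exact: Ex_sqr_ge0.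
have eB0 : 0 < e / 3 / B by rewrite !divr_gt0.
have [tau ttau tauP] := trig_approx cphi phiM eB0.
have [K tauK] := trig_bounded ttau.
have close d0 (T0 : measurableType d0) (P0 : probability T0 R) (X : 'I_n -> T0 -> R) :
    (forall i, sqintg P0 (X i)) -> Ex P0 (fun w => weight (\row_i X i w)) <= B ->
    `|Ex P0 (fun w => phi (\row_i X i w)) - Ex P0 (fun w => tau (\row_i X i w))| <= e / 3.
  move=> Xs XB; have [iX _] := Ex_weight Xs; have mX i := (Xs i).1.
  have i1 : intg P0 (fun w => phi (\row_i X i w)).
    by apply: (@intg_bounded _ _ _ P0 _ M) => //; exact: measurable_continuous_rV.
  have i2 : intg P0 (fun w => tau (\row_i X i w)).
    by apply: (@intg_bounded _ _ _ P0 _ K) => //; exact: measurable_trig.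
  rewrite -ExB// (@le_trans _ _ (Ex P0 (fun w => e / 3 / B * weight (\row_i X i w))))//.
    by apply: Ex_norm_le => [||w]; [exact: intgB|exact: intgZ|exact: tauP].
  by rewrite ExZ// -[leRHS](divfK (lt0r_neq0 B0)) ler_wpM2l// ltW.
have /cvgrPdist_le /(_ (e / 3)) H := cvg_trig ttau.
have e3 : 0 < e / 3 by rewrite divr_gt0.
near=> N.
have h1 : `|Ex P (fun w => phi (\row_i V N i w)) - Ex P (fun w => tau (\row_i V N i w))| <= e / 3.
  apply: close => //; have [_ ->] := Ex_weight (Vsq N).
  rewrite le_max; apply/orP; left; rewrite lerD2l.
  have VN : forall i, Ex P (fun w => V N i w ^+ 2) <= S by near: N.
  rewrite (@le_trans _ _ (\sum_(i < n) S))//; first by apply: ler_sum.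
  by rewrite sumr_const card_ord mulr_natl.
have h2 : `|Ex Q (fun w => phi (\row_i Z i w)) - Ex Q (fun w => tau (\row_i Z i w))| <= e / 3.
  by apply: close => //; rewrite le_max lexx orbT.
have h3 : `|Ex Q (fun w => tau (\row_i Z i w)) - Ex P (fun w => tau (\row_i V N i w))| <= e / 3.
  by near: N; exact: H.
move: h1 h2 h3; rewrite !ler_distl.
by move=> /andP[? ?] /andP[? ?] /andP[? ?]; apply/andP; split; lra.
Unshelve. all: by end_near. Qed.

End convergence_in_law.

(** * Laws determined by bounded continuous functions *)

Section laws_from_continuous_functions.
Context (R : realType) (S : normedModType R).
Implicit Types (C : set S) (x y : S).

Let gap C x : R := inf [set `|x - y| | y in C].

Let gap_ge0 C x : C !=set0 -> 0 <= gap C x.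
Proof.
by move=> [y Cy]; apply: lb_le_inf; [exists `|x - y|, y|move=> _ [z _ <-]].
Qed.

Let gap_le C x y : C y -> gap C x <= `|x - y|.
Proof. by move=> Cy; apply: ge_inf; [exists 0 => _ [z _ <-]|exists y]. Qed.

Let gap_lipschitz C x y : C !=set0 -> gap C x - gap C y <= `|x - y|.
Proof.
move=> C0; rewrite lerBlDl -lerBlDr; apply: lb_le_inf.
  by case: C0 => z Cz; exists `|y - z|, z.
move=> _ [z Cz <-]; rewrite lerBlDr (le_trans (gap_le x Cz))//.
have -> : x - z = (x - y) + (y - z) by rewrite addrA subrK.
by rewrite [leRHS]addrC ler_normD.
Qed.

Let continuous_gap C : C !=set0 -> continuous (gap C).
Proof.
move=> C0 x; apply/cvgrPdist_le => e e0; near=> y.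
have xy : `|x - y| <= e by near: y; apply: cvgr_dist_le => //; exact: cvg_id.
rewrite ler_norml lerNl opprB !(le_trans _ xy)//; last by rewrite distrC gap_lipschitz.
exact: gap_lipschitz.
Unshelve. all: by end_near. Qed.

Let gap_gt0 C x : closed C -> C !=set0 -> ~ C x -> 0 < gap C x.
Proof.
move=> Cc C0 Cx; have /nbhs_ballP[e /= e0 xe] : nbhs x (~` C).
  by apply: open_nbhs_nbhs; split=> //; exact: closed_openC.
apply: (@lt_le_trans _ _ e) => //; apply: lb_le_inf.
  by case: C0 => y Cy; exists `|x - y|, y.
move=> _ [y Cy <-]; rewrite leNgt; apply/negP => xy.
by apply: (xe y) => //; rewrite -ball_normE.
Qed.

(** Continuous functions with values in [[0, 1]] that converge to the indicator of the complement of
    a nonempty closed [C]. *)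
Let soft C k x : R := k.+1%:R * gap C x / (1 + k.+1%:R * gap C x).

Let soft_den C k x : C !=set0 -> 0 < 1 + k.+1%:R * gap C x.
Proof. by move=> C0; rewrite ltr_pwDl// mulr_ge0// gap_ge0. Qed.

Let continuous_soft C k : C !=set0 -> continuous (soft C k).
Proof.
move=> C0 x; have c1 : {for x, continuous (fun y => k.+1%:R * gap C y)}.
  by apply: cvgM; [exact: cvg_cst|exact: continuous_gap].
apply: cvgM => //; apply: cvgV; first by rewrite lt0r_neq0// soft_den.
by apply: cvgD => //; exact: cvg_cst.
Qed.

Let norm_soft C k x : C !=set0 -> `|soft C k x| <= 1.
Proof.
move=> C0; have g0 := gap_ge0 x C0.
rewrite ger0_norm; first by rewrite ler_pdivrMr ?soft_den// mul1r lerDr.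
by rewrite divr_ge0 ?mulr_ge0// ltW// soft_den.
Qed.

Let soft_gt0 C k x : closed C -> C !=set0 -> (0 < soft C k x) <-> ~ C x.
Proof.
move=> Cc C0; split=> [s0 Cx|/(gap_gt0 Cc C0) g0].
  have := gap_le x Cx; rewrite subrr normr0 => g0.
  suff : soft C k x <= 0 by rewrite leNgt s0.
  by rewrite /soft mulr_le0_ge0 ?mulr_ge0_le0// invr_ge0 ltW// soft_den.
by rewrite divr_gt0 ?mulr_gt0 ?soft_den.
Qed.

Let cvg_soft C x : closed C -> C !=set0 -> soft C k x @[k --> \oo] --> (\1_(~` C) x : R).
Proof.
move=> Cc C0; rewrite indicE; have [Cx|Cx] := pselect (C x).
  rewrite memNset /=; last by move=> /(_ Cx).
  rewrite (_ : (fun k => soft C k x) = fun=> 0); first exact: cvg_cst.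
  apply/funext => k; have g0 : gap C x = 0.
    by apply/le_anti; rewrite gap_ge0// andbT (le_trans (gap_le x Cx))// subrr normr0.
  by rewrite /soft g0 mulr0 mul0r.
rewrite mem_set//=; have g0 := gap_gt0 Cc C0 Cx.
apply/cvgrPdist_le => e e0; have eg : 0 < e * gap C x by rewrite mulr_gt0.
apply: filterS (near_infty_natSinv_lt (PosNum eg)) => k /= ke.
rewrite (_ : 1 - soft C k x = (1 + k.+1%:R * gap C x)^-1); last first.
  have := lt0r_neq0 (soft_den k x C0); rewrite /soft; move: (_ * gap C x) => a a0.
  by field.
rewrite ger0_norm ?invr_ge0 ?(ltW (soft_den _ _ _))// -[leRHS]invrK lef_pV2 ?posrE ?soft_den ?invr_gt0//.
rewrite (@le_trans _ _ (k.+1%:R * gap C x)) ?lerDr//.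
move: ke; rewrite -[ltLHS]mul1r ltr_pdivrMr// => ke.
rewrite -[leLHS]mul1r ler_pdivrMr// (_ : _ * e = e * gap C x * k.+1%:R); last by ring.
exact: ltW.
Qed.

Context d (T : measurableType d) (P : probability T R).
Context d' (T' : measurableType d') (Q : probability T' R).
Context (X : T -> S) (Y : T' -> S).
Hypothesis XY : forall phi : S -> R, continuous phi -> (forall x, `|phi x| <= 1) ->
  [/\ measurable_fun setT (phi \o X), measurable_fun setT (phi \o Y) &
      Ex P (phi \o X) = Ex Q (phi \o Y)].

Let open_law (O : set S) : open O ->
  [/\ measurable (X @^-1` O), measurable (Y @^-1` O) & P (X @^-1` O) = Q (Y @^-1` O)].
Proof.
move=> Oo; have Cc : closed (~` O) by exact: open_closedC.
(* For [O = setT] there is no distance to the complement, and both probabilities are [1]. *)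
have [[y Cy]|/nonemptyPn C0] := pselect ((~` O) !=set0); last first.
  have -> : O = setT by rewrite -(setCK O) C0 setC0.
  by rewrite (preimage_setT X) (preimage_setT Y) !probability_setT; split=> //; exact: measurableT.
have C0 : (~` O) !=set0 by exists y.
have pre d0 (T0 : measurableType d0) (P0 : probability T0 R) (Z : T0 -> S) :
    (forall k, measurable_fun setT (soft (~` O) k \o Z)) ->
    measurable (Z @^-1` O) /\ Ex P0 (soft (~` O) k \o Z) @[k --> \oo] --> fine (P0 (Z @^-1` O)).
  move=> mZ; have mO : measurable (Z @^-1` O).
    have -> : Z @^-1` O = setT `&` (soft (~` O) 0 \o Z) @^-1` `]0, +oo[.
      apply/seteqP; split=> w /=.
        by move=> Ow; split=> //; rewrite in_itv/= andbT; apply/soft_gt0 => //; apply: contrapT.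
      by move=> [_]; rewrite in_itv/= andbT => /soft_gt0 - /(_ Cc C0)/contrapT.
    exact: mZ.
  split=> //; have -> : fine (P0 (Z @^-1` O)) = Ex P0 (\1_(Z @^-1` O) : T0 -> R).
    by rewrite /Ex /Rintegral integral_indic// setIT.
  apply: (@Ex_cvg_ae _ _ _ P0 _ _ 1) => //; first by move=> k w; exact: norm_soft.
  by apply: aeW => w; have := @cvg_soft (~` O) (Z w) Cc C0; rewrite setCK.
have XYk k := XY (@continuous_soft _ k C0) (fun x => norm_soft k x C0).
have [|mX lX] := pre _ _ P X; first by move=> k; have [] := XYk k.
have [|mY lY] := pre _ _ Q Y; first by move=> k; have [] := XYk k.
split=> //; have E : (fun k => Ex P (soft (~` O) k \o X)) = (fun k => Ex Q (soft (~` O) k \o Y)).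
  by apply/funext => k; have [] := XYk k.
rewrite E in lX; have := cvg_unique (@Rhausdorff R) lX lY => /= fE.
by rewrite -[LHS]fineK ?fin_num_measure// -[RHS]fineK ?fin_num_measure// fE.
Qed.

Lemma same_law_continuous : same_law P Q X Y.
Proof.
(* Measurability of the preimages belongs to the invariant: [X] and [Y] are known to be measurable
   only through bounded continuous functions. *)
pose good (A : set S) := [/\ measurable (X @^-1` A), measurable (Y @^-1` A) & P (X @^-1` A) = Q (Y @^-1` A)].
suff H : <<s [set U : set S | open U] >> `<=` good by move=> A /H[].
rewrite -setI_closed_g_dynkin_g_sigma_algebra; last by move=> A B; exact: openI.
apply: smallest_sub; last by move=> A; exact: open_law.
split.
- by rewrite /good (preimage_setT X) (preimage_setT Y) !probability_setT; split=> //; exact: measurableT.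
- move=> A [mX mY E]; rewrite /good -(preimage_setC X) -(preimage_setC Y).
  by split; [exact: measurableC mX|exact: measurableC mY|rewrite !probability_setC// E].
- move=> F tF gF.
  have tpre (T0 : Type) (Z : T0 -> S) : trivIset setT (fun k => Z @^-1` F k).
    apply/trivIsetP => i j _ _ ij; apply/seteqP; split=> // w [Fi Fj].
    by have : (F i `&` F j) (Z w) by []; move/trivIsetP : tF => ->.
  rewrite /good (preimage_bigcup _ X) (preimage_bigcup _ Y); split.
  + by apply: bigcup_measurable => k _; have [] := gF k.
  + by apply: bigcup_measurable => k _; have [] := gF k.
  + have mX k : measurable (X @^-1` F k) by have [] := gF k.
    have mY k : measurable (Y @^-1` F k) by have [] := gF k.
    rewrite !measure_bigcup//.
    by apply: eq_eseriesr => k _; have [] := gF k.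
Qed.

End laws_from_continuous_functions.

Section equality_of_laws.
Context (R : realType) d (T : measurableType d) (P : probability T R).
Context d' (T' : measurableType d') (Q : probability T' R).

Lemma cvg_in_distribution_Ex (S : topologicalType) (X : nat -> T -> S) (Y : T' -> S) (phi : S -> R) (M : R) :
  cvg_in_distribution P Q X Y -> continuous phi -> (forall x, `|phi x| <= M) ->
  measurable_fun setT (phi \o Y) ->
  Ex P (fun w => phi (X N w)) @[N --> \oo] --> Ex Q (fun w => phi (Y w)).
Proof.
move=> XY cphi phiM mY; have := XY _ cphi (ex_intro _ M phiM).
rewrite expectation_Ex; last exact: (@intg_bounded _ _ _ Q _ M).
move=> /fine_cvgP[_].
by rewrite (_ : fine \o _ = fun N => Ex P (fun w => phi (X N w)))//; apply/funext => N; rewrite ExE.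
Qed.

(** The bound [1 - cos (u V) <= u^2 V^2] passes to the limit under the expectation, and
    [sqintg_of_cos] turns it back into a second moment of [Z]. *)
Lemma sqintg_cvg_cos (V : nat -> T -> R) (Z : T' -> R) (S : R) :
  (forall N, sqintg P (V N)) -> measurable_fun setT Z ->
  (\forall N \near \oo, Ex P (fun w => V N w ^+ 2) <= S) ->
  (forall u, Ex P (fun w => cos (u * V N w)) @[N --> \oo] --> Ex Q (fun w => cos (u * Z w))) ->
  sqintg Q Z.
Proof.
move=> Vs mZ VS VZ; apply: (@sqintg_of_cos _ _ _ Q Z S) => // u.
have ci d0 (T0 : measurableType d0) (P0 : probability T0 R) (f : T0 -> R) :
    measurable_fun setT f -> intg P0 (fun w => cos (u * f w)).
  by move=> mf; apply: mom_intg; apply: mom_cos; exact: measurable_funM.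
rewrite ExB ?Ex_cst; [|exact: intg_cst|exact: ci].
have c1 : (1 - Ex P (fun w => cos (u * V N w))) @[N --> \oo] --> 1 - Ex Q (fun w => cos (u * Z w)).
  by apply: cvgB; [exact: cvg_cst|exact: VZ].
apply: (ler_cvg_to c1 (cvg_cst _)).
apply: filterS VS => N VN; have [mV iV] := Vs N.
rewrite -[X in X - _](Ex_cst P).
rewrite -ExB; [|exact: intg_cst|exact: ci].
apply: (@le_trans _ _ (Ex P (fun w => u ^+ 2 * V N w ^+ 2))).
  apply: Ex_le; [by apply: intgB; [exact: intg_cst|exact: ci]|exact: intgZ|move=> w].
  by rewrite -exprMn; exact: cos_sub1_le.
by rewrite ExZ// ler_wpM2l// sqr_ge0.
Qed.

Context (n : nat) (X : 'I_n -> T -> R) (Y : 'I_n -> T' -> R).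
Hypotheses (Xs : forall i, sqintg P (X i)) (Ys : forall i, sqintg Q (Y i)).
Hypothesis XYcos : forall (u : 'I_n -> R) t,
  Ex P (fun w => cos (\sum_i u i * X i w + t)) = Ex Q (fun w => cos (\sum_i u i * Y i w + t)).

(** The continuity theorem applied to a constant sequence. *)
Lemma Ex_eq_of_cos (phi : 'rV[R]_n -> R) (M : R) : continuous phi -> (forall x, `|phi x| <= M) ->
  Ex P (fun w => phi (\row_i X i w)) = Ex Q (fun w => phi (\row_i Y i w)).
Proof.
move=> cphi phiM.
pose S := \sum_i Ex P (fun w => X i w ^+ 2).
have VS : \forall N \near \oo, forall i, Ex P (fun w => X i w ^+ 2) <= S.
  by apply: nearW => _ i; rewrite /S (bigD1 i)//= lerDl sumr_ge0// => j _; exact: Ex_sqr_ge0.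
have cosE (u : 'I_n -> R) (t : R) : Ex P (fun w => cos (\sum_i u i * X i w + t)) @[N --> \oo] -->
    Ex Q (fun w => cos (\sum_i u i * Y i w + t)).
  by rewrite XYcos; exact: cvg_cst.
have := cvg_bounded_continuous (V := fun=> X) (fun _ => Xs) Ys VS cosE cphi phiM.
exact: (cvg_unique (@Rhausdorff R) (cvg_cst _)).
Qed.

Lemma same_law_of_cos : same_law P Q (fun w => \row_i X i w) (fun w => \row_i Y i w).
Proof.
apply: same_law_continuous => phi cphi phi1; split.
- by apply: measurable_continuous_rV => // i; have [] := Xs i.
- by apply: measurable_continuous_rV => // i; have [] := Ys i.
- exact: Ex_eq_of_cos phi1.
Qed.

End equality_of_laws.

Lemma normal_law_of_cos (R : realType) d (T : measurableType d) (P : probability T R) (Z : {RV P >-> R}) (s : R) :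
  s != 0 -> sqintg P Z ->
  (forall u t, Ex P (fun w => cos (u * Z w + t)) = expR (- (s ^+ 2 * u ^+ 2) / 2) * cos t) ->
  normal_law P Z s.
Proof.
move=> s0 Zs Zcos; pose N : probability (measurableTypeR R) R := normal_prob (0 : R) s.
have idm : mom N (fun x => x) := mom_normal s0.
have H : same_law P N (fun w => Z w : R^o) (fun x : measurableTypeR R => x : R^o).
  apply: same_law_continuous => phi cphi phi1.
  have mphi : measurable_fun setT (phi : R -> R) by exact: continuous_measurable_fun.
  split.
  - exact: measurableT_comp mphi Zs.1.
  - exact: measurableT_comp mphi (mom_measurable idm).
  (* The line is viewed as the space of rows of length one. *)
  - pose psi (x : 'rV[R]_1) : R := phi (x 0 0).
    have cpsi : continuous psi.
      by move=> x; exact: (continuous_comp (@continuous_coord R 1 0 x) (cphi (x 0 0))).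
    have := @Ex_eq_of_cos _ _ _ P _ _ N 1 (fun=> Z) (fun=> (fun x => x)) (fun=> Zs)
      (fun=> mom_sqintg idm) _ psi 1 cpsi (fun x => phi1 _).
    rewrite /psi; under eq_Ex do rewrite mxE; under [in RHS]eq_Ex do rewrite mxE; apply => u t.
    under eq_Ex do rewrite big_ord1; under [RHS]eq_Ex do rewrite big_ord1.
    by rewrite Zcos normal_charfun.
move=> A mA; apply: H; have mA' : (@ocitv R).-sigma.-measurable A by exact: mA.
(* The half-open intervals that generate the measurable sets are exchanged for open ones, as
   [same_law] refers to the topology. *)
rewrite RGenOpens.measurableE in mA'; move: mA'.
by apply: sub_sigma_algebra2 => B [x [y ->]]; exact: interval_open.
Qed.

(** * Joint convergence *)

Lemma cvg_sumr (R : realType) (T J : Type) (G : set_system T) (s : seq J) (F : J -> T -> R) (l : J -> R) :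
  Filter G -> (forall j, F j x @[x --> G] --> l j) ->
  \sum_(j <- s) F j x @[x --> G] --> \sum_(j <- s) l j.
Proof.
move=> FG Fl; elim: s => [|j s IH].
  rewrite big_nil (_ : (fun x => _) = fun=> 0); first exact: cvg_cst.
  by apply/funext => x; rewrite big_nil.
rewrite big_cons (_ : (fun x => _) = fun x => F j x + \sum_(i <- s) F i x); first exact: cvgD.
by apply/funext => x; rewrite big_cons.
Qed.

Section joint_convergence.
Context (R : realType) (H : hilbertType R) d (T : measurableType d) (P : probability T R).
Context (W : H -> {RV P >-> R}) (HW : isonormal W) (p : nat) (p2 : (2 <= p)%N).
Context (K : tensor_power H p) (I : K -> {RV P >-> R}) (HI : multiple_integral W I).
Context (X : nat -> {RV P >-> R}) (f : nat -> K).
Hypothesis (fs : forall N, symmetric_tensor (f N)) (Xf : forall N, {ae P, forall w, X N w = I (f N) w}).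
Context (sigma : R) (sigma0 : sigma != 0).
Hypothesis Xcvg : cvg_in_distribution P (normal_prob 0 sigma) (fun N => X N : _ -> R) idfun.
Context (n : nat) (Y : nat -> 'I_n -> {RV P >-> R}) (YI : forall N j, wiener_chaos I (Y N j)).
Context d' (T' : measurableType d') (P' : probability T' R) (Ylim : 'I_n -> {RV P' >-> R}).
Hypothesis Ycvg : cvg_in_distribution P P' (fun N => random_vector (Y N)) (random_vector Ylim).
Context (rho : 'rV[R]_n).
Hypothesis XYcvg : forall j : 'I_n, 'E_P[fun w => X N w * Y N j w] @[N --> \oo] --> (rho 0 j)%:E.

Let N01 : probability (measurableTypeR R) R := normal_prob (0 : R) sigma.
Let mX N : measurable_fun setT (X N). Proof. exact: measurable_funPT. Qed.
Let mY N j : measurable_fun setT (Y N j). Proof. exact: measurable_funPT. Qed.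
Let mYlim j : measurable_fun setT (Ylim j). Proof. exact: measurable_funPT. Qed.

Let dotY v N w : R := euclidean_dot v (random_vector (Y N) w).
Let dotYlim v w : R := euclidean_dot v (random_vector Ylim w).

Let dotYE v N w : dotY v N w = \sum_j v 0 j * Y N j w.
Proof. by apply: eq_bigr => j _; rewrite mxE. Qed.

Let dotYlimE v w : dotYlim v w = \sum_j v 0 j * Ylim j w.
Proof. by apply: eq_bigr => j _; rewrite mxE. Qed.

Let mdotY v N : measurable_fun setT (dotY v N).
Proof.
rewrite (_ : dotY v N = fun w => \sum_j v 0 j * Y N j w); last by apply/funext => w; exact: dotYE.
by apply: measurable_sum => j; exact: measurable_funM.
Qed.

Let mdotYlim v : measurable_fun setT (dotYlim v).
Proof.
rewrite (_ : dotYlim v = fun w => \sum_j v 0 j * Ylim j w); last by apply/funext => w; exact: dotYlimE.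
by apply: measurable_sum => j; exact: measurable_funM.
Qed.

Let Xlaw : cvg_law P X N01 idfun.
Proof.
move=> phi cphi [M phiM]; apply: (cvg_in_distribution_Ex Xcvg cphi phiM).
exact: continuous_measurable_fun.
Qed.

Let Ylaw v : cvg_law P (dotY v) P' (dotYlim v).
Proof.
move=> phi cphi [M phiM].
have cv : continuous (fun x : 'rV[R]_n => phi (euclidean_dot v x)).
  by move=> x; exact: (continuous_comp (@continuous_euclidean_dot R n v x) (cphi _)).
apply: (cvg_in_distribution_Ex Ycvg cv (fun x => phiM _)).
exact: (measurableT_comp (continuous_measurable_fun cphi) (mdotYlim v)).
Qed.

Let approxX : exists2 s : nat -> seq (R * H), (forall N y, y \in s N -> `|y.2| = 1) &
  l2_close P X (fun N => hermite_sum W p (s N)).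
Proof. exact: (hermite_sum_approx HW HI (ltnW p2) fs mX Xf). Qed.

Let approxY v : exists2 s : nat -> seq (R * H), (forall N y, y \in s N -> `|y.2| = 1) &
  l2_close P (dotY v) (fun N => hermite_sum W p (s N)).
Proof.
have E N : exists g : K, symmetric_tensor g /\ {ae P, forall w, dotY v N w = I g w}.
  have [g gs gE] := wiener_chaos_comb HI (v 0) (YI N); exists g; split=> //.
  by apply: filterS gE => w <-; exact: dotYE.
have [g gP] := choice E.
exact: (hermite_sum_approx HW HI (ltnW p2) (fun N => (gP N).1) (mdotY v) (fun N => (gP N).2)).
Qed.

Let idm : mom N01 (fun x => x) := mom_normal sigma0.

Let N01_4 : Ex N01 (fun x => x ^+ 4) = 3 * Ex N01 (fun x => x ^+ 2) ^+ 2.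
Proof. by rewrite normal_moment4// normal_moment2//; ring. Qed.

Let sqX N : sqintg P (X N). Proof. by have [s _ XF] := approxX; exact: sqintg_l2 N XF. Qed.

Let sqdotY v N : sqintg P (dotY v N).
Proof. by have [s _ YG] := approxY v; exact: sqintg_l2 N YG. Qed.

Let coord_dot j : dotY (delta_mx 0 j) = (fun N => Y N j : _ -> R).
Proof.
apply/funext => N; apply/funext => w; rewrite dotYE (bigD1 j)//= big1 => [|k kj].
  by rewrite addr0 mxE !eqxx mul1r.
by rewrite mxE (negbTE kj) andbF mul0r.
Qed.

Let sqY N j : sqintg P (Y N j).
Proof. by have := sqdotY (delta_mx 0 j) N; rewrite coord_dot. Qed.

Let XYr v : Ex P (fun w => X N w * dotY v N w) @[N --> \oo] --> euclidean_dot rho v.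
Proof.
have E N : Ex P (fun w => X N w * dotY v N w) = \sum_j v 0 j * Ex P (fun w => X N w * Y N j w).
  have XYi j : intg P (fun w => X N w * Y N j w) by exact: sqintgM.
  rewrite (eq_Ex _ (g := fun w => \sum_j v 0 j * (X N w * Y N j w))); last first.
    by move=> w; rewrite dotYE mulr_sumr; apply: eq_bigr => j _; rewrite mulrCA.
  by rewrite Ex_sum => [|j]; [apply: eq_bigr => j _; rewrite ExZ|exact: intgZ].
rewrite (_ : (fun N => _) = fun N => \sum_j v 0 j * Ex P (fun w => X N w * Y N j w)); last exact/funext.
rewrite /euclidean_dot; under eq_bigr do rewrite mulrC.
apply: cvg_sumr => j; apply: cvgM; first exact: cvg_cst.
have /fine_cvgP[_] := XYcvg (j := j).
by rewrite (_ : fine \o _ = fun N => Ex P (fun w => X N w * Y N j w))//; apply/funext => N; rewrite ExE.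
Qed.

Let B0 : 0 <= 125 ^+ p :> R. Proof. exact: exprn_ge0. Qed.

(** For fixed [v] the variable [<v, Y_N>] lies in the same chaos as [X_N], so the vector case
    reduces to pairs of scalar variables. *)
Let pair_limit v u t :
  (Ex P (fun w => cos (u * X N w + (dotY v N w + t))) -
   Ex P (fun w => cos (dotY v N w + t)) * expR (- (u ^+ 2 * sigma ^+ 2 / 2 + u * euclidean_dot rho v)))
    @[N --> \oo] --> (0 : R).
Proof.
have [s s1 XF] := approxX; have [s' s1' YG] := approxY v.
have FG N := chaos_pair_hermite_sum HW p2 (s1 N) (s1' N).
have := chaos_pair_limit B0 FG XF YG idm N01_4 Xlaw (cvg_law_tight (mdotYlim v) (Ylaw (v := v))) (XYr (v := v)) u t.
by rewrite normal_moment2.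
Qed.

Let pair_bounded v : exists S : R,
  \forall N \near \oo, Ex P (fun w => X N w ^+ 2) <= S /\ Ex P (fun w => dotY v N w ^+ 2) <= S.
Proof.
have [s s1 XF] := approxX; have [s' s1' YG] := approxY v.
have FG N := chaos_pair_hermite_sum HW p2 (s1 N) (s1' N).
exact: (chaos_pair_bounded B0 FG XF YG idm N01_4 Xlaw (cvg_law_tight (mdotYlim v) (Ylaw (v := v)))).
Qed.

(** The pair as a single row of length [1 + n], so that the results on random rows apply. *)
Definition joint N (i : 'I_(1 + n)) w : R := row_mx (\row_(_ < 1) X N w) (random_vector (Y N) w) 0 i.

Lemma jointl N j w : joint N (lshift n j) w = X N w.
Proof. by rewrite /joint row_mxEl mxE. Qed.

Lemma jointr N j w : joint N (rshift 1 j) w = Y N j w.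
Proof. by rewrite /joint row_mxEr mxE. Qed.

Let joint_sum (c : 'I_(1 + n) -> R) N w : \sum_i c i * joint N i w =
  c (lshift n ord0) * X N w + dotY (\row_j c (rshift 1 j)) N w.
Proof.
rewrite big_split_ord/= big_ord1 jointl dotYE; congr (_ + _).
by apply: eq_bigr => j _; rewrite jointr mxE.
Qed.

Let sq_joint N i : sqintg P (joint N i).
Proof.
rewrite (_ : joint N i = fun w => joint N i w)//; case: (split_ordP i) => j ->.
  by under eq_fun do rewrite jointl.
by under eq_fun do rewrite jointr.
Qed.

Let joint_bounded : exists2 S : R, 0 <= S &
  \forall N \near \oo, forall i, Ex P (fun w => joint N i w ^+ 2) <= S.
Proof.
have E i : exists S : R, \forall N \near \oo, Ex P (fun w => joint N i w ^+ 2) <= S.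
  case: (split_ordP i) => j ->.
    have [S HS] := pair_bounded 0; exists S; apply: filterS HS => N [HS _].
    by under eq_Ex do rewrite jointl.
  have [S HS] := pair_bounded (delta_mx 0 j); exists S; apply: filterS HS => N [_ HS].
  by under eq_Ex do rewrite jointr; rewrite coord_dot in HS.
have [S HS] := choice E; exists (\sum_i `|S i|); first by apply: sumr_ge0.
have : \forall N \near \oo, forall i, Ex P (fun w => joint N i w ^+ 2) <= S i by exact: filter_forall.
apply: filterS => N HN i; rewrite (le_trans (HN i))// (le_trans (ler_norm _))//.
by rewrite (bigD1 i)//= lerDl sumr_ge0.
Qed.

(** Real form of the limiting characteristic function; the Gaussian factor is real, so the phase [t]
    stays with [Y]. *)
Definition limit_cos u v t : R := Ex P' (fun w => cos (euclidean_dot v (random_vector Ylim w) + t)) *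
  expR (- (u ^+ 2 * sigma ^+ 2 / 2 + u * euclidean_dot rho v)).

Let joint_cos (c : 'I_(1 + n) -> R) t : Ex P (fun w => cos (\sum_i c i * joint N i w + t)) @[N --> \oo] -->
  limit_cos (c (lshift n ord0)) (\row_j c (rshift 1 j)) t.
Proof.
set u := c _; set v := \row_j _.
have cY : Ex P (fun w => cos (dotY v N w + t)) @[N --> \oo] --> Ex P' (fun w => cos (dotYlim v w + t)).
  apply: (Ylaw (v := v) (phi := fun x => cos (x + t))).
    by move=> x; apply: continuous_comp; [apply: cvgD; [exact: cvg_id|exact: cvg_cst]|exact: continuous_cos].
  by exists 1 => x; rewrite ler_norml cos_geN1 cos_le1.
pose e := expR (- (u ^+ 2 * sigma ^+ 2 / 2 + u * euclidean_dot rho v)).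
have c2 : (Ex P (fun w => cos (dotY v N w + t)) * e) @[N --> \oo] --> limit_cos u v t.
  by apply: cvgM => //; exact: cvg_cst.
have c3 : (Ex P (fun w => cos (u * X N w + (dotY v N w + t))) - Ex P (fun w => cos (dotY v N w + t)) * e +
    Ex P (fun w => cos (dotY v N w + t)) * e) @[N --> \oo] --> limit_cos u v t.
  by rewrite -[limit_cos _ _ _]add0r; apply: cvgD => //; exact: pair_limit.
rewrite (_ : (fun N => _) = fun N => Ex P (fun w => cos (u * X N w + (dotY v N w + t))) -
  Ex P (fun w => cos (dotY v N w + t)) * e + Ex P (fun w => cos (dotY v N w + t)) * e)//.
by apply/funext => N; rewrite subrK; apply: eq_Ex => w; rewrite joint_sum addrA.
Qed.

(** The limit inherits a second moment from the bounded ones of [Y_N]; the comparison of laws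
    through cosines relies on it. *)
Lemma sqintg_limit j : sqintg P' (Ylim j).
Proof.
have [S HS] := pair_bounded (delta_mx 0 j).
apply: (@sqintg_cvg_cos _ _ _ P _ _ _ (fun N => Y N j) (Ylim j) S) => //.
  by apply: filterS HS => N [_]; rewrite coord_dot.
move=> u; have := @Ylaw (delta_mx 0 j) (fun x => cos (u * x)); rewrite coord_dot.
rewrite (_ : dotYlim _ = Ylim j); last first.
  apply/funext => w; rewrite dotYlimE (bigD1 j)//= big1 => [|k kj].
    by rewrite addr0 mxE !eqxx mul1r.
  by rewrite mxE (negbTE kj) andbF mul0r.
apply.
  move=> x; apply: continuous_comp; last exact: continuous_cos.
  by apply: cvgM; [exact: cvg_cst|exact: cvg_id].
by exists 1 => x; rewrite ler_norml cos_geN1 cos_le1.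
Qed.

Lemma joint_limit : exists (Z : {RV (uniform_prob (@ltr01 R)) >-> R}) (Y' : 'I_n -> {RV (uniform_prob (@ltr01 R)) >-> R}),
  [/\ sqintg (uniform_prob (@ltr01 R)) Z, forall j, sqintg (uniform_prob (@ltr01 R)) (Y' j),
   (forall u v t, Ex (uniform_prob (@ltr01 R))
     (fun w => cos (u * Z w + euclidean_dot v (random_vector Y' w) + t)) = limit_cos u v t) &
   cvg_in_distribution P (uniform_prob (@ltr01 R)) (fun N w => (X N w, random_vector (Y N) w))
     (fun w => (Z w, random_vector Y' w))].
Proof.
have [S S0 VS] := joint_bounded.
have [z mz zcos] := limit_law sq_joint S0 VS.
have zE c t := zcos c t _ (joint_cos (c := c) (t := t)).
have zs i : sqintg (uniform_prob (@ltr01 R)) (z i).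
  apply: (@sqintg_cvg_cos _ _ _ P _ _ _ (fun N => joint N i) (z i) S) => //.
    by apply: filterS VS => N; exact.
  (* A single coordinate is written as a linear combination of all, to which [joint_cos] applies. *)
  move=> u; pose c k := if k == i then u else 0.
  have cE (x : 'I_(1 + n) -> R) : u * x i = \sum_k c k * x k + 0.
    rewrite addr0 (bigD1 i)//= /c eqxx big1 ?addr0// => k /negbTE->; exact: mul0r.
  rewrite (eq_Ex _ (fun w => congr1 cos (cE (z^~ w)))) zE.
  rewrite (_ : (fun N => _) = fun N => Ex P (fun w => cos (\sum_k c k * joint N k w + 0))).
    exact: joint_cos.
  by apply/funext => N; apply: eq_Ex => w; rewrite -cE.
pose Z : {RV (uniform_prob (@ltr01 R)) >-> R} := mfun_Sub (mem_set (mz (lshift n ord0))).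
pose Y' j : {RV (uniform_prob (@ltr01 R)) >-> R} := mfun_Sub (mem_set (mz (rshift 1 j))).
exists Z, Y'; split; [exact: zs|by move=> j; exact: zs| |].
  move=> u v t; pose c := row_mx (\row_(_ < 1) u) v 0.
  have c0 : c (lshift n ord0) = u by rewrite /c row_mxEl mxE.
  have cr : \row_j c (rshift 1 j) = v by apply/rowP => j; rewrite mxE /c row_mxEr.
  have := zE c t; rewrite c0 cr => <-; apply: eq_Ex => w.
  rewrite big_split_ord/= big_ord1 c0; congr (cos (_ + _ + _)).
  by apply: eq_bigr => j _; rewrite mxE /c row_mxEr.
move=> phi cphi [M phiM].
pose psi (x : 'rV[R]_(1 + n)) : R := phi (x 0 (lshift n ord0), rsubmx x).
have cpsi : continuous psi.
  move=> x; apply: (continuous_comp _ (cphi _)).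
  exact: (cvg_pair (@continuous_coord R _ _ x) (@continuous_rsubmx _ _ _ _ x)).
have psiM x : `|psi x| <= M by exact: phiM.
have zc c t : Ex P (fun w => cos (\sum_i c i * joint N i w + t)) @[N --> \oo] -->
    Ex (uniform_prob (@ltr01 R)) (fun w => cos (\sum_i c i * z i w + t)).
  by rewrite zE; exact: joint_cos.
have psi_cvg := cvg_bounded_continuous sq_joint zs VS zc cpsi psiM.
have E1 N w : psi (\row_i joint N i w) = phi (X N w, random_vector (Y N) w).
  by rewrite /psi mxE jointl; congr (phi (_, _)); apply/rowP => j; rewrite !mxE jointr.
have E2 w : psi (\row_i z i w) = phi (Z w, random_vector Y' w).
  by rewrite /psi mxE; congr (phi (_, _)); apply/rowP => j; rewrite !mxE.
have i1 N : intg P (fun w => phi (X N w, random_vector (Y N) w)).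
  apply: (@intg_bounded _ _ _ P _ M) => //.
  under eq_fun do rewrite -E1; apply: measurable_continuous_rV => // i.
  by have [] := sq_joint N i.
have i2 : intg (uniform_prob (@ltr01 R)) (fun w => phi (Z w, random_vector Y' w)).
  apply: (@intg_bounded _ _ _ _ _ M) => //.
  by under eq_fun do rewrite -E2; apply: measurable_continuous_rV.
rewrite expectation_Ex//; under eq_fun do rewrite expectation_Ex//.
apply: cvg_EFin; first by apply: nearW.
move: psi_cvg; under eq_fun do under eq_Ex do rewrite E1.
by rewrite (eq_Ex _ E2).
Qed.

End joint_convergence.

Theorem theorem2
  (R : realType)
  (H : hilbertType R) (Hsep : separable H)
  (dO : measure_display) (Omega : measurableType dO) (P : probability Omega R)
  (W : H -> {RV P >-> R}) (HW : isonormal W)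
  (p : nat) (Hp : (2 <= p)%N)
  (K : tensor_power H p)
  (I : K -> {RV P >-> R}) (HI : multiple_integral W I)
  (X : nat -> {RV P >-> R}) (f : nat -> K)
  (Hf : forall N, symmetric_tensor (f N))
  (HX : forall N, {ae P, forall w, X N w = I (f N) w})
  (sigma : R) (Hsigma : 0 < sigma ^+ 2)
  (HXcvg : cvg_in_distribution P (normal_prob 0 sigma) (fun N => X N : _ -> R) idfun)
  (d : nat) (Hd : (0 < d)%N)
  (Y : nat -> 'I_d -> {RV P >-> R})
  (HY : forall N j, wiener_chaos I (Y N j))
  (dO' : measure_display) (Omega' : measurableType dO')
  (P' : probability Omega' R)
  (Ylim : 'I_d -> {RV P' >-> R})
  (HYcvg : cvg_in_distribution P P'
    (fun N => random_vector (Y N)) (random_vector Ylim))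
  (rho : 'rV[R]_d)
  (Hrho : forall j : 'I_d,
    'E_P[fun w => X N w * Y N j w] @[N --> \oo] --> (rho 0 j)%:E) :
  exists (dQ : measure_display) (OmegaQ : measurableType dQ)
    (Q : probability OmegaQ R)
    (Z : {RV Q >-> R}) (Y' : 'I_d -> {RV Q >-> R}),
    [/\ normal_law Q Z sigma,
        same_law Q P' (random_vector Y') (random_vector Ylim),
        (forall (u : R) (v : 'rV[R]_d),
          complex_expectation Q
            (fun w => expi (u * Z w + euclidean_dot v (random_vector Y' w))) =
          complex_expectation P'
            (fun w => expi (euclidean_dot v (random_vector Ylim w))) *
          real_complex R (expR (- (sigma ^+ 2 * u ^+ 2 / 2) -
                                u * euclidean_dot rho v))) &
        cvg_in_distribution P Q
          (fun N w => (X N w, random_vector (Y N) w))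
          (fun w => (Z w, random_vector Y' w))].
Proof.
(* The hypothesis allows a negative [sigma]; the argument works from [sigma != 0]. *)
have s0 : sigma != 0 by apply: contraTneq Hsigma => ->; rewrite expr0n ltxx.
have [Z [Y' [Zs Ys cosE cvgE]]] := joint_limit HW Hp HI Hf HX s0 HXcvg HY HYcvg Hrho.
have Yls := sqintg_limit HW Hp HI Hf HX s0 HXcvg HY HYcvg.
exists _, _, (uniform_prob (@ltr01 R)), Z, Y'; split=> //.
(* With [v = 0] only the Gaussian factor remains. *)
- apply: normal_law_of_cos => // u t; have := cosE u 0 t.
  rewrite /limit_cos; have dot0 : forall x : 'rV[R]_d, euclidean_dot 0 x = 0 by exact: euclidean_dot0l.
  under eq_Ex do rewrite dot0 addr0; move=> ->.
  under eq_Ex do rewrite dot0 add0r; rewrite Ex_cst mulrC; congr (expR _ * _).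
  rewrite /euclidean_dot big1 => [|j _]; last by rewrite mxE mulr0.
  by rewrite mulr0 addr0 mulNr (mulrC (sigma ^+ 2)).
(* With [u = 0] the Gaussian factor is [1]. *)
- apply: same_law_of_cos => // u t; have := cosE 0 (\row_j u j) t.
  rewrite /limit_cos expr0n/= !mul0r addr0 oppr0 expR0 mulr1 => E.
  apply: etrans (etrans E _); apply: eq_Ex => w; rewrite ?mul0r ?add0r; congr (cos (_ + _));
    by apply: eq_bigr => j _; rewrite !mxE.
- move=> u v; set e := expR _.
  have eE : e = expR (- (u ^+ 2 * sigma ^+ 2 / 2 + u * euclidean_dot rho v)).
    by rewrite /e; congr expR; ring.
  (* The imaginary part is the cosine identity at the phase [- pi / 2]. *)
  have sinE (T0 : Type) (g : T0 -> R) w : sin (g w) = cos (g w + - (pi / 2)) by rewrite cosBpihalf.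
  have H0 := cosE u v 0; have H1 := cosE u v (- (pi / 2)).
  rewrite /limit_cos -eE in H0 H1.
  apply/eqP; rewrite eq_complex /complex_expectation /= !mulr0 subr0 add0r -!ExE; apply/andP; split; apply/eqP.
    under eq_Ex do rewrite -[u * _ + _]addr0; rewrite H0; congr (_ * _).
    by apply: eq_Ex => w; rewrite addr0.
  under eq_Ex do rewrite sinE; rewrite H1; congr (_ * _).
  by apply: eq_Ex => w; rewrite sinE.
Qed.
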